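(* Consider the ternary recurrence sequence given by $$C_0=0,\quad C_1=0,\quad C_2=1,\qquad C_{n+3}=C_{n+2}+C_n\quad (n\ge 0).$$ Let $p$ be a prime with $p\nmid 2\cdot 3\cdot 29\cdot 31$. The following assertions are equivalent: \begin{enumerate} \item $C_p\equiv 0\pmod p$. \item $p=X^2+31Y^2$ for some $X,Y\in\mathbb{Z}$. \item $\tau_{16}(p)\equiv 2\pmod{31}$. \end{enumerate}
   Context: $\tau_{16}(n)$ denotes the coefficient of $x^n$ in the formal power series expansion of $$x\Bigl(1+240\sum_{k=1}^{\infty}x^k\sum_{d\mid k}d^3\Bigr)\prod_{k=1}^{\infty}(1-x^k)^{24},$$ i.e. the $n$-th Fourier coefficient of the cusp form $\Delta E_4$ of weight $16$. *)

(* Defs.v *)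
From mathcomp Require Import all_boot all_order all_algebra.
Set Implicit Arguments.
Unset Strict Implicit.
Unset Printing Implicit Defensive.

Import GRing.Theory.

Local Open Scope ring_scope.

Fixpoint C (n : nat) : int :=
  match n with
  | 0%N | 1%N => 0
  | 2%N => 1
  | (m.+2 as m2).+1 => C m2 + C m
  end.

(* A formal power series over the integers is given by its coefficients. *)
Definition fps := nat -> int.

Definition fps_mul (f g : fps) : fps :=
  fun n => \sum_(i < n.+1) f i * g (n - i)%N.

Definition fps_X : fps := fun n => (n == 1%N)%:R.

Definition E4 : fps := fun n =>
  if n == 0%N then 1 else 240%:R * \sum_(d <- divisors n) (d ^ 3)%N%:Z.

(* \prod_(k >= 1) (1 - x^k)^24: multiplying by a factor with k > n leaves the
   coefficient of x^n unchanged, so the partial product up to n determines it;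
   see euler24_stable. *)
Definition euler24 : fps := fun n =>
  (\prod_(1 <= k < n.+1) (1 - 'X^k) ^+ 24 : {poly int})`_n.

Definition tau16 : fps := fps_mul (fps_mul fps_X E4) euler24.

Lemma euler24_stable (n N : nat) : (n <= N)%N ->
  (\prod_(1 <= k < N.+1) (1 - 'X^k) ^+ 24 : {poly int})`_n = euler24 n.
Proof.
move=> /subnKC <-; elim: (N - n)%N => [|m IHm]; first by rewrite addn0.
rewrite addnS big_nat_recr //= -{}IHm; move: (\prod_(_ <= _ < _) _) => q.
elim: 24%N => [|e IHe]; first by rewrite expr0 mulr1.
rewrite exprSr mulrA mulrBr mulr1 coefB coefMXn ltnS leq_addr.
by rewrite subr0.
Qed.

(* Main.v *)
Require Import Defs.
From HB Require Import structures.
From mathcomp Require Import all_boot all_order all_fingroup all_solvable all_algebra all_field.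
From mathcomp Require Import boolp ring zify.
Set Implicit Arguments.
Unset Strict Implicit.
Unset Printing Implicit Defensive.
Import GRing.Theory Order.TTheory Num.Theory.
Local Open Scope ring_scope.

(* (1) <-> (2): [p] divides [C p] iff the Frobenius of [p] fixes the three roots
   of [t^3 - t^2 - 1]. In that case the square root of the discriminant -31 is
   rational mod [p], and reduction of forms gives [p = X^2 + 31 Y^2] or
   [8 p = x^2 + 31 y^2] with [x], [y] odd. By Cardano's formula the roots are
   [(1 + z^i x + z^-i / x) / 3] where [x^3] is the unit [(29 + 3 sqrt 93) / 2],
   so it remains to decide whether this unit is a cube in the field with [p^2]
   elements. Write [u^2 + 31 v^2 = 2^(k+2) p] with [u], [v] odd; then [u / v] is
   a square root of -31, and the unit becomes an Eisenstein integer of norm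
   [27 2^k p + v^2] divided by [v]. Rational cubic reciprocity, proved from Gauss
   and Jacobi sums, turns its cubic symbol at [p] into that of [2] to the power
   [k], up to sign: the unit is a cube iff [3] divides [k]. Here [k = 3] occurs
   for [p = X^2 + 31 Y^2] and [k = 1] or [4] otherwise.

   (2) <-> (3): for [phi = \sum_n x^(n^2)], the relations
   [phi(x)^2 + phi(-x)^2 = 2 phi(x^2)^2] and [phi(x) phi(-x) = phi(-x^2)^2] of the
   arithmetic-geometric mean determine the logarithmic derivative of [phi]. With
   [c = phi(x)^4], [b = phi(-x)^4] and [a = c - b] they give
   [256 Delta(x^2) = (a b c)^2] and [E4(x^2) = a^2 + a b + b^2]. Modulo 31 the
   product is a combination of 32nd powers of theta series, and
   [f^32 = f(x) f(x^31)], so that the coefficient at [p] counts representations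
   of [p] and [8 p] by [x^2 + 31 y^2]. *)

(** * Representations by binary forms of discriminant -31 *)

(** The polynomial [t^3 - t^2 - 1] has discriminant -31 and its splitting field is the Hilbert class
    field of Q(sqrt -31), whose class number is 3; hence the role of the form [X^2 + 31 Y^2]. Cubic
    reciprocity takes the place of class field theory. The obstacle is that reciprocity needs an
    Eisenstein integer, where the unit only gives a residue modulo [p]. Representing a multiple of
    [p] supplies the lift, and the multiplier is a power of 2 because the symbol of 2 is known and
    nontrivial. Gauss sums take values in an arbitrary field: over [algC] they give the norm of a
    Jacobi sum, in characteristic [q] its symbol at [q], so that no ring of cyclotomic integers has
    to be reduced. On the modular side, a series with zero constant term that is a constant multiple
    of its image under [x -> x^2] vanishes, and the key identities between theta series are verified
    by such functional equations. The modulus fits the weight: [Delta E4] has weight 16, the weight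
    of a 32nd power of a theta series, and [32 = 31 + 1]. *)

Lemma prime_dvd_mulz (p : nat) (a b : int) : prime p ->
  (p %| a * b)%Z -> (p %| a)%Z \/ (p %| b)%Z.
Proof.
move=> pp; rewrite !dvdzE abszM Euclid_dvdM // => /orP.
by case; [left|right].
Qed.

(* Two representations of [k * p] and [l * p] by [x ^ 2 + 31 y ^ 2] compose to
   [k * l * p ^ 2 = (x u + 31 y v) ^ 2 + 31 (x v - u y) ^ 2], where [p] divides
   one of [x v - u y] and [x v + u y]. *)
Lemma compose_representations (p : nat) (k l x y u v : int) : prime p ->
  k * p%:Z = x ^+ 2 + 31%:R * y ^+ 2 -> l * p%:Z = u ^+ 2 + 31%:R * v ^+ 2 ->
  exists (s t : int), [/\ s = 1 \/ s = -1, x * v - s * (u * y) = t * p%:Z &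
    31%:R * t ^+ 2 <= k * l].
Proof.
move=> pp e1 e2; have p0 : (0 < p%:Z) by rewrite ltz_nat prime_gt0.
have : (p %| (x * v - u * y) * (x * v + u * y))%Z.
  apply/dvdzP; exists (k * v ^+ 2 - l * y ^+ 2).
  rewrite [RHS](_ : _ = (k * p%:Z) * v ^+ 2 - (l * p%:Z) * y ^+ 2); last by ring.
  by rewrite e1 e2; ring.
have bound s t : (s = 1 \/ s = -1) -> x * v - s * (u * y) = t * p%:Z ->
    31%:R * t ^+ 2 <= k * l.
  move=> s1 et; have s2 : s ^+ 2 = 1 by case: s1 => ->.
  have p2 : 0 < p%:Z ^+ 2 by rewrite exprn_gt0.
  rewrite -(ler_pM2r p2).
  have -> : k * l * p%:Z ^+ 2 = (x * u + s * (31%:R * (y * v))) ^+ 2 +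
      31%:R * (x * v - s * (u * y)) ^+ 2.
    rewrite [LHS](_ : _ = (k * p%:Z) * (l * p%:Z)); last by ring.
    rewrite e1 e2.
    rewrite [RHS](_ : _ = (x * u) ^+ 2 + 31%:R * (x * v) ^+ 2 +
      s ^+ 2 * (961%:R * (y * v) ^+ 2 + 31%:R * (u * y) ^+ 2)); last by ring.
    by rewrite s2; ring.
  rewrite et [X in _ <= _ + X](_ : _ = 31%:R * t ^+ 2 * p%:Z ^+ 2); last by ring.
  by rewrite lerDr sqr_ge0.
case/prime_dvd_mulz => // /dvdzP[t et].
- by exists 1, t; split; [left | rewrite mul1r | apply: (bound 1); [left | rewrite mul1r]].
have {}et : x * v - -1 * (u * y) = t * p%:Z by rewrite mulN1r opprK.
by exists (-1), t; split; [right | | apply: (bound (-1)); [right |]].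
Qed.

Lemma compose_cross (p : nat) (k l x y u v s : int) : prime p -> (s = 1 \/ s = -1) ->
  k * p%:Z = x ^+ 2 + 31%:R * y ^+ 2 -> l * p%:Z = u ^+ 2 + 31%:R * v ^+ 2 ->
  x * v = s * (u * y) -> k * v ^+ 2 = l * y ^+ 2.
Proof.
move=> pp s1 e1 e2 e; have s2 : s ^+ 2 = 1 by case: s1 => ->.
have p0 : p%:Z != 0 by rewrite eqz_nat -lt0n prime_gt0.
apply: (mulIf p0).
rewrite [LHS](_ : _ = (k * p%:Z) * v ^+ 2); last by ring.
rewrite [RHS](_ : _ = (l * p%:Z) * y ^+ 2); last by ring.
have : (x * v) ^+ 2 = (u * y) ^+ 2 by rewrite e exprMn s2 mul1r.
by rewrite e1 e2 !exprMn => e'; rewrite !mulrDl e'; ring.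
Qed.

(** The bound 64 is the product [k l] for two representations of [8 p], the largest that occurs. *)
Lemma small_square (t : int) : 31%:R * t ^+ 2 <= 64%:R -> t = -1 \/ t = 0 \/ t = 1.
Proof.
move=> t64; suff: `|t| < 2 by lia.
have: `|t| ^+ 2 < 2 ^+ 2 :> int by rewrite real_normK ?num_real; lia.
by rewrite ltr_pXn2r // ?nnegrE.
Qed.

Lemma sqrz_nat_inj (m n : nat) : m%:Z ^+ 2 = n%:Z ^+ 2 -> m = n.
Proof. by move/eqP; rewrite eqrXn2 // => /eqP[]. Qed.

Lemma representation_unique (p x y u v : nat) : prime p ->
  (p = x ^ 2 + 31 * y ^ 2 -> p = u ^ 2 + 31 * v ^ 2 -> v = y)%N.
Proof.
move=> pp e1 e2.
have E1 : 1 * p%:Z = x%:Z ^+ 2 + 31%:R * y%:Z ^+ 2 by lia.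
have E2 : 1 * p%:Z = u%:Z ^+ 2 + 31%:R * v%:Z ^+ 2 by lia.
have [s [t [s1 et bt]]] := compose_representations pp E1 E2.
have t0 : t = 0.
  have [et1|[//|et1]] : t = -1 \/ t = 0 \/ t = 1 by apply: small_square; lia.
    by rewrite et1 in bt.
  by rewrite et1 in bt.
have xv : x%:Z * v%:Z = s * (u%:Z * y%:Z) by apply/eqP; rewrite -subr_eq0 et t0 mul0r.
have := compose_cross pp s1 E1 E2 xv; rewrite !mul1r.
exact: sqrz_nat_inj.
Qed.

Lemma representation8_unique (p x y u v : nat) : prime p -> odd p ->
  odd x -> odd y -> odd u -> odd v ->
  (8 * p = x ^ 2 + 31 * y ^ 2 -> 8 * p = u ^ 2 + 31 * v ^ 2 -> v = y)%N.
Proof.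
move=> pp op ox oy ou ov e1 e2.
have E1 : 8%:R * p%:Z = x%:Z ^+ 2 + 31%:R * y%:Z ^+ 2 by lia.
have E2 : 8%:R * p%:Z = u%:Z ^+ 2 + 31%:R * v%:Z ^+ 2 by lia.
have [s [t [s1 et bt]]] := compose_representations pp E1 E2.
have t0 : t = 0.
  (* The bound leaves [t = 1] and [t = -1]. Parity excludes them: [x v] and [u y] are odd, so [t p]
     is even. *)
  have bt1 := small_square bt.
  have oxv : odd (x * v) by rewrite oddM ox.
  have ouy : odd (u * y) by rewrite oddM ou.
  rewrite -!PoszM in et; move: (x * v)%N (u * y)%N oxv ouy et => m n om on et.
  by case: s1 et => ->; case: bt1 => [|[|]] -> et //; exfalso; lia.
have xv : x%:Z * v%:Z = s * (u%:Z * y%:Z) by apply/eqP; rewrite -subr_eq0 et t0 mul0r.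
have := compose_cross pp s1 E1 E2 xv.
by move/(mulfI (isT : 8%:R != 0 :> int))/sqrz_nat_inj.
Qed.

(** With [t = 0] the cross products agree, which gives [y^2 = 8 Y^2] and makes [y] even. *)
Lemma representations_exclusive (p : nat) (X Y x y : int) : prime p ->
  p%:Z = X ^+ 2 + 31%:R * Y ^+ 2 -> 8%:R * p%:Z = x ^+ 2 + 31%:R * y ^+ 2 ->
  ~~ (2%:Z %| y)%Z -> False.
Proof.
move=> pp e1 e2 oy.
have E1 : 1 * p%:Z = X ^+ 2 + 31%:R * Y ^+ 2 by rewrite mul1r.
have [s [t [s1 et bt]]] := compose_representations pp E1 e2.
have t0 : t = 0.
  have [et1|[//|et1]] : t = -1 \/ t = 0 \/ t = 1 by apply: small_square; lia.
    by rewrite et1 in bt.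
  by rewrite et1 in bt.
have xv : X * y = s * (x * Y) by apply/eqP; rewrite -subr_eq0 et t0 mul0r.
have := compose_cross pp s1 E1 e2 xv; rewrite mul1r => e; case/negP: oy; have : (2%:Z %| y ^+ 2)%Z.
  by apply/dvdzP; exists (4%:R * Y ^+ 2); rewrite e; ring.
by rewrite expr2 => /(prime_dvd_mulz (isT : prime 2)) [].
Qed.

Definition represents (a b c p : int) :=
  exists x y : int, p = a * x ^+ 2 + b * x * y + c * y ^+ 2.

Lemma forms_disc31 (a b c p : int) : 0 < a -> b ^+ 2 + 31%:R = 4%:R * a * c ->
  represents a b c p ->
  represents 1 1 8%:R p \/ represents 2%:R 1 4%:R p.
Proof.
have [n] := ubnP `|a|%N; elim: n a b c => // n IH a b c ltan a0 disc rep.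
have [k [k1 k2]] : exists k : int, - a < b - 2%:R * a * k /\ b - 2%:R * a * k <= a.
  exists ((b + a - 1) %/ (2%:R * a))%Z.
  have a2 : 2%:R * a != 0 by lia.
  have := divz_eq (b + a - 1) (2%:R * a); have := modz_ge0 (b + a - 1) a2.
  have := ltz_mod (b + a - 1) a2.
  rewrite gtr0_norm; last by lia.
  move: (_ %/ _)%Z (_ %% _)%Z => q r; lia.
have {rep} : represents a (b - 2%:R * a * k) (a * k ^+ 2 - b * k + c) p.
  case: rep => x [y ->]; exists (x + k * y), y; ring.
have : (b - 2%:R * a * k) ^+ 2 + 31%:R = 4%:R * a * (a * k ^+ 2 - b * k + c).
  by rewrite [RHS](_ : _ = 4%:R * a * c + (4%:R * a * (a * k ^+ 2 - b * k)));
    [rewrite -disc; ring | ring].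
move: (b - _) (a * k ^+ 2 - b * k + c) k1 k2 => {k}b' c' lo hi {}disc rep.
have [ltca|leac] := ltP c' a.
  have c0 : 0 < c'.
    have: 0 < 4%:R * a * c' by rewrite -disc ltr_wpDl ?sqr_ge0.
    by rewrite pmulr_rgt0 // mulr_gt0.
  apply: (IH c' b' a) => //; first by lia.
    by rewrite disc; ring.
  by case: rep => x [y ->]; exists y, x; ring.
have b2 : b' ^+ 2 <= a ^+ 2.
  rewrite -subr_ge0 subr_sqr mulr_ge0 //; lia.
(* A reduced form has [4 a^2 <= 4 a c = b^2 + 31 <= a^2 + 31]. *)
have a3 : a <= 3%:R.
  have : 4%:R * a ^+ 2 <= 4%:R * a * c' by rewrite expr2 mulrA ler_pM2l // mulr_gt0.
  rewrite -disc => a4; rewrite leNgt; apply/negP => a3'.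
  have : 4%:R ^+ 2 <= a ^+ 2 by rewrite lerXn2r // nnegrE; lia.
  by lia.
case: rep => x [y e].
have [a1|[a2|a3']] : a = 1 \/ a = 2%:R \/ a = 3%:R by lia.
- have b1 : b' = 0 \/ b' = 1 by lia.
  case: b1 => b1; rewrite a1 b1 in disc e; first by exfalso; lia.
  have c8 : c' = 8%:R by lia.
  by left; exists x, y; rewrite e c8.
- have b1 : b' = -1 \/ b' = 0 \/ b' = 1 \/ b' = 2%:R by lia.
  case: b1 => [b1|[b1|[b1|b1]]]; rewrite a2 b1 in disc e; try by exfalso; lia.
    have c4 : c' = 4%:R by lia.
    by right; exists x, (- y); rewrite e c4; ring.
  have c4 : c' = 4%:R by lia.
  by right; exists x, y; rewrite e c4.
- have b1 : b' = -2%:R \/ b' = -1 \/ b' = 0 \/ b' = 1 \/ b' = 2%:R \/ b' = 3%:R by lia.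
  case: b1 => [b1|[b1|[b1|[b1|[b1|b1]]]]]; rewrite a3' b1 in disc; exfalso; lia.
Qed.

Lemma odd_intE (x : int) : exists k e, x = 2%:R * k + e /\ (e = 0 \/ e = 1).
Proof.
exists (x %/ 2)%Z, (x %% 2)%Z; split; last by lia.
by rewrite {1}(divz_eq x 2) mulrC.
Qed.

(** A square root [b] of -31 modulo [4 p] makes [p] the leading coefficient of a form of
    discriminant -31. *)
Lemma split_prime_forms (p : nat) (s : int) : prime p -> odd p ->
  (p %| s ^+ 2 + 31%:R)%Z ->
  (exists X Y : int, p%:Z = X ^+ 2 + 31%:R * Y ^+ 2) \/
  (exists x y : int, [/\ 8%:R * p%:Z = x ^+ 2 + 31%:R * y ^+ 2,
     (x %% 2)%Z = 1 & (y %% 2)%Z = 1]).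
Proof.
move=> pp op ps; have p0 := prime_gt0 pp.
have op' : exists m, p%:Z = 2%:R * m + 1.
  by exists (p./2)%:Z; rewrite -{1}(odd_double_half p) op; lia.
have [b [ob /dvdzP[c disc]]] : exists b, (b %% 2)%Z = 1 /\ (4%:R * p%:Z %| b ^+ 2 + 31%:R)%Z.
  have dvd b : (b %% 2)%Z = 1 -> (p %| b ^+ 2 + 31%:R)%Z -> (4%:R * p%:Z %| b ^+ 2 + 31%:R)%Z.
    move=> ob pb; rewrite Gauss_dvdz ?pb ?andbT //.
      have [k [e [eb ee]]] := odd_intE b; have e1 : e = 1 by lia.
      by apply/dvdzP; exists (k ^+ 2 + k + 8%:R); rewrite eb e1; ring.
    by rewrite coprimezE; apply: (@coprimeXl 2 2 `|p%:Z|%N); rewrite coprime2n.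
  have [k [e [es ee]]] := odd_intE s.
  case: ee => e1; last by exists s; split; [lia | apply: dvd => //; lia].
  (* Adding the odd [p] makes the root odd and keeps it a root modulo [p]. *)
  case: op' => m em; exists (s + p%:Z); split; first by lia.
  apply: dvd; first by lia.
  rewrite [X in (_ %| X)%Z](_ : _ = (2%:R * s + p%:Z) * p%:Z + (s ^+ 2 + 31%:R)); last by ring.
  by rewrite rpredD // dvdz_mull.
have : represents p%:Z b c p%:Z by exists 1, 0; ring.
have disc' : b ^+ 2 + 31%:R = 4%:R * p%:Z * c by rewrite disc; ring.
case/(forms_disc31 _ disc'); first by rewrite ltz_nat.
(* An odd [y] would make [x^2 + x y + 8 y^2] even. With [y = 2 k] the form is
   [(x + k)^2 + 31 k^2]. *)
- case=> x [y e]; left; have [k [d [ey dd]]] := odd_intE y.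
  case: dd => d1; last first.
    exfalso; case: op' => m em; have [l [f [ex ff]]] := odd_intE x.
    move: e; rewrite em ey ex d1; case: ff => ->; lia.
  by exists (x + k), k; rewrite e ey d1; ring.
- case=> x [y e]; right; case: op' => m em.
  have [k [d [ey dd]]] := odd_intE y; have [l [f [ex ff]]] := odd_intE x.
  have d1 : d = 1 by case: dd => // d0; exfalso; move: e; rewrite em ey d0; lia.
  exists (4%:R * x + y), y; split; [by rewrite e; ring | clear e; lia | clear e; lia].
Qed.

(** * Gauss and Jacobi sums *)

Lemma dvd3_sqr_pred q : prime q -> q != 3%N -> (3 %| (q ^ 2).-1)%N.
Proof.
move=> pq q3; have : ~~ (3 %| q)%N by rewrite dvdn_prime2 // eq_sym.
rewrite -subn1 -(eqn_mod_dvd 3) ?expn_gt0 ?prime_gt0 // -modnXm.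
by rewrite /dvdn; case: (q %% 3)%N (ltn_pmod q (isT : 0 < 3)%N) => [|[|[|[|]]]].
Qed.

Section GaussSum.
Variables (F : finFieldType) (K : fieldType) (chi psi : F -> K).
Hypothesis chi0 : chi 0 = 0.
Hypothesis chiM : {morph chi : x y / x * y}.
Hypothesis chi_cube : forall x, x != 0 -> chi x ^+ 3 = 1.
Hypothesis chi_nontriv : exists2 x, x != 0 & chi x != 1.
Hypothesis psiD : forall x y, psi (x + y) = psi x * psi y.
Hypothesis psi0 : psi 0 = 1.
Hypothesis psi_nontriv : exists x, psi x != 1.

Definition gauss_sum (f : F -> K) := \sum_t f t * psi t.
Definition jacobi_sum := \sum_t chi t * chi (1 - t).

Let chi2 t := chi t ^+ 2.

Let chi_neq0 x : x != 0 -> chi x != 0.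
Proof.
by move/chi_cube => e; apply: contra_eq_neq e => ->; rewrite expr0n eq_sym oner_eq0.
Qed.

Let chi1 : chi 1 = 1.
Proof. by apply: (mulfI (chi_neq0 (oner_neq0 F))); rewrite -chiM !mulr1. Qed.

Let chiX n x : chi (x ^+ n) = chi x ^+ n.
Proof. by elim: n => [|n IH]; rewrite ?expr0 ?chi1 // !exprS chiM IH. Qed.

Let chiN1 : chi (- 1) = 1.
Proof.
have e2 : chi (-1) ^+ 2 = 1 by rewrite expr2 -chiM mulrNN mulr1 chi1.
have /chi_cube : -1 != 0 :> F by rewrite oppr_eq0 oner_eq0.
by rewrite exprS e2 mulr1.
Qed.

Let chiN x : chi (- x) = chi x.
Proof. by rewrite -mulN1r chiM chiN1 mul1r. Qed.

Let sum_mult (f : F -> K) : {morph f : x y / x * y} ->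
  (exists2 x, x != 0 & f x != 1) -> \sum_t f t = 0.
Proof.
move=> fM [x nzx fx1]; have e : \sum_t f t = f x * \sum_t f t.
  rewrite big_distrr (reindex_inj (mulfI nzx)) /=.
  by apply: eq_bigr => t _; rewrite fM.
apply/eqP; move/eqP: e; rewrite -subr_eq0 -{1}[X in X - _]mul1r -mulrBl mulf_eq0.
by rewrite subr_eq0 eq_sym (negPf fx1).
Qed.

Let sum_chi : \sum_t chi t = 0. Proof. exact: sum_mult. Qed.

Let sum_chi2 : \sum_t chi2 t = 0.
Proof.
apply: sum_mult; first by move=> x y; rewrite /chi2 chiM exprMn.
have [x nzx chix] := chi_nontriv; exists x => //; apply: contraNneq chix => e.
by have := chi_cube nzx; rewrite exprS -/(chi2 x) e mulr1 => ->.
Qed.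

Let sum_psi : \sum_t psi t = 0.
Proof.
have [x psix] := psi_nontriv; have e : \sum_t psi t = psi x * \sum_t psi t.
  rewrite big_distrr (reindex_inj (addrI x)) /=.
  by apply: eq_bigr => t _; rewrite psiD.
apply/eqP; move/eqP: e; rewrite -subr_eq0 -{1}[X in X - _]mul1r -mulrBl mulf_eq0.
by rewrite subr_eq0 eq_sym (negPf psix).
Qed.

Let convolve (f h : F -> K) :
  gauss_sum f * gauss_sum h = \sum_u (\sum_s f s * h (u - s)) * psi u.
Proof.
rewrite /gauss_sum big_distrl; under [RHS]eq_bigr => u _ do rewrite big_distrl.
rewrite [RHS]exchange_big; apply: eq_bigr => s _; rewrite big_distrr.
rewrite (reindex_inj (addrI (- s))); apply: eq_bigr => u _ /=.
have -> : psi u = psi s * psi (- s + u) by rewrite -psiD addrA subrr add0r.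
by rewrite [u - s]addrC; ring.
Qed.

Lemma gauss_sum_sqr : gauss_sum chi ^+ 2 = jacobi_sum * gauss_sum chi2.
Proof.
rewrite expr2 convolve [RHS]big_distrr; apply: eq_bigr => u _ /=; rewrite mulrA.
congr (_ * _); have [->|nzu] := eqVneq u 0.
  rewrite /chi2 chi0 expr0n mulr0; transitivity (\sum_t chi2 t); last exact: sum_chi2.
  by apply: eq_bigr => s _; rewrite sub0r chiN.
rewrite (reindex_inj (mulfI nzu)) /jacobi_sum big_distrl.
by apply: eq_bigr => t _ /=; rewrite -{2}[u]mulr1 -mulrBr !chiM /chi2; ring.
Qed.

Lemma gauss_sum_mul : gauss_sum chi * gauss_sum chi2 = #|F|%:R.
Proof.
have jac : \sum_t chi t * chi2 (1 - t) = -1.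
  rewrite (reindex_inj (inv_inj (subKr 1))) (bigD1 0) //= !subr0 subrr /chi2 chi0.
  rewrite expr0n mulr0 add0r.
  (* Inverting [t] turns the summand into [chi (t - 1)], up to the character of the cube [t^3]. *)
  have -> : \sum_(t | t != 0) chi (1 - t) * chi (1 - (1 - t)) ^+ 2 =
            \sum_(t | t != 0) chi (t - 1).
    rewrite [RHS](reindex_inj invr_inj) /=.
    apply: eq_big => [t|t nzt]; first by rewrite invr_eq0.
    rewrite subKr -[t^-1 - 1](mulfK (expf_neq0 3 nzt)) chiM.
    have -> : (t^-1 - 1) * t ^+ 3 = (1 - t) * t ^+ 2 by field.
    rewrite chiM chiX -[LHS]mulr1; congr (_ * _).
    have := chiM (t ^+ 3) (t ^+ 3)^-1; rewrite divff ?expf_neq0 // chi1.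
    by rewrite chiX chi_cube // mul1r.
  have : \sum_t chi (t - 1) = 0.
    by rewrite -(reindex_inj (addIr (- 1)) (P := xpredT) (F := chi)) sum_chi.
  rewrite (bigD1 0) //= sub0r chiN1 => /eqP.
  by rewrite addrC addr_eq0 => /eqP.
rewrite convolve (bigD1 0) //= psi0 mulr1.
have -> : \sum_s chi s * chi2 (0 - s) = #|F|%:R - 1.
  rewrite (bigD1 0) //= chi0 mul0r add0r.
  under eq_bigr => s nzs do rewrite sub0r /chi2 chiN -exprS chi_cube //.
  rewrite sumr_const cardC1; have cF : (0 < #|F|)%N by apply/card_gt0P; exists 0.
  by rewrite -[in RHS](prednK cF) -natr1 addrK.
have -> : \sum_(u | u != 0) (\sum_s chi s * chi2 (u - s)) * psi u = 1.
  transitivity (- \sum_(u | u != 0) psi u).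
    rewrite -sumrN; apply: eq_bigr => u nzu; rewrite (reindex_inj (mulfI nzu)) /=.
    rewrite -mulN1r -jac big_distrl big_distrl; apply: eq_bigr => t _ /=.
    rewrite -{2}[u]mulr1 -mulrBr /chi2 !chiM.
    rewrite [LHS](_ : _ = chi u ^+ 3 * (chi t * chi (1 - t) ^+ 2) * psi u); last by ring.
    by rewrite chi_cube // mul1r.
  by move/eqP: sum_psi; rewrite (bigD1 0) //= psi0 addr_eq0 => /eqP.
by rewrite subrK.
Qed.

Lemma gauss_sum_cube : gauss_sum chi ^+ 3 = #|F|%:R * jacobi_sum.
Proof.
by rewrite exprS gauss_sum_sqr mulrCA gauss_sum_mul mulrC.
Qed.

(** In characteristic [q], raising the Gauss sum [g] to the power [q^2] replaces [psi t] by
    [psi (q^2 t)] and keeps [chi t], as 3 divides [q^2 - 1]. Hence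
    [g^(q^2) = chi(q)^-2 g = chi(q) g], while [g^3] is the base on the left. *)
Lemma gauss_sum_Frobenius (q : nat) : q \in [pchar K] -> q != 3%N ->
  (q%:R : F) != 0 -> (#|F|%:R : K) != 0 ->
  (#|F|%:R * jacobi_sum) ^+ ((q ^ 2).-1 %/ 3) = chi q%:R.
Proof.
move=> chq q3 nzq nzF; have pq := pcharf_prime chq.
have q2_gt0 : (0 < q ^ 2)%N by rewrite expn_gt0 prime_gt0.
have q1 : (3 %| (q ^ 2).-1)%N.
  have : ~~ (3 %| q)%N by rewrite dvdn_prime2 // eq_sym.
  rewrite -subn1; rewrite -(eqn_mod_dvd 3) // -modnXm.
  by rewrite /dvdn; case: (q %% 3)%N (ltn_pmod q (isT : 0 < 3)%N) => [|[|[|]]].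
rewrite -gauss_sum_cube -exprM mulnC divnK //.
have nzg : gauss_sum chi != 0.
  by apply: contraNneq nzF => g0; rewrite -gauss_sum_mul g0 mul0r.
apply: (mulIf nzg); rewrite -exprSr prednK //.
have hE x : x ^+ (q ^ 2) = pFrobenius_aut chq (pFrobenius_aut chq x).
  by rewrite !pFrobenius_autE -exprM mulnn.
have psiX n x : psi x ^+ n = psi (n%:R * x).
  elim: n => [|n IH]; first by rewrite expr0 mul0r psi0.
  by rewrite exprS IH -psiD -natr1 mulrDl mul1r addrC.
rewrite hE /gauss_sum !rmorph_sum big_distrr.
rewrite [RHS](reindex_inj (mulfI (expf_neq0 2 nzq))); apply: eq_bigr => t _ /=.
rewrite !pFrobenius_autE -exprM mulnn exprMn psiX natrX.
have [->|nzt] := eqVneq t 0.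
  by rewrite !(mulr0, chi0, mul0r) expr0n (gtn_eqF q2_gt0) !mul0r.
rewrite mulrA -chiM; congr (_ * _).
rewrite -(prednK q2_gt0) exprS -{1}(divnK q1) mulnC exprM chi_cube // expr1n mulr1.
have -> : q%:R * (q%:R ^+ 2 * t) = q%:R ^+ 3 * t by ring.
by rewrite chiM chiX chi_cube // mul1r.
Qed.

End GaussSum.

Lemma expr3_root (K : comNzRingType) (z : K) : z ^+ 2 + z + 1 = 0 -> z ^+ 3 = 1.
Proof.
move=> ez; have e : z ^+ 3 - 1 = (z - 1) * (z ^+ 2 + z + 1) by ring.
by apply/eqP; rewrite -subr_eq0 e ez mulr0.
Qed.

Lemma prim3_root (K : fieldType) (z : K) : z ^+ 2 + z + 1 = 0 -> 3%:R != 0 :> K ->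
  3.-primitive_root z.
Proof.
move=> ez nz3; have z3 := expr3_root ez.
have [m prim_m m3] := prim_order_exists (isT : 0 < 3)%N z3.
have := primeP (isT : prime 3) => -[_ /(_ m m3)] /pred2P[m1|<- //].
move: prim_m ez; rewrite m1 => /prim_expr_order; rewrite expr1 => -> e3.
by case/eqP: nz3; rewrite -e3; ring.
Qed.

Lemma conj_root3 (K : comNzRingType) (z : K) :
  z ^+ 2 + z + 1 = 0 -> (z ^+ 2) ^+ 2 + z ^+ 2 + 1 = 0.
Proof.
move=> ez; rewrite [LHS](_ : _ = (z ^+ 2 + z + 1) * (z ^+ 2 - z + 1)); last by ring.
by rewrite ez mul0r.
Qed.

Lemma exists_unity_root (K : closedFieldType) n : (1 < n)%N -> n%:R != 0 :> K ->
  exists2 z : K, z ^+ n = 1 & z != 1.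
Proof.
move=> n1 nzn; pose P : {poly K} := \poly_(i < n) 1.
have szP : size P = n.
  by rewrite size_poly_eq // oner_neq0.
have PE x : P.[x] = \sum_(i < n) x ^+ i.
  by rewrite horner_poly; apply: eq_bigr => i _; rewrite mul1r.
have /closed_rootP[z /rootP] : size P != 1%N by rewrite szP gtn_eqF.
rewrite PE => ez; exists z.
  by apply/eqP; rewrite -subr_eq0 subrX1 ez mulr0.
apply: contraNneq nzn => z1; rewrite -ez z1.
by under eq_bigr => i _ do rewrite expr1n; rewrite sumr_const card_ord.
Qed.

(** * Cubic characters and Jacobi sums modulo a prime *)

Section CubicCharacter.
Variables (l : nat) (w : 'F_l).
Hypotheses (pl : prime l) (l3 : l != 3%N) (ew : w ^+ 2 + w + 1 = 0).
Local Notation F := 'F_l.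
Let k := (l.-1 %/ 3)%N.

Let nz3 : 3%:R != 0 :> F.
Proof. by rewrite -(dvdn_pcharf (pchar_Fp pl)) dvdn_prime2. Qed.

Let prim_w : 3.-primitive_root w. Proof. exact: prim3_root. Qed.

Let Fermat (t : F) : t != 0 -> t ^+ l.-1 = 1.
Proof.
move=> nzt; apply: (mulIf nzt); rewrite mul1r -exprSr prednK ?prime_gt0 //.
by have := expf_card t; rewrite card_Fp.
Qed.

Let nzw : w != 0.
Proof.
by apply: contra_eq_neq ew => ->; rewrite expr0n !add0r oner_neq0.
Qed.

Let k3 : (3 * k = l.-1)%N.
Proof.
have : (3 %| l.-1)%N by rewrite (prim_order_dvd prim_w) Fermat.
by rewrite mulnC => /divnK.
Qed.

Let k_gt0 : (0 < k)%N.
Proof.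
have := prime_gt1 pl; have := k3; case: (k) => //; rewrite muln0.
by case: (l) => [|[|]].
Qed.

(** The character is stored as an exponent, so that one discrete logarithm yields characters with
    values in every field containing a root [z] of [z^2 + z + 1]; for [z = w] it is the power map
    [t^k]. The value at 0 is a default that [cubic_char] overrides. *)
Definition cubic_log (t : F) : nat :=
  if t ^+ k == 1 then 0%N else if t ^+ k == w then 1%N else 2%N.

Let logE t : t != 0 -> t ^+ k = w ^+ cubic_log t.
Proof.
move=> nzt; have : (t ^+ k) ^+ 3 = 1 by rewrite -exprM mulnC k3 Fermat.
rewrite /cubic_log; case: eqP => [-> //|]; case: eqP => [-> //|] tw t1 /eqP.
rewrite -subr_eq0 [_ - _](_ : _ = (t ^+ k - 1) * (t ^+ k - w) * (t ^+ k - w ^+ 2)).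
  rewrite !mulf_eq0 !subr_eq0; move/eqP/negPf: tw => ->; move/eqP/negPf: t1 => -> /=.
  by move/eqP.
move: (t ^+ k) => x.
rewrite [RHS](_ : _ = x ^+ 3 - 1 - (w ^+ 2 + w + 1) * x ^+ 2 +
   (w ^+ 2 + w + 1) * w * x - (w - 1) * (w ^+ 2 + w + 1)); last by ring.
by rewrite ew; ring.
Qed.

Lemma cubic_logM x y : x != 0 -> y != 0 ->
  cubic_log (x * y) = cubic_log x + cubic_log y %[mod 3].
Proof.
move=> nzx nzy; apply/eqP; rewrite -(eq_prim_root_expr prim_w) exprD.
by rewrite -!logE // ?mulf_neq0 // exprMn.
Qed.

Let log_nontriv : exists2 x, x != 0 & (cubic_log x %% 3 != 0)%N.
Proof.
have [x /andP[nzx xk]] : exists x : F, (x != 0) && (x ^+ k != 1).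
  apply/existsP; apply: contraT => /existsPn all1.
  pose rs := enum [pred x : F | x != 0].
  have : (size rs <= k)%N.
    apply: max_unity_roots k_gt0 _ (enum_uniq _); apply/allP => x.
    rewrite mem_enum inE => nzx; have := all1 x; rewrite nzx negbK => ek.
    by rewrite unity_rootE.
  by rewrite -cardE cardC1 card_Fp // -k3 leqNgt ltn_Pmull.
by exists x => //; rewrite -/(dvdn 3 _) (prim_order_dvd prim_w) -logE.
Qed.

Definition cubic_char (K : nzRingType) (z : K) (t : F) : K :=
  if t == 0 then 0 else z ^+ cubic_log t.

Lemma cubic_charM (K : fieldType) (z : K) : z ^+ 3 = 1 ->
  {morph cubic_char z : x y / x * y}.
Proof.
move=> z3 x y; rewrite /cubic_char mulf_eq0.
have [->|nzx] := eqVneq x 0; first by rewrite /= mul0r.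
have [->|nzy] := eqVneq y 0; first by rewrite /= mulr0.
by rewrite /= -exprD -(expr_mod _ z3) cubic_logM // expr_mod.
Qed.

Lemma cubic_char_cube (K : fieldType) (z : K) : z ^+ 3 = 1 ->
  forall x, x != 0 -> cubic_char z x ^+ 3 = 1.
Proof.
by move=> z3 x /negPf nzx; rewrite /cubic_char nzx -exprM mulnC exprM z3 expr1n.
Qed.

Lemma cubic_char_nontriv (K : fieldType) (z : K) : 3.-primitive_root z ->
  exists2 x, x != 0 & cubic_char z x != 1.
Proof.
move=> prim_z; have [x nzx ex] := log_nontriv; exists x => //.
by rewrite /cubic_char (negPf nzx) -(prim_order_dvd prim_z).
Qed.

Definition additive_char (K : nzRingType) (y : K) (t : F) : K := y ^+ t.

Lemma additive_charD (K : nzRingType) (y : K) : y ^+ l = 1 ->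
  forall s t, additive_char y (s + t) = additive_char y s * additive_char y t.
Proof.
move=> yl s t; have yl' : y ^+ (Zp_trunc (pdiv l)).+2 = 1 by rewrite Fp_cast.
by rewrite /additive_char -exprD; apply: expr_mod yl'.
Qed.

(** Grouping the Jacobi sum by the values of the character at [t (1 - t)] exhibits it as an
    Eisenstein integer, whose coordinates [jacobi_re] and [jacobi_om] do not depend on the field of
    values. *)
Definition jacobi_set i := [set t : F | (t * (1 - t)) ^+ k == w ^+ i].

Let jacobi_partition (K : fieldType) (z : K) : z ^+ 3 = 1 ->
  jacobi_sum (cubic_char z) =
  #|jacobi_set 0|%:R + #|jacobi_set 1|%:R * z + #|jacobi_set 2|%:R * z ^+ 2.
Proof.
move=> z3; have t01 (t : F) : t * (1 - t) != 0 -> cubic_char z t * cubic_char z (1 - t) =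
    z ^+ cubic_log (t * (1 - t)).
  by move=> nz; rewrite -cubic_charM // /cubic_char (negPf nz).
have sumE i : #|jacobi_set i|%:R = \sum_t ((t * (1 - t)) ^+ k == w ^+ i)%:R :> K.
  by rewrite -sum1_card natr_sum big_mkcond; apply: eq_bigr => t _; rewrite inE; case: ifP.
rewrite !sumE !big_distrl -!big_split; apply: eq_bigr => t _ /=.
have [e0|nz] := eqVneq (t * (1 - t)) 0.
  rewrite -cubic_charM // e0 /cubic_char eqxx expr0n (gtn_eqF k_gt0).
  by rewrite !(eq_sym 0) !expf_eq0 (negPf nzw) /= !mul0r !addr0.
rewrite t01 // logE // !(eq_prim_root_expr prim_w).
rewrite /cubic_log; case: ifP => _; last case: ifP => _;
 by rewrite /= ?mul0r ?mul1r ?addr0 ?add0r ?expr0 ?expr1.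
Qed.

Definition jacobi_re : int := #|jacobi_set 0|%:Z - #|jacobi_set 2|%:Z.
Definition jacobi_om : int := #|jacobi_set 1|%:Z - #|jacobi_set 2|%:Z.

Lemma jacobi_sumE (K : fieldType) (z : K) : z ^+ 2 + z + 1 = 0 ->
  jacobi_sum (cubic_char z) = jacobi_re%:~R + jacobi_om%:~R * z.
Proof.
move=> ez; rewrite jacobi_partition ?expr3_root //.
have -> : z ^+ 2 = - 1 - z by apply/eqP; rewrite -subr_eq0 -ez; apply/eqP; ring.
by rewrite !rmorphB /=; ring.
Qed.

Let Fp_nz (K : fieldType) (y : K) : y ^+ l = 1 -> y != 1 ->
  exists t, additive_char y t != 1.
Proof.
move=> yl y1; exists 1; rewrite /additive_char.
suff -> : (1 : F) = 1%N :> nat by rewrite expr1.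
by rewrite -[LHS]/(1 %% (Zp_trunc (pdiv l)).+2)%N Fp_cast // modn_small // prime_gt1.
Qed.

(** The cube of [g(chi) g(chi^2) = l] is [l^3], and each factor has cube [l] times a Jacobi sum. The
    computation takes place in [algC], into which the integers embed. *)
Lemma jacobi_norm : jacobi_re ^+ 2 - jacobi_re * jacobi_om + jacobi_om ^+ 2 = l%:Z.
Proof.
have nz (n : nat) : (0 < n)%N -> n%:R != 0 :> algC by rewrite pnatr_eq0 lt0n.
have [z z3 z1] := exists_unity_root (isT : 1 < 3)%N (nz 3 isT).
have [y yl y1] := exists_unity_root (prime_gt1 pl) (nz l (prime_gt0 pl)).
have ez : z ^+ 2 + z + 1 = 0.
  have nz1 : z - 1 != 0 by rewrite subr_eq0.
  apply: (mulfI nz1); rewrite mulr0 [LHS](_ : _ = z ^+ 3 - 1); [by rewrite z3 subrr | ring].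
have ez2 := conj_root3 ez.
have psi0 : additive_char y 0 = 1 by rewrite /additive_char expr0.
have chi0 x : cubic_char x 0 = 0 :> algC by rewrite /cubic_char eqxx.
have nz3' := nz 3%N isT.
have cube x (ex : x ^+ 2 + x + 1 = 0) := gauss_sum_cube (chi0 x)
  (cubic_charM (expr3_root ex)) (cubic_char_cube (expr3_root ex))
  (cubic_char_nontriv (prim3_root ex nz3')) (additive_charD yl) psi0 (Fp_nz yl y1).
have gmul := gauss_sum_mul (chi0 z)
  (cubic_charM (expr3_root ez)) (cubic_char_cube (expr3_root ez))
  (cubic_char_nontriv (prim3_root ez nz3')) (additive_charD yl) psi0 (Fp_nz yl y1).
have chi2 : gauss_sum (additive_char y) (fun t => cubic_char z t ^+ 2) =
    gauss_sum (additive_char y) (cubic_char (z ^+ 2)).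
  apply: eq_bigr => t _; congr (_ * _); rewrite /cubic_char.
  by case: (t == 0); rewrite ?expr0n // -!exprM mulnC.
have := congr1 (fun x => x ^+ 3) gmul; rewrite exprMn chi2 !cube //.
rewrite !jacobi_sumE // card_Fp //.
set A : algC := jacobi_re%:~R; set B : algC := jacobi_om%:~R => e.
have nzl := nz l (prime_gt0 pl).
have {}e : (A + B * z) * (A + B * z ^+ 2) = l%:R.
  apply: (mulfI (expf_neq0 2 nzl)); rewrite -exprSr -e; ring.
apply: (@intr_inj algC); rewrite rmorphD rmorphB !rmorphXn rmorphM /= -/A -/B -pmulrn -e.
have z2 : z ^+ 2 = - z - 1 by apply/eqP; rewrite -subr_eq0 -ez; apply/eqP; ring.
rewrite [RHS](_ : _ = A ^+ 2 + A * B * (z ^+ 2 + z) + B ^+ 2 * z ^+ 3); last by ring.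
by rewrite z3 z2; ring.
Qed.

(** This tells which of the two primes above [l] divides the Jacobi sum. For [z = w] the sum is that
    of the polynomial [(t (1 - t))^k] over the field; its degree [2 k] is less than [l - 1], and
    power sums of such degrees vanish. *)
Lemma jacobi_root : jacobi_re%:~R + jacobi_om%:~R * w = 0.
Proof.
rewrite -jacobi_sumE //.
have chiw t : cubic_char w t = t ^+ k.
  rewrite /cubic_char; case: eqVneq => [->|nzt]; last by rewrite logE.
  by rewrite expr0n gtn_eqF.
pose P : {poly F} := ('X * (1 - 'X)) ^+ k.
have -> : jacobi_sum (cubic_char w) = \sum_t P.[t].
  by apply: eq_bigr => t _; rewrite !chiw horner_exp !hornerE exprMn.
have szP : (size P <= l.-1)%N.
  rewrite /P (leq_trans (size_poly_exp_leq _ _)) //.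
  have sz3 : leq (size ('X * (1 - 'X) : {poly F})) 3.
    apply: leq_trans (size_polyMleq _ _) _; rewrite size_polyX -opprB size_polyN.
    by rewrite size_XsubC.
  by rewrite -k3; move: sz3 k_gt0; case: (size _) => [|s]; nia.
have power_sum i : (i < l.-1)%N -> \sum_(t : F) t ^+ i = 0.
  have [->|i0] := posnP i => ltil.
    under eq_bigr => t _ do rewrite expr0.
    by rewrite sumr_const card_Fp // pchar_Fp_0.
  have [x /andP[nzx xi]] : exists x : F, (x != 0) && (x ^+ i != 1).
    apply/existsP; apply: contraT => /existsPn all1.
    pose rs := enum [pred x : F | x != 0].
    have : (size rs <= i)%N.
      apply: max_unity_roots i0 _ (enum_uniq _); apply/allP => x.
      rewrite mem_enum inE => nzx; have := all1 x; rewrite nzx negbK => ek.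
      by rewrite unity_rootE.
    by rewrite -cardE cardC1 card_Fp // leqNgt ltil.
  have e : \sum_(t : F) t ^+ i = x ^+ i * \sum_(t : F) t ^+ i.
    rewrite big_distrr (reindex_inj (mulfI nzx)) /=.
    by apply: eq_bigr => t _; rewrite exprMn.
  apply/eqP; move/eqP: e; rewrite -subr_eq0 -{1}[X in X - _]mul1r -mulrBl mulf_eq0.
  by rewrite subr_eq0 eq_sym (negPf xi).
under eq_bigr => t _ do rewrite horner_coef.
rewrite exchange_big big1 // => i _ /=.
by rewrite -big_distrr /= power_sum ?mulr0 // (leq_trans (ltn_ord i)).
Qed.

(** Reciprocity for one prime: the left side is a symbol at [q] of the Jacobi sum [J], with
    [l J = J^2 conj(J)], and the right side is the symbol of [q] modulo [l]. *)
Lemma jacobi_Frobenius (K : closedFieldType) (z : K) q : q \in [pchar K] ->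
  q != 3%N -> q != l -> z ^+ 2 + z + 1 = 0 ->
  (l%:R * (jacobi_re%:~R + jacobi_om%:~R * z)) ^+ ((q ^ 2).-1 %/ 3) =
  z ^+ cubic_log q%:R.
Proof.
move=> chq q3 ql ez; have pq := pcharf_prime chq.
have nzl : l%:R != 0 :> K by rewrite -(dvdn_pcharf chq) dvdn_prime2.
have nz3K : 3%:R != 0 :> K by rewrite -(dvdn_pcharf chq) dvdn_prime2.
have nzq : q%:R != 0 :> F by rewrite -(dvdn_pcharf (pchar_Fp pl)) dvdn_prime2 // eq_sym.
have [y yl y1] := exists_unity_root (prime_gt1 pl) nzl.
have chi0 : cubic_char z 0 = 0 by rewrite /cubic_char eqxx.
have psi0 : additive_char y 0 = 1 by rewrite /additive_char expr0.
have := gauss_sum_Frobenius chi0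
  (cubic_charM (expr3_root ez)) (cubic_char_cube (expr3_root ez))
  (cubic_char_nontriv (prim3_root ez nz3K)) (additive_charD yl) psi0 (Fp_nz yl y1)
  chq q3 nzq.
by rewrite card_Fp // jacobi_sumE // => -> //; rewrite /cubic_char (negPf nzq).
Qed.

Lemma jacobi_set_card i : (0 < i < 3)%N -> (3 %| #|jacobi_set i|)%N.
Proof.
move=> i3.
(* The map [t -> 1 / (1 - t)] has order 3 and multiplies [t (1 - t)] by the cube
   [- (1 - t)^-3]; a fixed point other than [0] and [1] has [t (1 - t) = 1]. *)
pose f (t : F) : F := if t == 0 then 0 else if t == 1 then 1 else (1 - t)^-1.
have f0 : f 0 = 0 by rewrite /f eqxx.
have f1 : f 1 = 1 by rewrite /f oner_eq0 eqxx.
have fE t : t != 0 -> t != 1 -> f t = (1 - t)^-1.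
  by rewrite /f => /negPf -> /negPf ->.
have f_neq (t : F) : t != 0 -> t != 1 -> (1 - t)^-1 != 0 /\ (1 - t)^-1 != 1.
  move=> t0 t1; rewrite invr_eq0 subr_eq0 eq_sym t1 invr_eq1; split=> //.
  by rewrite -subr_eq0 addrAC subrr add0r oppr_eq0.
have f3 t : f (f (f t)) = t.
  have [->|t0] := eqVneq t 0; first by rewrite !f0.
  have [->|t1] := eqVneq t 1; first by rewrite !f1.
  have [u0 u1] := f_neq t t0 t1; have [v0 v1] := f_neq _ u0 u1.
  rewrite (fE t) // (fE _ u0 u1) (fE _ v0 v1).
  have nz1t : 1 - t != 0 by rewrite subr_eq0 eq_sym.
  have -> : 1 - (1 - t)^-1 = - (t / (1 - t)) by field.
  have -> : 1 - (- (t / (1 - t)))^-1 = t^-1 by field; rewrite oppr_eq0 t0 nz1t.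
  exact: invrK.
have f_inj : injective f by apply: (can_inj (g := fun t => f (f t))) => t; apply: f3.
have N1k : (-1) ^+ k = 1 :> F.
  have nzN1 : -1 != 0 :> F by rewrite oppr_eq0 oner_eq0.
  have := Fermat nzN1; rewrite -k3 mulnC exprM exprS exprAC sqrrN !expr1n.
  by rewrite mulr1.
have fS t : (f t \in jacobi_set i) = (t \in jacobi_set i).
  have [->|t0] := eqVneq t 0; first by rewrite f0.
  have [->|t1] := eqVneq t 1; first by rewrite f1.
  have nz1t : 1 - t != 0 by rewrite subr_eq0 eq_sym.
  rewrite !inE fE //; congr (_ == _).
  have -> : (1 - t)^-1 * (1 - (1 - t)^-1) = -1 * (t * (1 - t)) / (1 - t) ^+ 3 by field.
  by rewrite expr_div_n exprMn N1k mul1r -exprM k3 Fermat // divr1.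
pose s := perm f_inj.
have s3 : (s ^+ 3 = 1)%g by apply/permP => t; rewrite !permM perm1 !permE f3.
have G3 : (3.-group <[s]>)%g.
  by rewrite /pgroup (pnat_dvd _ (pnat_id (isT : prime 3))) // order_dvdn s3.
have acts : [acts <[s]>%g, on jacobi_set i | 'P].
  rewrite cycle_subG; apply/astabsP => t.
  by rewrite /= apermE permE fS.
have := pgroup_fix_mod G3 acts.
have -> : ('Fix_(jacobi_set i | 'P)(<[s]>))%g = set0.
  apply/setP => t; rewrite in_set0; apply/negbTE/negP => /setIP[tS /afixP tfix].
  have := tfix s (cycle_id s); rewrite /= apermE permE => ft.
  move: tS; rewrite inE => /eqP ek.
  have nz : t * (1 - t) != 0.
    apply: contra_eq_neq ek => ->; rewrite expr0n gtn_eqF // eq_sym.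
    by rewrite expf_neq0.
  move: (nz); rewrite mulf_eq0 negb_or subr_eq0 => /andP[t0 t1].
  move: ft; rewrite fE // 1?eq_sym // => ft.
  have e1 : t * (1 - t) = 1 by rewrite -{1}ft mulVf // subr_eq0.
  move/esym/eqP: ek; rewrite e1 expr1n -(prim_order_dvd prim_w).
  by case/andP: i3 => i0 i3 /(dvdn_leq i0); rewrite leqNgt i3.
by rewrite cards0 => /eqP.
Qed.

(** This fixes the Jacobi sum among its associates up to sign: it is congruent to a rational integer
    modulo 3. *)
Lemma jacobi_om_dvd3 : (3 %| jacobi_om)%Z.
Proof. by rewrite rpredB // dvdzE; apply: jacobi_set_card. Qed.

End CubicCharacter.

(** * Rational cubic reciprocity *)

Definition eisenstein_norm (A B : int) := A ^+ 2 - A * B + B ^+ 2.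

Lemma eisenstein_norm_ge0 A B : 0 <= eisenstein_norm A B.
Proof.
have : 0 <= 4%:R * eisenstein_norm A B.
  have -> : 4%:R * eisenstein_norm A B = (2%:R * A - B) ^+ 2 + 3%:R * B ^+ 2.
    by rewrite /eisenstein_norm; ring.
  by apply: addr_ge0; rewrite ?sqr_ge0 // mulr_ge0 ?sqr_ge0.
by rewrite pmulr_rge0.
Qed.

Definition eisenstein_val (K : nzRingType) (A B : int) (z : K) : K :=
  A%:~R + B%:~R * z.

Lemma eisenstein_normE (K : comNzRingType) (z : K) A B : z ^+ 2 + z + 1 = 0 ->
  eisenstein_val A B z * eisenstein_val A B (z ^+ 2) = (eisenstein_norm A B)%:~R.
Proof.
move=> ez; have z3 := expr3_root ez.
rewrite /eisenstein_val /eisenstein_norm rmorphD rmorphB !rmorphXn rmorphM /=.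
move: (A%:~R) (B%:~R) => a b.
rewrite [LHS](_ : _ = a ^+ 2 + a * b * (z ^+ 2 + z + 1) - a * b + b ^+ 2 * z ^+ 3); last by ring.
by rewrite ez z3; ring.
Qed.

Lemma eisenstein_valM (K : comNzRingType) (z : K) (a b A B : int) : z ^+ 2 + z + 1 = 0 ->
  eisenstein_val (a * A - b * B) (a * B + b * A - b * B) z =
  eisenstein_val a b z * eisenstein_val A B z.
Proof.
move=> ez; rewrite /eisenstein_val !rmorphB rmorphD !rmorphM /=.
move: (a%:~R) (b%:~R) (A%:~R) (B%:~R) => c d C D.
rewrite [RHS](_ : _ = c * C + (c * D + d * C) * z + d * D * (z ^+ 2 + z + 1) - d * D * z - d * D);
  last by ring.
by rewrite ez; ring.
Qed.

Lemma intr_eq0_Fp (l : nat) (x : int) : prime l -> (x%:~R == 0 :> 'F_l) = (l %| x)%Z.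
Proof. by move=> pl; rewrite -(dvdz_pcharf (pchar_Fp pl)). Qed.

Lemma eisenstein_cubic_divide (l : nat) (A B : int) : prime l -> coprimez A B ->
  (l %| eisenstein_norm A B)%Z -> l != 3%N ->
  exists w : 'F_l, w ^+ 2 + w + 1 = 0 /\ A%:~R + B%:~R * w = 0.
Proof.
move=> pl copAB lN l3.
have nzB : B%:~R != 0 :> 'F_l.
  rewrite intr_eq0_Fp //; apply/negP => lB.
  have lA : (l %| A)%Z.
    have : (l %| A ^+ 2)%Z.
      have -> : A ^+ 2 = eisenstein_norm A B + B * (A - B) by rewrite /eisenstein_norm; ring.
      by rewrite rpredD // dvdz_mulr.
    by rewrite expr2 !dvdzE abszM Euclid_dvdM // => /orP[].
  have : (l %| gcdz A B)%Z by rewrite dvdz_gcd lA.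
  by rewrite (eqP copAB) dvdzE dvdn1 absz_nat => /eqP l1; move: pl; rewrite l1.
exists (- (A%:~R / B%:~R)); split; last by field.
have : (eisenstein_norm A B)%:~R = 0 :> 'F_l by apply/eqP; rewrite intr_eq0_Fp.
rewrite /eisenstein_norm rmorphD rmorphB !rmorphXn rmorphM /=.
move: (A%:~R) (B%:~R) nzB => a b nzb e.
apply: (mulIf (expf_neq0 2 nzb)); rewrite mul0r -e; field.
exact: nzb.
Qed.

(* [z ^+ E q] is the cubic residue symbol of [q] modulo [A + B z]; for a prime [q]
   reciprocity evaluates it as a power computed in characteristic [q]. *)
Definition cubic_symbol_spec (A B : int) (E : nat -> nat) :=
  let m := `|eisenstein_norm A B|%N in
  [/\ forall x y, coprime x m -> coprime y m -> (E (x * y) = E x + E y %[mod 3])%N,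
      forall x y, coprime x m -> (x = y %[mod m])%N -> (E x = E y %[mod 3])%N &
      forall q (K : closedFieldType) (z : K), q \in [pchar K] -> q != 3%N ->
        coprime q m -> z ^+ 2 + z + 1 = 0 ->
        (eisenstein_val A B z ^+ 2 * eisenstein_val A B (z ^+ 2)) ^+ ((q ^ 2).-1 %/ 3)
          = z ^+ E q].

(** The only units with [B] divisible by 3 are 1 and -1. The symbol of -1 is trivial because
    [(q^2 - 1) / 3] is even for odd [q], and [-1 = 1] for [q = 2]. *)
Lemma cubic_symbol_unit (A B : int) : (3 %| B)%Z -> eisenstein_norm A B = 1 ->
  cubic_symbol_spec A B (fun=> 0%N).
Proof.
move=> B3 N1; split=> // q K z chq q3 _ ez; rewrite expr0.
have pq := pcharf_prime chq.
have B0 : B = 0.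
  have : (2%:R * A - B) ^+ 2 + 3%:R * B ^+ 2 = 4%:R.
    transitivity (4%:R * eisenstein_norm A B); last by rewrite N1.
    by rewrite /eisenstein_norm; ring.
  have := sqr_ge0 (2%:R * A - B); case/dvdzP: B3 => k -> ge0 e.
  suff -> : k = 0 by rewrite mul0r.
  have : k ^+ 2 < 1 by move: e ge0; rewrite exprMn; lia.
  by have := sqr_ge0 k; move=> ??; have /eqP : k ^+ 2 = 0 by [lia]; rewrite sqrf_eq0 => /eqP.
move: N1; rewrite /eisenstein_norm /eisenstein_val B0 !(mulr0, mul0r, expr0n, subr0, addr0) /=.
move/eqP; rewrite sqrf_eq1 => /orP[] /eqP->; first by rewrite rmorph1 !expr1n mulr1 expr1n.
rewrite rmorphN rmorph1 sqrrN expr1n mul1r.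
have [q2|q2] := eqVneq q 2%N.
  have c2 : 2%:R = 0 :> K by rewrite -(pcharf0 chq) q2.
  by rewrite q2 expr1; apply/eqP; rewrite eq_sym -addr_eq0 -(natrD _ 1 1) c2.
have oq : odd q by case/even_prime: pq q2 => ->.
rewrite -signr_odd (_ : odd _ = false) //.
have := dvd3_sqr_pred pq q3; have oq2 : odd (q ^ 2) by rewrite oddX.
case/dvdnP=> n en; rewrite en mulnK //.
have : (q ^ 2 = (n * 3).+1)%N by rewrite -en prednK ?odd_gt0.
by move=> e; move: oq2; rewrite e /= oddM andbT => /negPf.
Qed.

Lemma cubic_symbol_step (l : nat) (w : 'F_l) (A B A' B' : int) (E' : nat -> nat) :
  prime l -> l != 3%N -> w ^+ 2 + w + 1 = 0 ->
  let a := jacobi_re w in let b := jacobi_om w in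
  A = a * A' - b * B' -> B = a * B' + b * A' - b * B' ->
  eisenstein_norm A B = l%:Z * eisenstein_norm A' B' ->
  cubic_symbol_spec A' B' E' ->
  cubic_symbol_spec A B (fun n => cubic_log w n%:R + E' n)%N.
Proof.
move=> pl l3 ew a b eA eB eN [EM Eper Eval].
have em : `|eisenstein_norm A B|%N = (l * `|eisenstein_norm A' B'|)%N.
  by rewrite eN abszM absz_nat.
have nzl x : coprime x l -> x%:R != 0 :> 'F_l.
  by rewrite -(dvdn_pcharf (pchar_Fp pl)) -prime_coprime // coprime_sym.
rewrite /cubic_symbol_spec em; split.
- move=> x y; rewrite !coprimeMr => /andP[xl xm] /andP[yl ym].
  rewrite natrM -modnDm (cubic_logM pl l3 ew) ?nzl // EM // modnDm.
  by rewrite addnACA.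
- move=> x y; rewrite coprimeMr => /andP[xl xm] exy.
  have dl : (l %| l * `|eisenstein_norm A' B'|)%N by apply: dvdn_mulr.
  have dm : (`|eisenstein_norm A' B'| %| l * `|eisenstein_norm A' B'|)%N by apply: dvdn_mull.
  have -> : x%:R = y%:R :> 'F_l.
    apply/val_inj; rewrite /= !val_Fp_nat // -(modn_dvdm x dl) exy.
    by rewrite (modn_dvdm y dl).
  rewrite -modnDmr (Eper x y) ?modnDmr // -(modn_dvdm x dm) exy.
  by rewrite (modn_dvdm y dm).
- move=> q K z chq q3; rewrite coprimeMr => /andP[ql qm] ez.
  have ez2 := conj_root3 ez.
  have nql : q != l.
    by apply: contraTneq ql => ->; rewrite /coprime gcdnn gtn_eqF ?prime_gt1.
  rewrite eA eB !eisenstein_valM //.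
  have J := jacobi_Frobenius pl l3 ew chq q3 nql ez.
  have JN : eisenstein_val a b z * eisenstein_val a b (z ^+ 2) = l%:R.
    by rewrite eisenstein_normE // /eisenstein_norm jacobi_norm.
  rewrite [X in X ^+ _](_ : _ = (eisenstein_val a b z * eisenstein_val a b (z ^+ 2)) *
    eisenstein_val a b z * (eisenstein_val A' B' z ^+ 2 * eisenstein_val A' B' (z ^+ 2)));
    last by ring.
  by rewrite exprMn JN J Eval // exprD.
Qed.

(** Coprimality of [A] and [B] keeps inert primes out of the factorisation, so that every prime
    factor [l] of the norm comes from a prime of degree one, for which a Jacobi sum is available.
    Dividing by that sum preserves the hypotheses and lowers the norm. *)
Lemma rational_cubic_reciprocity (A B : int) : coprimez A B -> (3 %| B)%Z ->
  ~~ (3 %| A)%Z -> exists E, cubic_symbol_spec A B E.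
Proof.
have [n] := ubnP `|eisenstein_norm A B|%N; elim: n A B => // n IH A B ltN cop B3 A3.
have N0 := eisenstein_norm_ge0 A B.
have dvd3M x y : (3 %| x * y)%Z -> (3 %| x)%Z || (3 %| y)%Z.
  by rewrite !dvdzE abszM Euclid_dvdM.
have N3 : ~~ (3 %| eisenstein_norm A B)%Z.
  apply: contra A3 => N3; suff /dvd3M/orP[] : (3 %| A * A)%Z by [].
  have -> : A * A = eisenstein_norm A B - B * (B - A) by rewrite /eisenstein_norm; ring.
  by rewrite rpredB // dvdz_mulr.
have [m1|mN1] := eqVneq `|eisenstein_norm A B|%N 1%N.
  by exists (fun=> 0%N); apply: cubic_symbol_unit => //; lia.
have m_gt1 : (1 < `|eisenstein_norm A B|)%N.
  by move: N3 mN1; rewrite dvdzE; case: `|eisenstein_norm A B|%N => [|[|]].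
set l := pdiv `|eisenstein_norm A B|%N; have pl : prime l := pdiv_prime m_gt1.
have lN : (l %| eisenstein_norm A B)%Z by rewrite dvdzE absz_nat pdiv_dvd.
have l3 : l != 3%N by apply: contraNneq N3 => e; move: lN; rewrite e.
have [w [ew eAB]] := eisenstein_cubic_divide pl cop lN l3.
set a := jacobi_re w; set b := jacobi_om w.
have jN : a ^+ 2 - a * b + b ^+ 2 = l%:Z := jacobi_norm pl l3 ew.
have jr : a%:~R + b%:~R * w = 0 := jacobi_root pl l3 ew.
have b3 : (3 %| b)%Z := jacobi_om_dvd3 pl l3 ew.
have a3 : ~~ (3 %| a)%Z.
  apply/negP => a3; have : (3 %| l%:Z)%Z.
    by rewrite -jN !expr2 rpredD ?rpredB ?dvdz_mulr.
  by rewrite dvdzE !absz_nat dvdn_prime2 // eq_sym (negPf l3).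
have nzl : l%:Z != 0 by rewrite eqz_nat -lt0n prime_gt0.
have Aw : A%:~R = - (B%:~R * w) by apply/eqP; rewrite -addr_eq0 eAB.
have aw : a%:~R = - (b%:~R * w) by apply/eqP; rewrite -addr_eq0 jr.
(* [A' + B' z] is [A + B z] times the conjugate of [a + b z], divided by [l]. Both coordinates of
   the product vanish modulo [l] because [A + B z] and [a + b z] have the common root [w]. *)
have /dvdzP[A' eA'] : (l %| A * a - A * b + B * b)%Z.
  rewrite -intr_eq0_Fp // rmorphD rmorphB !rmorphM /= Aw aw.
  move: (B%:~R) (b%:~R) => C c.
  rewrite [X in X == 0](_ : _ = C * c * (w ^+ 2 + w + 1)); last by ring.
  by rewrite ew mulr0.
have /dvdzP[B' eB'] : (l %| B * a - A * b)%Z.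
  rewrite -intr_eq0_Fp // rmorphB !rmorphM /= Aw aw.
  move: (B%:~R) (b%:~R) => C c; rewrite [X in X == 0](_ : _ = 0) //; ring.
have eA : A = a * A' - b * B'.
  apply: (mulIf nzl); rewrite -{1}jN.
  rewrite [RHS](_ : _ = a * (A' * l%:Z) - b * (B' * l%:Z)); last by ring.
  by rewrite -eA' -eB'; ring.
have eB : B = a * B' + b * A' - b * B'.
  apply: (mulIf nzl); rewrite -{1}jN.
  rewrite [RHS](_ : _ = a * (B' * l%:Z) + b * (A' * l%:Z) - b * (B' * l%:Z)); last by ring.
  by rewrite -eA' -eB'; ring.
have eN : eisenstein_norm A B = l%:Z * eisenstein_norm A' B'.
  by rewrite -jN /eisenstein_norm eA eB; ring.
have [||||E' specE'] := IH A' B'.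
- rewrite -ltnS (leq_trans _ ltN) // ltnS eN abszM absz_nat ltn_Pmull ?prime_gt1 //.
  by rewrite lt0n; apply: contraTneq m_gt1 => e0; rewrite eN abszM e0 muln0.
- have : (gcdz A' B' %| gcdz A B)%Z.
    by rewrite dvdz_gcd eA eB !(rpredB, rpredD) ?dvdz_mull ?dvdz_gcdl ?dvdz_gcdr.
  by rewrite (eqP cop) dvdz1 => /eqP e1; rewrite /coprimez; apply/eqP; move: e1; rewrite /gcdz absz_nat => ->.
- have : (3 %| a * B')%Z.
    have -> : a * B' = B - b * (A' - B') by rewrite eB; ring.
    by rewrite rpredB // dvdz_mulr.
  by case/dvd3M/orP => //; rewrite (negPf a3).
- apply: contra A3 => A'3; rewrite eA rpredB //; first exact: dvdz_mull.
  exact: dvdz_mulr.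
by exists (fun n => cubic_log w n%:R + E' n)%N; apply: (cubic_symbol_step pl l3 ew eA eB eN specE').
Qed.

(** * The cubic symbol of the unit (29 + 3 sqrt 93) / 2 *)

Lemma exists_closed_field q : prime q -> exists K : closedFieldType, q \in [pchar K].
Proof.
move=> pq; have [K [f _]] := countable_algebraic_closure 'F_q.
by exists K; rewrite (fmorph_pchar f) pchar_Fp.
Qed.

Lemma exists_root3 (K : closedFieldType) : 3%:R != 0 :> K ->
  exists z : K, z ^+ 2 + z + 1 = 0.
Proof.
move=> nz3; have [z z3 z1] := exists_unity_root (isT : 1 < 3)%N nz3.
exists z; have nz1 : z - 1 != 0 by rewrite subr_eq0.
apply: (mulfI nz1); rewrite mulr0 [LHS](_ : _ = z ^+ 3 - 1); last by ring.
by rewrite z3 subrr.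
Qed.

Section Frobenius2.
Variables (K : fieldType) (q : nat).
Hypotheses (chq : q \in [pchar K]) (q3 : q != 3%N).
Let pq := pcharf_prime chq.

Lemma Frobenius2E (x : K) :
  x ^+ (q ^ 2) = pFrobenius_aut chq (pFrobenius_aut chq x).
Proof. by rewrite !pFrobenius_autE -exprM mulnn. Qed.

Lemma Frobenius2D (x y : K) : (x + y) ^+ (q ^ 2) = x ^+ (q ^ 2) + y ^+ (q ^ 2).
Proof. by rewrite !Frobenius2E !rmorphD. Qed.

Lemma Frobenius2B (x y : K) : (x - y) ^+ (q ^ 2) = x ^+ (q ^ 2) - y ^+ (q ^ 2).
Proof. by rewrite !Frobenius2E !rmorphB. Qed.

Lemma Frobenius2_int (m : int) : (m%:~R : K) ^+ (q ^ 2) = m%:~R.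
Proof. by rewrite Frobenius2E !rmorph_int. Qed.

Lemma Frobenius2_root3 (z : K) : z ^+ 2 + z + 1 = 0 -> z ^+ (q ^ 2) = z.
Proof.
move=> ez; rewrite -(prednK (_ : 0 < q ^ 2)%N) ?expn_gt0 ?prime_gt0 //.
have /dvdnP[j ->] := dvd3_sqr_pred pq q3.
by rewrite exprS mulnC exprM expr3_root // expr1n mulr1.
Qed.

(** The equation [y^(q^2) = y] stands for membership in the field with [q^2] elements, in which
    nonzero cubes have trivial cubic symbol. *)
Lemma Frobenius2_cube (y : K) : y != 0 -> y ^+ (q ^ 2) = y ->
  (y ^+ 3) ^+ ((q ^ 2).-1 %/ 3) = 1.
Proof.
move=> nzy ey; rewrite -exprM mulnC divnK ?dvd3_sqr_pred //.
by apply: (mulIf nzy); rewrite -exprSr prednK ?mul1r // expn_gt0 prime_gt0.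
Qed.

End Frobenius2.

Section SymbolSpec.
Variables (A B : int) (E : nat -> nat).
Hypothesis specE : cubic_symbol_spec A B E.
Local Notation m := `|eisenstein_norm A B|%N.

Lemma symbol_exp x n : coprime x m -> (E (x ^ n) = n * E x %[mod 3])%N.
Proof.
have [EM _ _] := specE; have := EM 1%N 1%N; rewrite mul1n !coprime1n => /(_ isT isT) E1.
move=> xm; elim: n => [|n IH]; first by rewrite expn0 mul0n; lia.
by rewrite expnS EM ?coprimeXl // mulSn -modnDmr IH modnDmr.
Qed.

Lemma symbol_primes n : (0 < n)%N ->
  (forall q, prime q -> (q %| n)%N -> coprime q m /\ (3 %| E q)%N) ->
  coprime n m /\ (3 %| E n)%N.
Proof.
have [EM _ _] := specE.
elim/ltn_ind: n => n IH n0 primes_n; have [n1|n_gt1] := leqP n 1.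
  have -> : n = 1%N by case: n n0 n1 {IH primes_n} => [|[|]].
  rewrite coprime1n; split=> //; have := @symbol_exp 1 0; rewrite coprime1n => /(_ isT).
  by rewrite mul0n expn0 => /eqP; rewrite mod0n.
have pd := pdiv_dvd n; have pp := pdiv_prime n_gt1.
have [pm Ep] := primes_n _ pp pd.
have n'0 : (0 < n %/ pdiv n)%N by rewrite divn_gt0 ?pdiv_gt0 // dvdn_leq.
have ltn' : (n %/ pdiv n < n)%N by rewrite ltn_Pdiv ?prime_gt1.
have [|n'm En'] := IH _ ltn' n'0.
  by move=> q pq qn; apply: primes_n => //; rewrite -(divnK pd) dvdn_mulr.
rewrite -(divnK pd) coprimeMl n'm pm; split=> //.
by rewrite /dvdn EM // -/(dvdn 3 _) dvdn_addr.
Qed.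

Lemma symbol_trivial q (K : closedFieldType) (z : K) : q \in [pchar K] -> q != 3%N ->
  coprime q m -> z ^+ 2 + z + 1 = 0 ->
  (3 %| E q)%N = ((eisenstein_val A B z ^+ 2 * eisenstein_val A B (z ^+ 2))
     ^+ ((q ^ 2).-1 %/ 3) == 1).
Proof.
move=> chq q3 qm ez; have [_ _ Ev] := specE; rewrite (Ev q K) //.
have nz3 : 3%:R != 0 :> K.
  by rewrite -(dvdn_pcharf chq) dvdn_prime2 ?(pcharf_prime chq).
by rewrite (prim_order_dvd (prim3_root ez nz3)).
Qed.

End SymbolSpec.

Lemma modz2_cases (x : int) : (x %% 2)%Z = 0 \/ (x %% 2)%Z = 1.
Proof. lia. Qed.

Lemma intr_mod2 (K : nzRingType) (x : int) : 2%N \in [pchar K] ->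
  x%:~R = (x %% 2)%Z%:~R :> K.
Proof.
move=> ch2; rewrite {1}(divz_eq x 2) rmorphD rmorphM /=.
by rewrite -[2%:~R]/(2%:R) (pcharf0 ch2) mulr0 add0r.
Qed.

Section UnitOfQ93.
Variables (p k : nat) (u v : int).
Hypotheses (pp : prime p) (p2 : p != 2%N) (p3 : p != 3%N) (k0 : (0 < k)%N).
Hypotheses (ou : (u %% 2)%Z = 1) (ov : (v %% 2)%Z = 1) (v3 : ~~ (3 %| v)%Z).
Hypotheses (cop_uv : coprimez u v) (pv : ~~ (p %| v)%Z).
Hypothesis uv : u ^+ 2 + 31%:R * v ^+ 2 = 2%:Z ^+ k.+2 * p%:Z.

(* In characteristic [p], [u / v] is a square root of -31 and [1 + 2 z] one of -3,
   so the base is [(29 + 3 sqrt 93) / 2]. It is [(A + B z) / v] where [A + B z] has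
   norm [27 2^k p + v^2]; modulo this norm the symbol [E] satisfies
   [3 E 3 + k E 2 + E p = 2 E v], where [E 2] is nonzero and [E v = 0]. *)
Lemma unit93_cubic_symbol : exists2 j, (3 %| j)%N = (3 %| k)%N &
  forall (K : closedFieldType) (z : K), p \in [pchar K] -> z ^+ 2 + z + 1 = 0 ->
  ((29%:R * v%:~R + 3%:R * u%:~R + 6%:R * u%:~R * z) / (2%:R * v%:~R)) ^+ ((p ^ 2).-1 %/ 3)
    = z ^+ j.
Proof.
have [A eA] : exists A, 2%:R * A = 29%:R * v + 3%:R * u.
  by exists ((29%:R * v + 3%:R * u) %/ 2)%Z; lia.
set B := 3%:R * u.
(* Four times the norm is [(2 A - B)^2 + 3 B^2 = 29^2 v^2 + 27 u^2], and [29^2 = 27 31 + 4] brings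
   in [u^2 + 31 v^2]. *)
have eM : eisenstein_norm A B = 27%:R * 2%:Z ^+ k * p%:Z + v ^+ 2.
  apply: (mulfI (isT : 4%:R != 0 :> int)).
  rewrite [LHS](_ : _ = (2%:R * A) ^+ 2 - 2%:R * (2%:R * A) * B + 4%:R * B ^+ 2);
    last by rewrite /eisenstein_norm; ring.
  rewrite [RHS](_ : _ = 27%:R * (2%:Z ^+ k.+2 * p%:Z) + 4%:R * v ^+ 2); last by rewrite !exprS; ring.
  by rewrite -uv eA /B; ring.
have nzu : u != 0 by apply: contra_eq_neq ou => ->.
(* Reciprocity asks for coprime coordinates. The rational factor [c] enters the symbols only through
   the cube [c^3]. *)
set c := gcdz A B.
have nzc : c != 0 by rewrite gcdz_eq0 negb_and /B mulf_neq0 ?orbT.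
have /dvdzP[A0 eA0] := dvdz_gcdl A B; have /dvdzP[B0 eB0] := dvdz_gcdr A B.
rewrite -/c in eA0 eB0.
have cop0 : coprimez A0 B0.
  have : (c * gcdz A0 B0 %| c)%Z.
    rewrite {2}/c dvdz_gcd; apply/andP; split.
      by rewrite [X in (_ %| X)%Z]eA0 [A0 * c]mulrC dvdz_mul2l // dvdz_gcdl.
    by rewrite [X in (_ %| X)%Z]eB0 [B0 * c]mulrC dvdz_mul2l // dvdz_gcdr.
  rewrite -[X in (_ %| X)%Z -> _]mulr1 dvdz_mul2l // dvdz1 => /eqP e1; apply/eqP.
  by move: e1; rewrite /gcdz absz_nat => ->.
have eN : eisenstein_norm A B = c ^+ 2 * eisenstein_norm A0 B0.
  by rewrite /eisenstein_norm eA0 eB0; ring.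
have dvdM (x y : int) (q : nat) : prime q -> (q %| x * y)%Z -> (q %| x)%Z || (q %| y)%Z.
  by move=> pq; rewrite !dvdzE abszM Euclid_dvdM.
have dvdX (x : int) n (q : nat) : prime q -> (q %| x ^+ n)%Z -> (q %| x)%Z.
  by move=> pq; rewrite !dvdzE abszX Euclid_dvdX // => /andP[].
have v2 : ~~ (2 %| v)%Z by move: ov; clear; lia.
have A3 : ~~ (3 %| A)%Z.
  by move: v3 eA; clear; lia.
have c3 : ~~ (3 %| c)%Z by apply: contra A3 => /dvdz_trans; apply; apply: dvdz_gcdl.
have B03 : (3 %| B0)%Z.
  have /dvdM/orP[] // : (3 %| B0 * c)%Z by rewrite -eB0 /B dvdz_mulr.
  by rewrite (negPf c3).
have A03 : ~~ (3 %| A0)%Z by apply: contra A3 => h; rewrite eA0 dvdz_mulr.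
have [E specE] := rational_cubic_reciprocity cop0 B03 A03.
have copM q : prime q -> ~~ (q %| eisenstein_norm A B)%Z ->
    coprime q `|eisenstein_norm A0 B0|%N /\ ~~ (q %| c)%Z.
  move=> pq nqM; split.
    by rewrite prime_coprime //; apply: contra nqM => h; rewrite eN dvdz_mull // dvdzE.
  by apply: contra nqM => h; rewrite eN expr2 -mulrA dvdz_mulr.
(* As [k > 0] and [v] is odd, the norm is odd and the symbol of 2 is defined. *)
have cop2 : ~~ (2 %| eisenstein_norm A B)%Z.
  rewrite eM -(prednK k0) exprS; apply/negP => h; case/negP: v2; apply: (dvdX v 2%N) => //.
  have -> : v ^+ 2 = 27%:R * (2%:Z * 2%:Z ^+ k.-1) * p%:Z + v ^+ 2 -
     2%:Z * (27%:R * 2%:Z ^+ k.-1 * p%:Z) by ring.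
  by rewrite rpredB // dvdz_mulr.
have cop3 : ~~ (3 %| eisenstein_norm A B)%Z.
  rewrite eM; apply/negP => h; case/negP: v3; apply: (dvdX v 2%N) => //.
  have -> : v ^+ 2 = 27%:R * 2%:Z ^+ k * p%:Z + v ^+ 2 -
     3%:Z * (9%:R * 2%:Z ^+ k * p%:Z) by ring.
  by rewrite rpredB // dvdz_mulr.
have copp : ~~ (p %| eisenstein_norm A B)%Z.
  rewrite eM; apply/negP => h; case/negP: pv; apply: (dvdX v 2%N) => //.
  have -> : v ^+ 2 = 27%:R * 2%:Z ^+ k * p%:Z + v ^+ 2 -
     p%:Z * (27%:R * 2%:Z ^+ k) by ring.
  by rewrite rpredB // dvdz_mulr.
have copv (q : nat) : prime q -> (q %| v)%Z -> ~~ (q %| eisenstein_norm A B)%Z.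
  move=> pq qv; apply/negP => h.
  have : (q %| 27%:R * 2%:Z ^+ k * p%:Z)%Z.
    have -> : 27%:R * 2%:Z ^+ k * p%:Z = eisenstein_norm A B - v * v by rewrite eM; ring.
    by rewrite rpredB // dvdz_mulr.
  case/(dvdM _ _ _ pq)/orP => [/(dvdM _ _ _ pq)/orP[h27|/(dvdX _ _ _ pq) h2]|hp].
  - have : (q %| 3%:Z ^+ 3)%Z by [].
    move/(dvdX _ _ _ pq); rewrite dvdzE /= dvdn_prime2 // => /eqP q3.
    by move: qv; rewrite q3 (negPf v3).
  - by move: h2; rewrite dvdzE /= dvdn_prime2 // => /eqP q2; move: qv; rewrite q2 (negPf v2).
  - by move: hp; rewrite dvdzE /= dvdn_prime2 // => /eqP qp; move: qv; rewrite qp (negPf pv).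
(* Since [B0] is odd, [A0 + B0 z] reduces to [z] or [1 + z] in the field with 4 elements, where the
   exponent [(q^2 - 1) / 3] is 1. The symbol is [z] or [z^2] accordingly. *)
have E2 : ~~ (3 %| E 2)%N.
  have [K ch2] := exists_closed_field (isT : prime 2).
  have nz3 : 3%:R != 0 :> K by rewrite -(dvdn_pcharf ch2).
  have [z ez] := exists_root3 nz3; have [cop2m _] := copM 2%N isT cop2.
  rewrite (symbol_trivial specE ch2 isT cop2m ez) expr1.
  have c20 : 2%:R = 0 :> K := pcharf0 ch2.
  have odd1 (x : int) : (x %% 2)%Z = 1 -> x%:~R = 1 :> K.
    by move=> ox; rewrite intr_mod2 // ox.
  have even0 (x : int) : (x %% 2)%Z = 0 -> x%:~R = 0 :> K.
    by move=> ox; rewrite intr_mod2 // ox.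
  have B0odd : (B0 %% 2)%Z = 1.
    have [B0e|//] := modz2_cases B0; have : (2 %| B)%Z.
      by rewrite eB0 dvdz_mulr //; move: B0e; clear; lia.
    by rewrite /B; move: ou; clear; lia.
  have prim_z := prim3_root ez nz3.
  have zE : z ^+ 2 = - z - 1 by apply/eqP; rewrite -subr_eq0 -ez; apply/eqP; ring.
  rewrite /eisenstein_val (odd1 B0) // !mul1r.
  have [A0e|A0o] := modz2_cases A0.
    rewrite (even0 A0) // !add0r -exprD; have := prim_order_dvd prim_z 4.
    by move=> <-.
  rewrite (odd1 A0) // zE.
  have -> : (1 + z) ^+ 2 * (1 + (- z - 1)) = - (z ^+ 2 + z + 1) * z - z ^+ 2 by ring.
  rewrite ez mulNr mul0r oppr0 add0r.
  have -> : - z ^+ 2 = z ^+ 2 - 2%:R * z ^+ 2 by ring.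
  by rewrite c20 mul0r subr0 -(prim_order_dvd prim_z).
(* Modulo a prime [q] dividing [v], the element is a rational multiple of [1 + 2 z], a square root
   of -3, and its conjugate is its opposite. The symbol is thus that of a cube [y^3] with [y] in the
   field with [q^2] elements. *)
have Ev : coprime `|v|%N `|eisenstein_norm A0 B0|%N /\ (3 %| E `|v|)%N.
  apply: (symbol_primes specE); first by rewrite absz_gt0; apply: contra_eq_neq ov => ->.
  move=> q pq qv'; have qv : (q %| v)%Z by rewrite dvdzE.
  have [cop_q qc] := copM q pq (copv q pq qv); split=> //.
  have q2 : q != 2%N by apply: contraNneq v2 => e; move: qv; rewrite e.
  have q3 : q != 3%N by apply: contraNneq v3 => e; move: qv; rewrite e.
  have [K chq] := exists_closed_field pq.
  have nzn (n : nat) : ~~ (q %| n)%N -> n%:R != 0 :> K by rewrite (dvdn_pcharf chq).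
  have nzi (x : int) : ~~ (q %| x)%Z -> x%:~R != 0 :> K by rewrite (dvdz_pcharf chq).
  have nz3 : 3%:R != 0 :> K by rewrite nzn // dvdn_prime2.
  have nz2 : 2%:R != 0 :> K by rewrite nzn // dvdn_prime2.
  have [z ez] := exists_root3 nz3; rewrite (symbol_trivial specE chq q3 cop_q ez).
  have nzcK := nzi c qc.
  have nzuK : u%:~R != 0 :> K.
    apply: nzi; apply/negP => qu; have : (q %| gcdz u v)%Z by rewrite dvdz_gcd qu.
    by rewrite (eqP cop_uv) dvdzE dvdn1 absz_nat gtn_eqF // prime_gt1.
  have v0 : v%:~R = 0 :> K by apply/eqP; rewrite -(dvdz_pcharf chq).
  have zE : z ^+ 2 = - z - 1 by apply/eqP; rewrite -subr_eq0 -ez; apply/eqP; ring.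
  have th2 : (1 + 2%:R * z) ^+ 2 = - 3%:R.
    by rewrite [LHS](_ : _ = 4%:R * (z ^+ 2 + z + 1) - 3%:R); [rewrite ez; ring | ring].
  have nzth : 1 + 2%:R * z != 0.
    by apply: contra_eq_neq th2 => ->; rewrite expr0n eq_sym oppr_eq0.
  pose y : K := - (3%:R * u%:~R * (1 + 2%:R * z)) / (2%:R * c%:~R).
  have eAK : 2%:R * (A0%:~R * c%:~R) = 3%:R * u%:~R :> K.
    have : (2%:R * A)%:~R = (29%:R * v + 3%:R * u)%:~R :> K by rewrite eA.
    by rewrite {1}eA0 intrD !intrM v0 mulr0 add0r.
  have eBK : B0%:~R * c%:~R = 3%:R * u%:~R :> K.
    have : B%:~R = (B0 * c)%:~R :> K by rewrite -eB0.
    by rewrite /B !intrM.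
  have -> : eisenstein_val A0 B0 z ^+ 2 * eisenstein_val A0 B0 (z ^+ 2) = y ^+ 3.
    have nzc2 : 2%:R * c%:~R != 0 :> K by rewrite mulf_neq0.
    apply: (mulIf (expf_neq0 3 nzc2)).
    have e1 : eisenstein_val A0 B0 z * (2%:R * c%:~R) = 3%:R * u%:~R * (1 + 2%:R * z).
      rewrite /eisenstein_val.
      rewrite [LHS](_ : _ = 2%:R * (A0%:~R * c%:~R) + 2%:R * (B0%:~R * c%:~R) * z); last by ring.
      by rewrite eAK eBK; ring.
    have e2 : eisenstein_val A0 B0 (z ^+ 2) * (2%:R * c%:~R) = - (3%:R * u%:~R * (1 + 2%:R * z)).
      rewrite /eisenstein_val zE.
      rewrite [LHS](_ : _ = 2%:R * (A0%:~R * c%:~R) - 2%:R * (B0%:~R * c%:~R) * (1 + z)); last by ring.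
      by rewrite eAK eBK; ring.
    rewrite [LHS](_ : _ = (eisenstein_val A0 B0 z * (2%:R * c%:~R)) ^+ 2 *
      (eisenstein_val A0 B0 (z ^+ 2) * (2%:R * c%:~R))); last by ring.
    by rewrite e1 e2 -exprMn /y divfK //; ring.
  have thF : (1 + 2%:R * z) ^+ (q ^ 2) = 1 + 2%:R * z.
    by rewrite (Frobenius2D chq) expr1n exprMn (Frobenius2_int chq 2) Frobenius2_root3.
  have -> : y = (- (3%:R * u))%:~R * (1 + 2%:R * z) / (2%:R * c)%:~R.
    by rewrite /y intrN !intrM !mulNr.
  rewrite Frobenius2_cube ?eqxx //; first by
    rewrite !mulf_neq0 ?invr_eq0 // ?intrN ?intrM ?oppr_eq0 mulf_neq0.
  by rewrite 2!exprMn exprVn thF !(Frobenius2_int chq).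
have copX n : (n = 2 \/ n = 3 \/ n = p)%N -> coprime n `|eisenstein_norm A0 B0|%N.
  by case=> [->|[->|->]]; [case: (copM 2%N isT cop2) | case: (copM 3%N isT cop3) | case: (copM p pp copp)].
have Ep : (3 %| E p)%N = (3 %| k)%N.
  have [EM Eper _] := specE.
  (* Modulo the norm, [X] is [- v^2]. As [E] takes natural arguments, the sign is removed by
     squaring; the resulting factor 2 is invertible modulo 3. *)
  pose X := (3 ^ 3 * (2 ^ k * p))%N.
  have copXm : coprime X `|eisenstein_norm A0 B0|%N.
    by rewrite !coprimeMl !coprimeXl ?copX //; auto.
  have EX : (E X = 3 * E 3 + (k * E 2 + E p) %[mod 3])%N.
    have c2 := copX 2%N (or_introl erefl).
    have c3' := copX 3%N (or_intror (or_introl erefl)).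
    have cp := copX p (or_intror (or_intror erefl)).
    have := symbol_exp specE 3 c3'; have := symbol_exp specE k c2.
    have := EM (2 ^ k)%N p; rewrite coprimeXl // => /(_ isT cp).
    have := EM (3 ^ 3)%N (2 ^ k * p)%N.
    rewrite coprimeMl !coprimeXl // cp => /(_ isT isT); rewrite -/X.
    move: (E _) (E _) (E _) (E _) (k * _)%N (E _) (E _) => a1 a2 a3 a4 a5 a6 a7.
    clear; lia.
  have [copvm Ev3] := Ev.
  have XV : (X ^ 2 = `|v| ^ 4 %[mod `|eisenstein_norm A0 B0|])%N.
    have XM : (X + `|v| ^ 2 = `|eisenstein_norm A B|)%N.
      apply/eqP; rewrite -eqz_nat PoszD gez0_abs ?eisenstein_norm_ge0 // eM.
      have P2 : (2 ^ k)%N%:Z = 2%:Z ^+ k by rewrite -natz natrX.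
      by rewrite -abszX gez0_abs ?sqr_ge0 // /X !PoszM P2 mulrA.
    have dM : (`|eisenstein_norm A0 B0| %| X + `|v| ^ 2)%N by rewrite XM eN abszM dvdn_mull.
    apply/eqP; rewrite -(eqn_modDr (X * `|v| ^ 2)).
    have -> : (X ^ 2 + X * `|v| ^ 2 = X * (X + `|v| ^ 2))%N by ring.
    have -> : (`|v| ^ 4 + X * `|v| ^ 2 = `|v| ^ 2 * (X + `|v| ^ 2))%N by ring.
    by rewrite -[X in X == _]modnMmr -[X in _ == X]modnMmr (eqP dM) !muln0.
  have E2X : (2 * E X = 4 * E `|v| %[mod 3])%N.
    by rewrite -(symbol_exp specE) // -(symbol_exp specE) // (Eper _ (`|v| ^ 4)%N) // coprimeXl.
  have : (3 %| E X)%N.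
    have : (3 %| 2 * E X)%N by rewrite /dvdn E2X -/(dvdn 3 _) dvdn_mull.
    by rewrite Gauss_dvdr.
  rewrite /dvdn EX -/(dvdn 3 _) dvdn_addr ?dvdn_mulr // => kE.
  apply/idP/idP => [Ep3|k3].
    by move: kE; rewrite dvdn_addl // Euclid_dvdM // (negPf E2) orbF.
  by move: kE; rewrite dvdn_addr // dvdn_mulr.
(* Modulo [p] the norm is [v^2], so the argument of the symbol of [p] is [(A + B z) v^2] up to the
   cube [c^3], that is, the unit times [v^3]. *)
exists (E p) => // K z chp ez.
have [copm pc] := copM p pp copp.
have [_ _ Ev'] := specE; rewrite -(Ev' p K z) // {Ev'}.
have nzn (n : nat) : ~~ (p %| n)%N -> n%:R != 0 :> K by rewrite (dvdn_pcharf chp).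
have nzi (x : int) : ~~ (p %| x)%Z -> x%:~R != 0 :> K by rewrite (dvdz_pcharf chp).
have nz2 : 2%:R != 0 :> K by rewrite nzn // dvdn_prime2.
have nzv := nzi v pv; have nzcK := nzi c pc.
have p0 : p%:~R = 0 :> K := pcharf0 chp.
have MK : (eisenstein_norm A B)%:~R = v%:~R ^+ 2 :> K.
  by rewrite eM intrD [X in X + _]intrM p0 mulr0 add0r rmorphXn.
have valAB x : eisenstein_val A B x = c%:~R * eisenstein_val A0 B0 x :> K.
  by rewrite /eisenstein_val eA0 eB0 !intrM; ring.
have eAK : 2%:R * A%:~R = 29%:R * v%:~R + 3%:R * u%:~R :> K.
  have : (2%:R * A)%:~R = (29%:R * v + 3%:R * u)%:~R :> K by rewrite eA.
  by rewrite intrD !intrM.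
have eps : (29%:R * v%:~R + 3%:R * u%:~R + 6%:R * u%:~R * z) / (2%:R * v%:~R) =
    eisenstein_val A B z / v%:~R.
  have -> : 29%:R * v%:~R + 3%:R * u%:~R + 6%:R * u%:~R * z = 2%:R * eisenstein_val A B z.
    by rewrite -eAK /eisenstein_val /B intrM; ring.
  by field; rewrite nzv nz2.
have cube x := @Frobenius2_cube K p chp p3 x.
have eV : (eisenstein_val A B z / v%:~R) ^+ ((p ^ 2).-1 %/ 3) =
    (eisenstein_val A B z / v%:~R * v%:~R ^+ 3) ^+ ((p ^ 2).-1 %/ 3).
  by rewrite [RHS]exprMn cube ?mulr1 // (Frobenius2_int chp).
have eC : forall x : K, x ^+ ((p ^ 2).-1 %/ 3) = (c%:~R ^+ 3 * x) ^+ ((p ^ 2).-1 %/ 3).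
  by move=> x; rewrite [RHS]exprMn cube ?mul1r // (Frobenius2_int chp).
rewrite eps eV [RHS]eC; congr (_ ^+ _).
have -> : eisenstein_val A B z / v%:~R * v%:~R ^+ 3 = eisenstein_val A B z * v%:~R ^+ 2 by field.
rewrite -MK -(eisenstein_normE A B ez) !valAB; ring.
Qed.

End UnitOfQ93.

(** * The roots of t^3 - t^2 - 1 *)

Section CubicRoots.
Variables (K : fieldType) (a0 a1 a2 : K).
Hypotheses (e1 : a0 + a1 + a2 = 1) (e2 : a0 * a1 + a1 * a2 + a2 * a0 = 0).
Hypotheses (e3 : a0 * a1 * a2 = 1) (nz2 : 2%:R != 0 :> K).
Hypotheses (nz29 : 29%:R != 0 :> K) (nz31 : 31%:R != 0 :> K).

Definition vandermonde3 (b0 b1 b2 : K) := (b0 - b1) * (b1 - b2) * (b2 - b0).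
Local Notation V := (vandermonde3 a0 a1 a2).

(** The discriminant of a monic cubic in the elementary symmetric functions of its roots, evaluated
    at 1, 0, 1. *)
Lemma vandermonde3_sqr : V ^+ 2 = - 31%:R.
Proof.
have -> : V ^+ 2 = (a0 + a1 + a2) ^+ 2 * (a0 * a1 + a1 * a2 + a2 * a0) ^+ 2 -
   4%:R * (a0 * a1 + a1 * a2 + a2 * a0) ^+ 3 - 4%:R * (a0 + a1 + a2) ^+ 3 * (a0 * a1 * a2) +
   18%:R * (a0 + a1 + a2) * (a0 * a1 + a1 * a2 + a2 * a0) * (a0 * a1 * a2) -
   27%:R * (a0 * a1 * a2) ^+ 2 by rewrite /vandermonde3; ring.
by rewrite e1 e2 e3; ring.
Qed.

Let nzV : V != 0.
Proof.
by apply: contra_eq_neq vandermonde3_sqr => ->; rewrite expr0n eq_sym oppr_eq0.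
Qed.

Lemma cubic_factor (t : K) : t ^+ 3 - t ^+ 2 - 1 = (t - a0) * (t - a1) * (t - a2).
Proof.
rewrite [RHS](_ : _ = t ^+ 3 - (a0 + a1 + a2) * t ^+ 2 +
  (a0 * a1 + a1 * a2 + a2 * a0) * t - a0 * a1 * a2); last by ring.
by rewrite e1 e2 e3; ring.
Qed.

Let root_exp (t : K) n : t ^+ 3 - t ^+ 2 - 1 = 0 -> t ^+ n.+3 = t ^+ n.+2 + t ^+ n.
Proof.
move=> et; apply/eqP; rewrite -subr_eq0.
have -> : t ^+ n.+3 - (t ^+ n.+2 + t ^+ n) = t ^+ n * (t ^+ 3 - t ^+ 2 - 1).
  by rewrite !exprS; ring.
by rewrite et mulr0.
Qed.

Let root0 : a0 ^+ 3 - a0 ^+ 2 - 1 = 0. Proof. by rewrite cubic_factor subrr !mul0r. Qed.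
Let root1 : a1 ^+ 3 - a1 ^+ 2 - 1 = 0.
Proof. by rewrite cubic_factor subrr mulr0 mul0r. Qed.
Let root2 : a2 ^+ 3 - a2 ^+ 2 - 1 = 0. Proof. by rewrite cubic_factor subrr mulr0. Qed.

(** Binet's formula with its denominators cleared; at [n = 2] the right side is the Vandermonde
    product up to sign. *)
Lemma C_vandermonde n : - V * (C n)%:~R =
  a0 ^+ n * (a1 - a2) + a1 ^+ n * (a2 - a0) + a2 ^+ n * (a0 - a1).
Proof.
pose P n := - V * (C n)%:~R =
  a0 ^+ n * (a1 - a2) + a1 ^+ n * (a2 - a0) + a2 ^+ n * (a0 - a1).
suff: P n /\ P n.+1 /\ P n.+2 by case.
elim: n => [|n [P0 [P1 P2]]].
  by rewrite /P /= rmorph0 rmorph1 /vandermonde3; split; [ring | split; ring].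
split=> //; split=> //; rewrite /P -[C n.+3]/(C n.+2 + C n) intrD mulrDr P2 P0.
by rewrite !(root_exp n root0) !(root_exp n root1) !(root_exp n root2); ring.
Qed.

Section Frobenius.
Variable p : nat.
Hypothesis chp : p \in [pchar K].

Let FrobB (s t : K) : (s - t) ^+ p = s ^+ p - t ^+ p.
Proof. by rewrite -!(pFrobenius_autE chp) rmorphB. Qed.

Let Frob_root (t : K) : t ^+ 3 - t ^+ 2 - 1 = 0 -> t ^+ p = a0 \/ t ^+ p = a1 \/ t ^+ p = a2.
Proof.
move=> et; have : (t ^+ p) ^+ 3 - (t ^+ p) ^+ 2 - 1 = 0.
  rewrite -!exprM ![(p * _)%N]mulnC !exprM -[X in _ - X](expr1n K p) -!FrobB et expr0n.
  by rewrite (gtn_eqF (prime_gt0 (pcharf_prime chp))).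
rewrite cubic_factor => /eqP; rewrite !mulf_eq0 !subr_eq0.
by case/orP=> [/orP[]|] /eqP; auto.
Qed.

Let Frob_inj (s t : K) : s ^+ p = t ^+ p -> s = t.
Proof. by rewrite -!(pFrobenius_autE chp) => /fmorph_inj. Qed.

Let diff01 : a0 != a1.
Proof. by apply: contraNneq nzV => e; rewrite /vandermonde3 e subrr !mul0r. Qed.
Let diff12 : a1 != a2.
Proof. by apply: contraNneq nzV => e; rewrite /vandermonde3 e subrr mulr0 mul0r. Qed.
Let diff20 : a2 != a0.
Proof. by apply: contraNneq nzV => e; rewrite /vandermonde3 e subrr mulr0. Qed.

Lemma Frobenius_fixed_C : a0 ^+ p = a0 -> a1 ^+ p = a1 -> a2 ^+ p = a2 ->
  (C p)%:~R = 0 :> K.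
Proof.
move=> f0 f1 f2; apply: (mulfI (_ : - V != 0)); first by rewrite oppr_eq0.
by rewrite C_vandermonde f0 f1 f2; ring.
Qed.

(** For [f = t^3 - t^2 - 1] one has [27 f(1/3) = -29]; this is where the prime 29 is excluded. *)
Let third (t : K) : t ^+ 3 - t ^+ 2 - 1 = 0 -> 3%:R * t - 1 != 0.
Proof.
move=> et; apply: contraNneq nz29 => e.
have -> : 29%:R = - (27%:R * (t ^+ 3 - t ^+ 2 - 1) -
    (3%:R * t - 1) * (9%:R * t ^+ 2 - 6%:R * t - 2%:R)) :> K by ring.
by rewrite et e mulr0 mul0r subrr oppr0.
Qed.

Let Frobenius_cases :
  [\/ [/\ a0 ^+ p = a0, a1 ^+ p = a1 & a2 ^+ p = a2],
      [/\ a0 ^+ p = a1, a1 ^+ p = a2 & a2 ^+ p = a0]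
        \/ [/\ a0 ^+ p = a2, a1 ^+ p = a0 & a2 ^+ p = a1],
      [/\ a0 ^+ p = a0, a1 ^+ p = a2 & a2 ^+ p = a1] |
      [/\ a0 ^+ p = a1, a1 ^+ p = a0 & a2 ^+ p = a2]
        \/ [/\ a0 ^+ p = a2, a1 ^+ p = a1 & a2 ^+ p = a0]].
Proof.
have d01 e : a0 ^+ p = e -> a1 ^+ p = e -> False.
  by move=> <- /esym/Frob_inj/eqP; rewrite (negPf diff01).
have d12 e : a1 ^+ p = e -> a2 ^+ p = e -> False.
  by move=> <- /esym/Frob_inj/eqP; rewrite (negPf diff12).
have d20 e : a2 ^+ p = e -> a0 ^+ p = e -> False.
  by move=> <- /esym/Frob_inj/eqP; rewrite (negPf diff20).
case: (Frob_root root0) => [|[|]] f0; case: (Frob_root root1) => [|[|]] f1;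
  case: (Frob_root root2) => [|[|]] f2;
  try (by case: (d01 _ f0 f1)); try (by case: (d12 _ f1 f2)); try (by case: (d20 _ f2 f0)).
- by constructor 1.
- by constructor 3.
- by constructor 4; left.
- by constructor 2; left.
- by constructor 2; right.
- by constructor 4; right.
Qed.

(** Frobenius permutes the roots. In Binet's formula a 3-cycle produces [e1^2 - 3 e2 = 1] up to
    sign, with [e1] and [e2] the symmetric functions, and a transposition fixing [b0] produces
    [(b1 - b2) (3 b0 - 1)]. Neither vanishes. *)
Lemma C_Frobenius_fixed : (C p)%:~R = 0 :> K ->
  [/\ a0 ^+ p = a0, a1 ^+ p = a1 & a2 ^+ p = a2].
Proof.
move=> Cp; have := C_vandermonde p; rewrite Cp mulr0 => /esym D0.
have transp b0 b1 b2 : 3%:R * b0 - 1 != 0 -> b1 != b2 -> b0 + b1 + b2 = 1 ->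
    b0 * (b1 - b2) + b2 * (b2 - b0) + b1 * (b0 - b1) != 0 :> K.
  move=> nz d12 s.
  have -> : b0 * (b1 - b2) + b2 * (b2 - b0) + b1 * (b0 - b1) =
     (b1 - b2) * (3%:R * b0 - (b0 + b1 + b2)) by ring.
  by rewrite s mulf_neq0 // subr_eq0.
case: Frobenius_cases => [//|[[f0 f1 f2]|[f0 f1 f2]]|[f0 f1 f2]|[[f0 f1 f2]|[f0 f1 f2]]];
  exfalso; move: D0; rewrite f0 f1 f2.
- have -> : a1 * (a1 - a2) + a2 * (a2 - a0) + a0 * (a0 - a1) =
    (a0 + a1 + a2) ^+ 2 - 3%:R * (a0 * a1 + a1 * a2 + a2 * a0) by ring.
  by rewrite e1 e2 expr1n mulr0 subr0 => /eqP; rewrite oner_eq0.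
- have -> : a2 * (a1 - a2) + a0 * (a2 - a0) + a1 * (a0 - a1) =
    3%:R * (a0 * a1 + a1 * a2 + a2 * a0) - (a0 + a1 + a2) ^+ 2 by ring.
  by rewrite e1 e2 expr1n mulr0 sub0r => /eqP; rewrite oppr_eq0 oner_eq0.
- by apply/eqP; apply: transp; rewrite ?third.
- have s201 : a2 + a0 + a1 = 1 by rewrite -e1; ring.
  have /eqP nz := transp a2 a0 a1 (third root2) diff01 s201.
  by move=> e; apply: nz; rewrite -e; ring.
- have s120 : a1 + a2 + a0 = 1 by rewrite -e1; ring.
  have /eqP nz := transp a1 a2 a0 (third root1) diff20 s120.
  by move=> e; apply: nz; rewrite -e; ring.
Qed.

(** A transposition would change the sign of the Vandermonde product, and the square of a 3-cycle is
    not trivial. *)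
Lemma Frobenius2_fixed : V ^+ p = V ->
  a0 ^+ (p ^ 2) = a0 -> a1 ^+ (p ^ 2) = a1 -> a2 ^+ (p ^ 2) = a2 ->
  [/\ a0 ^+ p = a0, a1 ^+ p = a1 & a2 ^+ p = a2].
Proof.
rewrite -mulnn !exprM /vandermonde3 !exprMn !FrobB => fV s0 s1 s2.
have odd_perm : V ^+ p = - V -> False.
  rewrite /vandermonde3 !exprMn !FrobB fV => /eqP; rewrite -/V -addr_eq0 -mulr2n -mulr_natl.
  by rewrite mulf_eq0 (negPf nz2) (negPf nzV).
case: Frobenius_cases => [//|[[f0 f1 f2]|[f0 f1 f2]]|[f0 f1 f2]|[[f0 f1 f2]|[f0 f1 f2]]].
- by move: s0; rewrite f0 f1 => e; case/eqP: diff20.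
- by move: s0; rewrite f0 f2 => e; case/eqP: diff01.
- case: odd_perm; rewrite /vandermonde3 !exprMn !FrobB f0 f1 f2; ring.
- case: odd_perm; rewrite /vandermonde3 !exprMn !FrobB f0 f1 f2; ring.
- case: odd_perm; rewrite /vandermonde3 !exprMn !FrobB f0 f1 f2; ring.
Qed.

End Frobenius.
End CubicRoots.

Lemma solve_cube (K : closedFieldType) (a : K) : exists x, x ^+ 3 = a.
Proof.
have [x ex] := @solve_monicpoly K 3 (fun i => if i == 0%N then a else 0) isT.
exists x; rewrite ex !big_ord_recl big_ord0 /= expr0 mulr1 !mul0r !addr0.
by [].
Qed.

(** For [a = 29] this gives the unit in Cardano's formula: in terms of [s = 3 t - 1] the cubic is
    [s^3 - 3 s - 29], and [s = x + 1/x] is a root when [x^3 + x^-3 = 29]. *)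
Lemma solve_reciprocal (K : closedFieldType) (a : K) : exists x, x * (a - x) = 1.
Proof.
have [x ex] := @solve_monicpoly K 2 (fun i => if i == 0%N then -1 else a) isT.
move: ex; rewrite !big_ord_recl big_ord0 /= expr0 mulr1 addr0 expr1 => ex.
by exists x; rewrite mulrBr -expr2 ex; ring.
Qed.

Lemma Frobenius_fixed_nat (K : fieldType) p (t : K) : p \in [pchar K] -> t ^+ p = t ->
  exists n : nat, t = n%:R.
Proof.
move=> chp et; have pp := pcharf_prime chp.
have pK m n : (m < p)%N -> (n < p)%N -> m%:R = n%:R :> K -> m = n.
  wlog le_mn : m n / (m <= n)%N.
    by case/orP: (leq_total m n) => le h lm ln e; [apply: h | apply/esym; apply: h].
  move=> lm ln /eqP; rewrite eq_sym -subr_eq0 -natrB // -(dvdn_pcharf chp) => d.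
  apply/eqP; rewrite eqn_leq le_mn /= -subn_eq0.
  have [//|nm0] := posnP (n - m)%N.
  have := dvdn_leq nm0 d; rewrite leqNgt (leq_ltn_trans (leq_subr _ _) ln) //.
pose rs := [seq n%:R : K | n <- iota 0 p].
have us : uniq rs.
  rewrite map_inj_in_uniq ?iota_uniq // => m n; rewrite !mem_iota !add0n /= => lm ln.
  exact: pK.
have [/mapP[n _ ->]|ntrs] := boolP (t \in rs); first by exists n.
pose P : {poly K} := 'X^p - 'X.
have : (size (t :: rs) < size P)%N.
  apply: max_poly_roots.
  - rewrite -size_poly_eq0 size_polyDl size_polyXn // size_polyN size_polyX.
    by rewrite ltnS prime_gt1.
  - rewrite /= rootE !hornerE et subrr eqxx; apply/allP => s /mapP[n _ ->].
    by rewrite rootE !hornerE -(pFrobenius_autE chp) rmorph_nat subrr.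
  - by rewrite /= ntrs.
rewrite size_polyDl size_polyXn ?size_polyN ?size_polyX ?ltnS ?prime_gt1 //.
by rewrite /= size_map size_iota ltnn.
Qed.

Section Cardano.
Variables (p : nat) (K : fieldType) (z x y : K).
Hypotheses (chp : p \in [pchar K]) (p2 : p != 2%N) (p3 : p != 3%N) (p29 : p != 29%N).
Hypotheses (p31 : p != 31%N) (ez : z ^+ 2 + z + 1 = 0).
Hypotheses (xy : x * y = 1) (x3y3 : x ^+ 3 + y ^+ 3 = 29%:R).
Let pp := pcharf_prime chp.
Let nz (q : nat) : prime q -> p != q -> q%:R != 0 :> K.
Proof. by move=> pq npq; rewrite -(dvdn_pcharf chp) dvdn_prime2. Qed.
Let nz3 : 3%:R != 0 :> K. Proof. exact: nz. Qed.

(* Cardano's formula for [t^3 - t^2 - 1], rewritten for [3 t - 1]. *)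
Definition cardano_root (s t : K) := (1 + s * x + t * y) / 3%:R.
Local Notation a0 := (cardano_root 1 1).
Local Notation a1 := (cardano_root z (z ^+ 2)).
Local Notation a2 := (cardano_root (z ^+ 2) z).
Local Notation A := (1 + x + y).
Local Notation B := (1 + z * x + z ^+ 2 * y).
Local Notation C' := (1 + z ^+ 2 * x + z * y).

Let a0E : a0 = A / 3%:R. Proof. by rewrite /cardano_root !mul1r. Qed.

Let e1 : a0 + a1 + a2 = 1.
Proof.
rewrite a0E -!mulrDl [X in X / _](_ : _ = 3%:R + (z ^+ 2 + z + 1) * (x + y)); last by ring.
by rewrite ez mul0r addr0 divff.
Qed.

Let e2 : a0 * a1 + a1 * a2 + a2 * a0 = 0.
Proof.
rewrite a0E [LHS](_ : _ = (A * B + B * C' + C' * A) / 3%:R ^+ 2);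
  last by rewrite /cardano_root -exprVn; move: (3%:R^-1) => i; ring.
rewrite [X in X / _](_ : _ = 3%:R * (1 - x * y) + (z ^+ 2 + z + 1) *
  (x * y * z ^+ 2 + x ^+ 2 * z + y ^+ 2 * z - x * y * z + 2%:R * y + 3%:R * x * y + 2%:R * x));
  last by ring.
by rewrite ez xy subrr mulr0 mul0r addr0 mul0r.
Qed.

Let e3 : a0 * a1 * a2 = 1.
Proof.
rewrite a0E [LHS](_ : _ = (A * B * C') / 3%:R ^+ 3);
  last by rewrite /cardano_root -exprVn; move: (3%:R^-1) => i; ring.
rewrite [X in X / _](_ : _ = 1 + (x ^+ 3 + y ^+ 3) - 3%:R * (x * y) + (z ^+ 2 + z + 1) *
  (x * y * z ^+ 2 + x ^+ 2 * y * z ^+ 2 + x * y ^+ 2 * z ^+ 2 + x ^+ 2 * z + y ^+ 2 * z +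
   x ^+ 3 * z + y ^+ 3 * z - x * y * z + x + 3%:R * x * y + y - x ^+ 3 - y ^+ 3));
  last by ring.
rewrite ez xy x3y3 mul0r addr0.
rewrite [X in X / _](_ : _ = 3%:R ^+ 3); last by ring.
by rewrite divff ?expf_neq0.
Qed.

Let fixed := C_Frobenius_fixed e1 e2 e3 (nz (isT : prime 29) p29) (nz (isT : prime 31) p31) chp.

Let nzw : z - z ^+ 2 != 0.
Proof.
have -> : z - z ^+ 2 = z * (1 - z) by ring.
rewrite mulf_neq0 ?subr_eq0 //.
  by apply: contra_eq_neq ez => ->; rewrite expr0n !add0r oner_neq0.
apply: contra_eq_neq ez => <-; have -> : 1 ^+ 2 + 1 + 1 = 3%:R :> K by ring.
exact: nz3.
Qed.

(** [x] is a combination of roots with coefficients in the field with [p^2] elements, because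
    [3 a1 - 1 - z^2 (3 a0 - 1) = (z - z^2) x]. *)
Lemma C_zero_Frobenius2 : (C p)%:~R = 0 :> K -> x ^+ (p ^ 2) = x.
Proof.
case/fixed => f0 f1 _.
have g0 : a0 ^+ (p ^ 2) = a0 by rewrite -mulnn exprM !f0.
have g1 : a1 ^+ (p ^ 2) = a1 by rewrite -mulnn exprM !f1.
have -> : x = (3%:R * a1 - 1 - z ^+ 2 * (3%:R * a0 - 1)) / (z - z ^+ 2).
  have -> : 3%:R * a1 - 1 - z ^+ 2 * (3%:R * a0 - 1) = x * (z - z ^+ 2).
    by rewrite /cardano_root; field.
  by rewrite mulfK.
have gz := Frobenius2_root3 chp p3 ez.
move: (a0) (a1) g0 g1 => b0 b1 g0 g1.
have g3 : (3%:R : K) ^+ (p ^ 2) = 3%:R := Frobenius2_int chp 3.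
have gz2 : (z ^+ 2) ^+ (p ^ 2) = z ^+ 2 by rewrite exprAC gz.
rewrite exprMn exprVn !(Frobenius2B chp) [(3%:R * b1) ^+ _]exprMn [(z ^+ 2 * _) ^+ _]exprMn.
by rewrite (Frobenius2B chp) [(3%:R * b0) ^+ _]exprMn expr1n g3 gz2 gz g0 g1.
Qed.

Lemma C_zero_disc : (C p)%:~R = 0 :> K -> exists s : int, (p %| s ^+ 2 + 31%:R)%Z.
Proof.
case/fixed => f0 f1 f2; pose V := vandermonde3 a0 a1 a2.
have V2 : V ^+ 2 = - 31%:R := vandermonde3_sqr e1 e2 e3.
have fB (s t : K) : (s - t) ^+ p = s ^+ p - t ^+ p by rewrite -!(pFrobenius_autE chp) rmorphB.
have [n Vn] : exists n : nat, V = n%:R.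
  by apply: (Frobenius_fixed_nat chp); rewrite /V /vandermonde3 !exprMn !fB f0 f1 f2.
exists n%:Z; rewrite (dvdz_pcharf chp) rmorphD rmorphXn /=.
by rewrite -[n%:~R]/(n%:R) -Vn V2 addNr.
Qed.

(** The Vandermonde product is [r] or [- r], hence fixed by Frobenius, and the square of Frobenius
    fixes [x] and [z], hence all three roots. *)
Lemma Frobenius2_C_zero (r : K) : x ^+ (p ^ 2) = x -> r ^+ p = r -> r ^+ 2 = - 31%:R ->
  (C p)%:~R = 0 :> K.
Proof.
move=> fx fr r2; pose V := vandermonde3 a0 a1 a2.
have V2 : V ^+ 2 = - 31%:R := vandermonde3_sqr e1 e2 e3.
have fV : V ^+ p = V.
  have : (V == r) || (V == - r) by rewrite -eqf_sqr V2 r2.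
  case/orP=> /eqP -> //; by rewrite -(pFrobenius_autE chp) pFrobenius_autN pFrobenius_autE fr.
have gz := Frobenius2_root3 chp p3 ez.
have yE : y = x^-1 by rewrite -[y]mul1r -(mulVf (_ : x != 0)) -?mulrA ?xy ?mulr1 //;
  apply: contra_eq_neq xy => ->; rewrite mul0r eq_sym oner_neq0.
have g3 : (3%:R : K) ^+ (p ^ 2) = 3%:R := Frobenius2_int chp 3.
have fa s t : s ^+ (p ^ 2) = s -> t ^+ (p ^ 2) = t ->
    cardano_root s t ^+ (p ^ 2) = cardano_root s t.
  rewrite /cardano_root yE => gs gt.
  rewrite exprMn exprVn g3 2!(Frobenius2D chp) [(s * _) ^+ _]exprMn [(t * _) ^+ _]exprMn.
  by rewrite exprVn expr1n gs gt fx.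
have gz2 : (z ^+ 2) ^+ (p ^ 2) = z ^+ 2 by rewrite exprAC gz.
have [f0 f1 f2] := @Frobenius2_fixed K a0 a1 a2 e1 e2 e3 (nz (isT : prime 2) p2)
  (nz (isT : prime 31) p31) p chp fV (fa 1 1 (expr1n _ _) (expr1n _ _))
  (fa _ _ gz gz2) (fa _ _ gz2 gz).
exact: (Frobenius_fixed_C e1 e2 e3 (nz (isT : prime 31) p31) f0 f1 f2).
Qed.

End Cardano.

(** * The criterion for [p] to divide [C p], and the representations to which it applies *)

Lemma coprimez_primes (u v : int) :
  (forall q : nat, prime q -> (q %| u)%Z -> (q %| v)%Z -> False) -> coprimez u v.
Proof.
move=> noq; rewrite coprimezE; apply/negPn/negP => ncop.
have [g0|g_gt0] := posnP (gcdn `|u| `|v|).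
  move/eqP: g0; rewrite -leqn0 leqNgt gcdn_gt0 negb_or -!eqn0Ngt => /andP[/eqP u0 /eqP v0].
  by apply: (noq 2%N); rewrite // dvdzE ?u0 ?v0.
have g1 : (1 < gcdn `|u| `|v|)%N by rewrite ltn_neqAle eq_sym -/(coprime _ _) ncop.
apply: (noq _ (pdiv_prime g1)); rewrite dvdzE absz_nat.
  exact: dvdn_trans (pdiv_dvd _) (dvdn_gcdl _ _).
exact: dvdn_trans (pdiv_dvd _) (dvdn_gcdr _ _).
Qed.

Lemma prime_dvdz_sqr (q : nat) (a : int) : prime q -> (q %| a ^+ 2)%Z -> (q %| a)%Z.
Proof. by move=> pq; rewrite expr2 => /(prime_dvd_mulz pq) []. Qed.

(** [(u + v sqrt -31) / 2] is an algebraic integer of norm [2^k p]. The condition at 3 makes the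
    Eisenstein integer of [unit93_cubic_symbol] prime to 3, as reciprocity requires. *)
Definition odd_representation (p k : nat) (u v : int) :=
  [/\ (u %% 2)%Z = 1, (v %% 2)%Z = 1, ~~ (3 %| v)%Z, coprimez u v &
      u ^+ 2 + 31%:R * v ^+ 2 = 2%:Z ^+ k.+2 * p%:Z].

Section CubicCriterion.
Variable p : nat.
Hypotheses (pp : prime p) (p2 : p != 2%N) (p3 : p != 3%N) (p29 : p != 29%N).
Hypothesis p31 : p != 31%N.

Lemma odd_representation_ndvd k u v : odd_representation p k u v -> ~~ (p %| v)%Z.
Proof.
case=> _ _ _ cop uv; apply/negP => pv.
have pu : (p %| u)%Z.
  apply: (prime_dvdz_sqr pp).
  have -> : u ^+ 2 = 2%:Z ^+ k.+2 * p%:Z - v * (31%:R * v) by rewrite -uv; ring.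
  by rewrite rpredB ?dvdz_mull ?dvdz_mulr.
have : (p %| gcdz u v)%Z by rewrite dvdz_gcd pu.
by rewrite (eqP cop) dvdzE dvdn1 absz_nat gtn_eqF // prime_gt1.
Qed.

Lemma C_dvd_odd_representation k u v : (0 < k)%N -> odd_representation p k u v ->
  (p %| C p)%Z = (3 %| k)%N.
Proof.
move=> k0 rep; have pv := odd_representation_ndvd rep; case: rep => ou ov v3 cop uv.
have [j <- unitE] := unit93_cubic_symbol pp p2 p3 k0 ou ov v3 cop pv uv.
have [K chp] := exists_closed_field pp.
have nz (q : nat) : prime q -> p != q -> q%:R != 0 :> K.
  by move=> pq npq; rewrite -(dvdn_pcharf chp) dvdn_prime2.
have nz3 := nz 3%N isT p3; have nz2 := nz 2%N isT p2.
have [z ez] := exists_root3 nz3; have prim_z := prim3_root ez nz3.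
have nzv : v%:~R != 0 :> K by rewrite -(dvdz_pcharf chp).
have := unitE K z chp ez; set eps := _ / _ => epsE.
have uv0 : u%:~R ^+ 2 = - 31%:R * v%:~R ^+ 2 :> K.
  have : (u ^+ 2 + 31%:R * v ^+ 2)%:~R = 0 :> K.
    by rewrite uv intrM -[p%:~R]/(p%:R) (pcharf0 chp) mulr0.
  rewrite intrD intrM !rmorphXn /= => /eqP; rewrite addr_eq0 => /eqP ->.
  by rewrite mulNr.
(* [eps] is [(29 + 3 r) / 2] with [r = (u / v) (1 + 2 z)], so [r^2 = 93], and [29^2 - 9 93 = 4]. *)
have eps1 : eps * (29%:R - eps) = 1.
  have nz2v : 2%:R * v%:~R != 0 :> K by rewrite mulf_neq0.
  have -> : 29%:R - eps = (29%:R * v%:~R - 3%:R * u%:~R - 6%:R * u%:~R * z) / (2%:R * v%:~R).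
    by rewrite /eps; field; rewrite nzv nz2.
  apply: (mulIf (expf_neq0 2 nz2v)); rewrite /eps mulf_div -expr2 divfK ?expf_neq0 // mul1r.
  rewrite [LHS](_ : _ = 841%:R * v%:~R ^+ 2 - u%:~R ^+ 2 * (36%:R * (z ^+ 2 + z + 1) - 27%:R)); last by ring.
  by rewrite ez uv0; ring.
have [x x3] := solve_cube eps.
have nze : eps != 0 by apply: contra_eq_neq eps1 => ->; rewrite mul0r eq_sym oner_neq0.
have nzx : x != 0 by apply: contra_eq_neq x3 => ->; rewrite expr0n eq_sym.
have xy : x * x^-1 = 1 by rewrite divff.
have xy3 : x ^+ 3 + x^-1 ^+ 3 = 29%:R.
  rewrite exprVn x3; apply: (mulfI nze); rewrite mulrDr divff //.
  have e29 : eps * 29%:R = eps * eps + eps * (29%:R - eps) by ring.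
  by rewrite e29 eps1.
have Cp : (p %| C p)%Z = ((C p)%:~R == 0 :> K) by rewrite -(dvdz_pcharf chp).
rewrite Cp (prim_order_dvd prim_z) -epsE -x3; apply/eqP/eqP => [C0|x1].
  apply: (Frobenius2_cube chp) => //.
  exact: (C_zero_Frobenius2 chp p3 p29 p31 ez xy xy3).
apply: (@Frobenius2_C_zero p K z x x^-1 chp p2 p3 p31 ez xy xy3 (u%:~R / v%:~R)).
- rewrite -(prednK (_ : 0 < p ^ 2)%N) ?expn_gt0 ?prime_gt0 // exprS.
  by rewrite -(divnK (dvd3_sqr_pred pp p3)) mulnC exprM x1 mulr1.
- by rewrite -(pFrobenius_autE chp) fmorph_div !rmorph_int.
- by rewrite expr_div_n uv0 mulfK // expf_neq0.
Qed.

Lemma C_dvd_disc : (p %| C p)%Z -> exists s : int, (p %| s ^+ 2 + 31%:R)%Z.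
Proof.
move=> pC; have [K chp] := exists_closed_field pp.
have nz3 : 3%:R != 0 :> K by rewrite -(dvdn_pcharf chp) dvdn_prime2.
have [z ez] := exists_root3 nz3; have [eps eps1] := solve_reciprocal (29%:R : K).
have [x x3] := solve_cube eps.
have nze : eps != 0 by apply: contra_eq_neq eps1 => ->; rewrite mul0r eq_sym oner_neq0.
have nzx : x != 0 by apply: contra_eq_neq x3 => ->; rewrite expr0n eq_sym.
have xy : x * x^-1 = 1 by rewrite divff.
have xy3 : x ^+ 3 + x^-1 ^+ 3 = 29%:R.
  rewrite exprVn x3; apply: (mulfI nze); rewrite mulrDr divff //.
  have e29 : eps * 29%:R = eps * eps + eps * (29%:R - eps) by ring.
  by rewrite e29 eps1.
apply: (C_zero_disc chp p3 p29 p31 ez xy xy3).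
by apply/eqP; rewrite -(dvdz_pcharf chp).
Qed.

End CubicCriterion.

Section OddRepresentations.
Variable p : nat.
Hypotheses (pp : prime p) (p2 : p != 2%N).

Lemma represented_coprime (m q : nat) (x y : int) :
  m%:Z * p%:Z = x ^+ 2 + 31%:R * y ^+ 2 -> prime q -> ~~ (q %| m)%N ->
  (q %| x)%Z -> (q %| y)%Z -> False.
Proof.
move=> e pq qm /dvdzP[a ex] /dvdzP[b ey].
have : (q ^ 2 %| m * p)%N.
  have -> : (q ^ 2 %| m * p)%N = (q%:Z ^+ 2 %| m%:Z * p%:Z)%Z by rewrite dvdzE abszM abszX.
  by apply/dvdzP; exists (a ^+ 2 + 31%:R * b ^+ 2); rewrite e ex ey; ring.
have cop : coprime q m by rewrite prime_coprime.
rewrite Gauss_dvdr ?coprimeXl // => q2.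
have : (q %| p)%N by apply: dvdn_trans q2; rewrite dvdn_exp.
rewrite dvdn_prime2 // => /eqP qp; move/(dvdn_leq (prime_gt0 pp)): q2.
by rewrite qp leqNgt -{1}(expn1 p) ltn_exp2l ?prime_gt1.
Qed.

Lemma dvdz_odd2 (q : nat) (v : int) : (v %% 2)%Z = 1 -> (q %| v)%Z -> q != 2%N.
Proof. by move=> v2 qv; apply/eqP => q2; move: qv; rewrite q2; move: v2; clear; lia. Qed.

Lemma prime_dvdz_pow2M (q n : nat) (y : int) : prime q -> q != 2%N ->
  (q %| 2%:Z ^+ n * y)%Z -> (q %| y)%Z.
Proof.
move=> pq q2; elim: n => [|n IH]; first by rewrite mul1r.
rewrite exprS -mulrA => /(prime_dvd_mulz pq)[|//].
by rewrite dvdzE absz_nat dvdn_prime2 // (negPf q2).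
Qed.

(** [u] and [v] are the coordinates of the product of [X + s Y sqrt -31] and [1 + sqrt -31], the
    latter of norm [32 = 2^5]. A sign [s] for which 3 does not divide [v] exists because 3 does not
    divide both [X] and [Y]. *)
Lemma principal_odd_representation (X Y : int) : p%:Z = X ^+ 2 + 31%:R * Y ^+ 2 ->
  exists u v, odd_representation p 3 u v.
Proof.
move=> e; have op : odd p by case/even_prime: pp p2 => ->.
have XY2 : ((X + Y) %% 2)%Z = 1.
  have [m em] : exists m, p%:Z = 2%:R * m + 1.
    by exists (p./2)%:Z; rewrite -{1}(odd_double_half p) op; lia.
  have [a [b [eX eb]]] := odd_intE X; have [c [d [eY ed]]] := odd_intE Y.
  move: e; rewrite em eX eY; case: eb => ->; case: ed => ->; clear; lia.
have copXY (q : nat) : prime q -> (q %| X)%Z -> (q %| Y)%Z -> False.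
  move=> pq; apply: (@represented_coprime 1) => //; first by rewrite mul1r.
  by rewrite dvdn1 gtn_eqF // prime_gt1.
have [s [s1 s3]] : exists s : int, (s = 1 \/ s = -1) /\ ~~ (3 %| X + s * Y)%Z.
  have := copXY 3%N isT.
  have [h|h] := boolP (3 %| X + Y)%Z; last by exists 1; split; [left | rewrite mul1r].
  move=> c3; exists (-1); split; [by right | apply/negP => h'; apply: c3].
    by move: h h'; clear; lia.
  by move: h h'; clear; lia.
have v2 : ((X + s * Y) %% 2)%Z = 1.
  by case: s1 => ->; move: XY2; clear; lia.
have s2 : s ^+ 2 = 1 by case: s1 => ->.
exists (X - 31%:R * (s * Y)), (X + s * Y); split=> //.
- by move: v2; move: (s * Y); clear; lia.
- apply: coprimez_primes => q pq qu qv.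
  have qY : (q %| Y)%Z.
    apply: (prime_dvdz_pow2M (n := 5) pq (dvdz_odd2 v2 qv)).
    rewrite [X in (_ %| X)%Z](_ : _ = s * (X + s * Y - (X - 31%:R * (s * Y)))).
      by rewrite dvdz_mull // rpredB.
    by rewrite [RHS](_ : _ = s ^+ 2 * (32%:R * Y)); [rewrite s2; ring | ring].
  apply: (copXY q pq _ qY).
  by rewrite -(addrK (s * Y) X) rpredB // dvdz_mull.
- rewrite e [LHS](_ : _ = 32%:R * X ^+ 2 + 31%:R * 32%:R * s ^+ 2 * Y ^+ 2); last by ring.
  by rewrite s2; ring.
Qed.

(** The given representation has [k = 1] and serves unless 3 divides [y]. In that case
    multiplication by [(1 + sqrt -31) / 2], of norm 8, gives [k = 4]; the sign [s] makes [v] odd,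
    and 3 does not divide [v] because it does not divide [x]. *)
Lemma nonprincipal_odd_representation (x y : int) :
  8%:R * p%:Z = x ^+ 2 + 31%:R * y ^+ 2 -> (x %% 2)%Z = 1 -> (y %% 2)%Z = 1 ->
  exists k u v, [/\ (0 < k)%N, ~~ (3 %| k)%N & odd_representation p k u v].
Proof.
move=> e ox oy.
have copxy (q : nat) : prime q -> q != 2%N -> (q %| x)%Z -> (q %| y)%Z -> False.
  move=> pq q2; apply: (@represented_coprime 8) => //.
  by rewrite (Euclid_dvdX 2 3 pq) andbT dvdn_prime2 // (negPf q2).
have [y3|y3] := boolP (3 %| y)%Z; last first.
  exists 1%N, x, y; split=> //; split=> //.
  by apply: coprimez_primes => q pq qx qy; apply: (copxy q pq (dvdz_odd2 ox qx)).
have x3 : ~~ (3 %| x)%Z by apply/negP => x3; apply: (copxy 3%N).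
have [s [v [s1 ev ov]]] : exists s v : int,
    [/\ s = 1 \/ s = -1, x + s * y = 2%:R * v & (v %% 2)%Z = 1].
  have [h|h] := eqVneq ((x + y) %% 4)%Z 2%:R.
    by exists 1, ((x + y) %/ 2)%Z; split; [left | |]; move: h; clear; lia.
  exists (-1), ((x - y) %/ 2)%Z; split; [by right | |]; move: h ox oy; clear; lia.
have s2 : s ^+ 2 = 1 by case: s1 => ->.
exists 4%N, (v - 16%:R * (s * y)), v; split=> //; split=> //.
- by move: ov; move: (s * y); clear; lia.
- apply: contra x3 => v3; move: y3 v3 ev; case: s1 => ->; clear; lia.
- apply: coprimez_primes => q pq qu qv; have q2 := dvdz_odd2 ov qv.
  have qy : (q %| y)%Z.
    apply: (prime_dvdz_pow2M (n := 4) pq q2).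
    rewrite [X in (_ %| X)%Z](_ : _ = s * (v - (v - 16%:R * (s * y)))).
      by rewrite dvdz_mull // rpredB.
    by rewrite [RHS](_ : _ = s ^+ 2 * (16%:R * y)); [rewrite s2; ring | ring].
  apply: (copxy q pq q2 _ qy).
  by rewrite -(addrK (s * y) x) ev rpredB // dvdz_mull.
- have ex : x = 2%:R * v - s * y by rewrite -ev addrK.
  have e' : 8%:R * p%:Z = 4%:R * v ^+ 2 - 4%:R * v * (s * y) + 32%:R * y ^+ 2.
    rewrite e ex [LHS](_ : _ = 4%:R * v ^+ 2 - 4%:R * v * (s * y) + (s ^+ 2 + 31%:R) * y ^+ 2).
      by rewrite s2; ring.
    by ring.
  rewrite [LHS](_ : _ = 8%:R * (4%:R * v ^+ 2 - 4%:R * v * (s * y) + s ^+ 2 * (32%:R * y ^+ 2))).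
    by rewrite s2 mul1r -e'; ring.
  by ring.
Qed.

End OddRepresentations.

(** * Formal power series *)

(** A record, so that the ring structure is attached to series and not to functions [nat -> K]. *)
Record series (K : Type) := Series { coeff : nat -> K }.

HB.instance Definition _ (K : Type) := gen_eqMixin (series K).
HB.instance Definition _ (K : Type) := gen_choiceMixin (series K).

Lemma seriesP (K : Type) (f g : series K) : coeff f =1 coeff g -> f = g.
Proof. by case: f g => f [g] /= /funext ->. Qed.

Section SeriesRing.
Variable K : comNzRingType.
Implicit Types f g h : series K.

Definition series_zero : series K := Series (fun=> 0).
Definition series_opp f := Series (fun n => - coeff f n).
Definition series_add f g := Series (fun n => coeff f n + coeff g n).

Fact series_addA : associative series_add.
Proof. by move=> f g h; apply: seriesP => n /=; rewrite addrA. Qed.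
Fact series_addC : commutative series_add.
Proof. by move=> f g; apply: seriesP => n /=; rewrite addrC. Qed.
Fact series_add0 : left_id series_zero series_add.
Proof. by move=> f; apply: seriesP => n /=; rewrite add0r. Qed.
Fact series_addN : left_inverse series_zero series_opp series_add.
Proof. by move=> f; apply: seriesP => n /=; rewrite addNr. Qed.

HB.instance Definition _ := GRing.isZmodule.Build (series K)
  series_addA series_addC series_add0 series_addN.

Definition trunc N f : {poly K} := \poly_(i < N) coeff f i.

Definition series_one : series K := Series (fun n => (n == 0%N)%:R).
Definition series_mul f g :=
  Series (fun n => \sum_(i < n.+1) coeff f i * coeff g (n - i)%N).

Lemma coeff_trunc N f i : (i < N)%N -> (trunc N f)`_i = coeff f i.
Proof. by rewrite coef_poly => ->. Qed.

Lemma coeff_mulE N f g n : (n < N)%N ->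
  coeff (series_mul f g) n = (trunc N f * trunc N g)`_n.
Proof.
move=> ltnN; rewrite coefM; apply: eq_bigr => i _.
rewrite !coeff_trunc //; first by rewrite (leq_ltn_trans (leq_subr _ _)).
by rewrite (leq_trans (ltn_ord i)).
Qed.

(** A product of truncations has terms beyond the truncation order. They do not affect low
    coefficients, so that associativity is inherited from polynomials. *)
Lemma coeff_mul_poly N f (P : {poly K}) n : (n < N)%N ->
  (forall i, (i <= n)%N -> P`_i = coeff f i) -> forall Q : {poly K},
  (P * Q)`_n = (trunc N f * Q)`_n.
Proof.
move=> ltnN eqP Q; rewrite !coefM; apply: eq_bigr => i _.
by rewrite eqP ?coeff_trunc // ?(leq_trans (ltn_ord i)) -1?ltnS ?ltn_ord.
Qed.

Fact series_mulC : commutative series_mul.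
Proof.
by move=> f g; apply: seriesP => n; rewrite !(@coeff_mulE n.+1) // mulrC.
Qed.
Fact series_mulA : associative series_mul.
Proof.
have mulE f g h n : coeff (series_mul (series_mul f g) h) n =
    (trunc n.+1 f * trunc n.+1 g * trunc n.+1 h)`_n.
  rewrite (@coeff_mulE n.+1) // -(@coeff_mul_poly n.+1 (series_mul f g)
    (trunc n.+1 f * trunc n.+1 g)) // => i le_in.
  by rewrite (@coeff_mulE n.+1).
move=> f g h; apply: seriesP => n.
by rewrite (series_mulC f) !mulE mulrC mulrA.
Qed.
Fact series_mul1 : left_id series_one series_mul.
Proof.
move=> f; apply: seriesP => n /=; rewrite big_ord_recl subn0 mul1r.
by rewrite big1 ?addr0 // => i _; rewrite mul0r.
Qed.
Fact series_mulDl : left_distributive series_mul series_add.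
Proof.
move=> f g h; apply: seriesP => n /=; rewrite -big_split.
by apply: eq_bigr => i _; rewrite mulrDl.
Qed.
Fact series_one_neq0 : series_one != 0.
Proof.
by apply/eqP => /(congr1 (fun f => coeff f 0)) /= /eqP; rewrite oner_eq0.
Qed.
HB.instance Definition _ := GRing.Zmodule_isComNzRing.Build (series K)
  series_mulA series_mulC series_mul1 series_mulDl series_one_neq0.

Lemma coeff0 n : coeff (0 : series K) n = 0. Proof. by []. Qed.
Lemma coeff1 n : coeff (1 : series K) n = (n == 0%N)%:R. Proof. by []. Qed.
Lemma coeffD f g n : coeff (f + g) n = coeff f n + coeff g n. Proof. by []. Qed.
Lemma coeffN f n : coeff (- f) n = - coeff f n. Proof. by []. Qed.
Lemma coeffB f g n : coeff (f - g) n = coeff f n - coeff g n. Proof. by []. Qed.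
Lemma coeffM f g n :
  coeff (f * g) n = \sum_(i < n.+1) coeff f i * coeff g (n - i)%N.
Proof. by []. Qed.
Lemma coeffMn f m n : coeff (f *+ m) n = coeff f n *+ m.
Proof. by elim: m => // m IH; rewrite !mulrS coeffD IH. Qed.
Lemma coeff_sum I r (P : pred I) (F : I -> series K) n :
  coeff (\sum_(i <- r | P i) F i) n = \sum_(i <- r | P i) coeff (F i) n.
Proof. by elim/big_rec2: _ => // i a b _ <-. Qed.
Lemma coeffM_trunc N f g n : (n < N)%N ->
  coeff (f * g) n = (trunc N f * trunc N g)`_n.
Proof. exact: coeff_mulE. Qed.
Lemma coeff_natl m f n : coeff (m%:R * f) n = m%:R * coeff f n.
Proof. by rewrite mulr_natl coeffMn mulr_natl. Qed.
Lemma coeff0M f g : coeff (f * g) 0 = coeff f 0 * coeff g 0.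
Proof. by rewrite coeffM big_ord1. Qed.
Lemma coeff0X f n : coeff (f ^+ n) 0 = coeff f 0 ^+ n.
Proof. by elim: n => // n IH; rewrite !exprS coeff0M IH. Qed.

Definition X : series K := Series (fun n => (n == 1%N)%:R).

Lemma coeffXnM f m n :
  coeff (X ^+ m * f) n = if (n < m)%N then 0 else coeff f (n - m).
Proof.
have XM g k : coeff (X * g) k = if k is k'.+1 then coeff g k' else 0.
  rewrite coeffM; case: k => [|k]; first by rewrite big_ord1 mul0r.
  rewrite big_ord_recl mul0r add0r big_ord_recl /= mul1r big1 ?addr0.
    by rewrite subSS subn0.
  by move=> i _; rewrite mul0r.
elim: m n => [|m IH] [|n]; rewrite ?expr0 ?mul1r ?subn0 //.
  by rewrite exprS -mulrA XM.
by rewrite exprS -mulrA XM IH ltnS subSS.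
Qed.

Lemma coeffXn m n : coeff (X ^+ m) n = (n == m)%:R.
Proof.
by rewrite -[X ^+ m]mulr1 coeffXnM coeff1 subn_eq0; case: ltngtP.
Qed.

(* [eqm n] is congruence modulo [X ^+ n]. *)
Definition eqm n f g := forall i, (i < n)%N -> coeff f i = coeff g i.

Lemma eqm_refl n f : eqm n f f. Proof. by []. Qed.
Lemma eqm_sym n f g : eqm n f g -> eqm n g f.
Proof. by move=> fg i /fg. Qed.
Lemma eqm_trans n f g h : eqm n f g -> eqm n g h -> eqm n f h.
Proof. by move=> fg gh i ltin; rewrite fg ?gh. Qed.
Lemma eqmM n f f' g g' : eqm n f f' -> eqm n g g' -> eqm n (f * g) (f' * g').
Proof.
move=> ff gg i ltin; rewrite !coeffM; apply: eq_bigr => j _; rewrite ff ?gg //.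
  by rewrite (leq_ltn_trans (leq_subr _ _)).
by rewrite (leq_trans (ltn_ord j)).
Qed.
Lemma eqmX n f f' m : eqm n f f' -> eqm n (f ^+ m) (f' ^+ m).
Proof. by move=> ff; elim: m => // m IH; rewrite !exprS; apply: eqmM. Qed.
Lemma eqm_le m n f g : (m <= n)%N -> eqm n f g -> eqm m f g.
Proof. by move=> lemn fg i ltim; apply: fg; apply: leq_trans lemn. Qed.
Lemma eqmDX n f h : eqm n (f + X ^+ n * h) f.
Proof. by move=> i lin; rewrite coeffD coeffXnM lin addr0. Qed.
Lemma eqm_eq f g : (forall n, eqm n f g) -> f = g.
Proof. by move=> fg; apply: seriesP => n; apply: (fg n.+1). Qed.
Lemma eqm_0E n f : eqm n f 0 -> exists h, f = X ^+ n * h.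
Proof.
move=> f0; exists (Series (fun i => coeff f (n + i))); apply: seriesP => i.
by rewrite coeffXnM; case: ltnP => [/f0 //|le_ni]; rewrite /= subnKC.
Qed.

(** The inverse is the geometric series in [1 - f = X h]; its partial sum [S n] is an inverse modulo
    [X^n]. *)
Lemma series_inv f : coeff f 0 = 1 -> exists g, f * g = 1.
Proof.
move=> f0; have: eqm 1 (1 - f) 0 by case=> // _; rewrite coeffB f0 subrr.
case/eqm_0E => h; rewrite expr1 => defh.
pose S n := \sum_(i < n) (X * h) ^+ i.
exists (Series (fun n => coeff (S n.+1) n)); apply: eqm_eq => n.
have eS m k : (m <= k)%N -> eqm m (S k) (S m).
  move/subnKC <-; elim: (k - m)%N => [|d IH]; first by rewrite addn0.
  rewrite addnS {1}/S big_ord_recr /=; apply: eqm_trans IH.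
  rewrite exprMn => i lim; rewrite coeffD coeffXnM ltn_addr ?addr0 //.
have eG : eqm n (Series (fun n => coeff (S n.+1) n)) (S n).
  by move=> i lin /=; rewrite (eS i.+1 n).
apply: (eqm_trans (eqmM (eqm_refl f) eG)).
have -> : f * S n = 1 - X ^+ n * h ^+ n.
  rewrite -exprMn -[1 in RHS](expr1n _ n) subrXX.
  rewrite -[f](subKr 1) defh; congr (_ * _).
  by apply: eq_bigr => i _; rewrite expr1n mul1r.
by rewrite -mulrN; apply: eqmDX.
Qed.

Lemma series_mulI f g h : coeff f 0 = 1 -> f * g = f * h -> g = h.
Proof.
by case/series_inv => k fk e; rewrite -[g]mul1r -[h]mul1r -fk mulrAC e mulrAC.
Qed.

(** The Euler operator [X d/dX], a derivation; the name does not refer to theta series. *)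
Definition theta f := Series (fun n => n%:R * coeff f n).

Fact theta_is_zmod_morphism : zmod_morphism theta.
Proof. by move=> f g; apply: seriesP => n /=; rewrite mulrBr. Qed.
HB.instance Definition _ :=
  GRing.isZmodMorphism.Build _ _ theta theta_is_zmod_morphism.

Lemma coeff_theta f n : coeff (theta f) n = n%:R * coeff f n. Proof. by []. Qed.
Lemma thetaM f g : theta (f * g) = theta f * g + f * theta g.
Proof.
apply: seriesP => n; rewrite coeff_theta coeffD !coeffM -big_split big_distrr.
apply: eq_bigr => i _; rewrite !coeff_theta.
rewrite -{1}(subnKC (ltnSE (ltn_ord i))) natrD /=; ring.
Qed.
Lemma theta1 : theta 1 = 0.
Proof. by apply: seriesP => -[|n] /=; rewrite ?mul0r ?mulr0. Qed.
Lemma thetaX f n : theta (f ^+ n) = n%:R * f ^+ n.-1 * theta f.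
Proof.
elim: n => [|[|n] IH]; first by rewrite expr0 theta1 !mul0r.
  by rewrite expr0 mul1r mul1r.
rewrite exprS thetaM IH /= exprS -(natr1 n.+1); ring.
Qed.
Lemma theta_nat n : theta n%:R = 0.
Proof. by rewrite raddfMn /= theta1 mul0rn. Qed.

Lemma theta_natl n f : theta (n%:R * f) = n%:R * theta f.
Proof. by rewrite thetaM theta_nat mul0r add0r. Qed.

(** The substitution of [X^m] for [X]. *)
Definition dil m f :=
  Series (fun n => if (m %| n)%N then coeff f (n %/ m) else 0).

Lemma coeff_dil m f n :
  coeff (dil m f) n = if (m %| n)%N then coeff f (n %/ m) else 0.
Proof. by []. Qed.

Lemma coeff_dilM m f n : (0 < m)%N -> coeff (dil m f) (m * n) = coeff f n.
Proof. by move=> m0; rewrite coeff_dil dvdn_mulr // mulKn. Qed.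

Fact dil_is_zmod_morphism m : zmod_morphism (dil m).
Proof. by move=> f g; apply: seriesP => n /=; case: ifP; rewrite ?subrr. Qed.
HB.instance Definition _ m :=
  GRing.isZmodMorphism.Build _ _ (dil m) (dil_is_zmod_morphism m).

Lemma dil1 m : (0 < m)%N -> dil m 1 = 1.
Proof.
move=> m0; apply: seriesP => n /=; case: n => [|n]; first by rewrite dvdn0 div0n.
case: ifP => // /divnK; case: (_ %/ _)%N => //.
Qed.
Lemma dilM m f g : (0 < m)%N -> dil m (f * g) = dil m f * dil m g.
Proof.
move=> m0; apply: seriesP => n; rewrite coeff_dil.
have tr k h : (trunc k h \Po 'X^m) = trunc (m * k) (dil m h).
  apply/polyP => i; rewrite coef_comp_poly_Xn // !coef_poly coeff_dil.
  by case: ifP; rewrite ?if_same // ltn_divLR // mulnC.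
have ltn : (n < m * n.+1)%N by rewrite (leq_trans (ltnSn n)) ?leq_pmull.
rewrite (@coeffM_trunc (m * n.+1) (dil m f)) // -!tr -comp_polyM coef_comp_poly_Xn //.
case: ifP => // _; apply: coeffM_trunc.
by rewrite ltnS (leq_trans (leq_div n m)).
Qed.
Lemma dilX m f n : (0 < m)%N -> dil m (f ^+ n) = dil m f ^+ n.
Proof.
by move=> m0; elim: n => [|n IH]; rewrite ?dil1 // !exprS dilM ?IH.
Qed.
Lemma dil_X m : (0 < m)%N -> dil m X = X ^+ m.
Proof.
move=> m0; apply: seriesP => n; rewrite coeff_dil coeffXn /=.
case: ifP => [/dvdnP[k ->]|]; last by case: eqP => // ->; rewrite dvdnn.
by rewrite mulnK // -{2}[m]mul1n eqn_pmul2r.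
Qed.
Lemma dil_dil m n f : (0 < m)%N -> (0 < n)%N -> dil m (dil n f) = dil (m * n) f.
Proof.
move=> m0 n0; apply: seriesP => k; rewrite !coeff_dil.
case: ifP => [/dvdnP[j ->]|mk]; last first.
  case: ifP => // /(dvdn_trans (dvdn_mulr _ (dvdnn m))); by rewrite mk.
by rewrite mulnK // [(j * m)%N]mulnC dvdn_pmul2l // divnMl.
Qed.
Lemma dil_nat m n : (0 < m)%N -> dil m n%:R = n%:R.
Proof. by move=> m0; rewrite raddfMn /= dil1. Qed.
Lemma theta_dil m f : (0 < m)%N -> theta (dil m f) = m%:R * dil m (theta f).
Proof.
move=> m0; apply: seriesP => n; rewrite coeff_theta coeff_natl !coeff_dil.
case: ifP => [/dvdnP[j ->]|]; last by rewrite !mulr0.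
by rewrite mulnK // coeff_theta mulnC natrM mulrA.
Qed.
Lemma coeff0_dil m f : coeff (dil m f) 0 = coeff f 0.
Proof. by rewrite coeff_dil dvdn0 div0n. Qed.
Lemma eqm_dil m n f g : (0 < m)%N -> eqm n f g -> eqm n (dil m f) (dil m g).
Proof.
move=> m0 fg i lin; rewrite !coeff_dil; case: ifP => // _; apply: fg.
by apply: leq_ltn_trans lin; apply: leq_div.
Qed.

(** The substitution of [- X] for [X]. *)
Definition alt f := Series (fun n => (-1) ^+ n * coeff f n).
Lemma coeff_alt f n : coeff (alt f) n = (-1) ^+ n * coeff f n. Proof. by []. Qed.
Fact alt_is_zmod_morphism : zmod_morphism alt.
Proof. by move=> f g; apply: seriesP => n /=; rewrite mulrBr. Qed.
HB.instance Definition _ :=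
  GRing.isZmodMorphism.Build _ _ alt alt_is_zmod_morphism.
Lemma alt1 : alt 1 = 1.
Proof. by apply: seriesP => -[|n] /=; rewrite ?mulr1 ?mulr0. Qed.
Lemma altM f g : alt (f * g) = alt f * alt g.
Proof.
apply: seriesP => n; rewrite coeff_alt !coeffM big_distrr.
apply: eq_bigr => i _; rewrite -{1}(subnKC (ltnSE (ltn_ord i))) exprD /=; ring.
Qed.
Lemma altX f n : alt (f ^+ n) = alt f ^+ n.
Proof. by elim: n => [|n IH]; rewrite ?alt1 // !exprS altM IH. Qed.
Lemma alt_X : alt X = - X.
Proof.
apply: seriesP => -[|[|n]]; rewrite coeffN coeff_alt /=.
- by rewrite mulr0 oppr0.
- by rewrite expr1 mulr1.
- by rewrite mulr0 oppr0.
Qed.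
Lemma alt_nat n : alt n%:R = n%:R.
Proof. by rewrite raddfMn /= alt1. Qed.
Lemma altK : involutive alt.
Proof. by move=> f; apply: seriesP => n; rewrite !coeff_alt signrMK. Qed.
Lemma theta_alt f : theta (alt f) = alt (theta f).
Proof. by apply: seriesP => n; rewrite /= mulrCA. Qed.
Lemma alt_dil m f : ~~ odd m -> (0 < m)%N -> alt (dil m f) = dil m f.
Proof.
move=> evm m0; apply: seriesP => n; rewrite coeff_alt coeff_dil.
case: ifP => [/dvdnP[j ->]|]; last by rewrite mulr0.
by rewrite -signr_odd oddM (negPf evm) andbF mul1r.
Qed.
Lemma eqm_alt n f g : eqm n f g -> eqm n (alt f) (alt g).
Proof. by move=> fg i lin; rewrite !coeff_alt fg. Qed.
Lemma coeff0_alt f : coeff (alt f) 0 = coeff f 0.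
Proof. by rewrite coeff_alt mul1r. Qed.

End SeriesRing.

Lemma Frobenius_series (p : nat) (f : series 'F_p) : prime p ->
  f ^+ p = dil p f.
Proof.
move=> pp; have p0 := prime_gt0 pp; apply: eqm_eq => n i lin.
have trX m (g : series 'F_p) j : (j < n)%N ->
    coeff (g ^+ m) j = (trunc n g ^+ m)`_j.
  elim: m j => [|m IH] j ltjn; first by rewrite !expr0 coeff1 coefC; case: j ltjn.
  rewrite !exprS coeffM coefM; apply: eq_bigr => k _.
  rewrite coeff_trunc ?IH //; first by rewrite (leq_ltn_trans (leq_subr _ _)).
  by rewrite (leq_trans (ltn_ord k)).
have chP : p \in [pchar {poly 'F_p}].
  by rewrite (rmorph_pchar (@polyC 'F_p)) // pchar_Fp.
rewrite trX // coeff_dil /trunc poly_def -(pFrobenius_autE chP) rmorph_sum /= coef_sum.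
have Fp_id (c : 'F_p) : c ^+ p = c by have := expf_card c; rewrite card_Fp.
under eq_bigr => j _.
  rewrite pFrobenius_autE exprZn Fp_id -exprM coefZ coefXn.
over.
case: ifP => [/dvdnP[k def_i]|pNi]; last first.
  rewrite big1 // => j _; case: eqP => [def_i|]; last by rewrite mulr0.
  by rewrite def_i dvdn_mull in pNi.
have ltkn : (k < n)%N by rewrite (leq_ltn_trans _ lin) // def_i leq_pmulr.
rewrite def_i mulnK // (bigD1 (Ordinal ltkn)) //= eqxx mulr1 big1 ?addr0 // => j.
rewrite -val_eqE /= eqn_pmul2r // eq_sym => /negPf ->; exact: mulr0.
Qed.

(** * Theta series *)

Section FiniteProducts.
Variables (R : comNzRingType) (x : R).

(* Shanks's finite forms of the identities of Gauss: the correction terms are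
   divisible by [x ^+ n.+1]. *)
Lemma gauss_square_finite n :
  (1 + 2%:R * \sum_(1 <= s < n.+1) (-1) ^+ s * x ^+ (s ^ 2)) *
    \prod_(1 <= k < n.+1) (1 + x ^+ k) =
  \prod_(1 <= k < n.+1) (1 - x ^+ k) +
    2%:R * \sum_(1 <= s < n.+1) (-1) ^+ s * x ^+ (s * n.+1) *
      \prod_(s.+1 <= k < n.+1) (1 - x ^+ k) * \prod_(1 <= k < s) (1 + x ^+ k).
Proof.
elim: n => [|n IH]; first by rewrite !big_geq //; ring.
rewrite !(@big_nat_recr _ _ _ n.+1 1) //=.
set T := \sum_(1 <= s < n.+1) _ in IH *; set M := \prod_(1 <= k < n.+1) (1 + _) in IH *.
set N := \prod_(1 <= k < n.+1) (1 - _) in IH *.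
set S := \sum_(1 <= s < n.+1) _ in IH; set S' := \sum_(1 <= s < n.+1) _.
(* From [n] to [n + 1] the correction sum is multiplied by [1 + x^(n+1)], up to a telescoping sum
   with primitive [G]; the end values of [G] account for the terms added to the theta sum and to the
   product. *)
pose G s : R := (-1) ^+ s * x ^+ (s * n.+1) * \prod_(s <= k < n.+1) (1 - x ^+ k) *
  \prod_(1 <= k < s) (1 + x ^+ k).
have tele : S' - (1 + x ^+ n.+1) * S = G n.+1 - G 1%N.
  rewrite -(@telescope_sumr _ 1 n.+1 G) // big_distrr -sumrB.
  apply: eq_big_nat => s /andP[s0 lesn] /=.
  rewrite /G (@big_ltn _ _ _ s) // (@big_nat_recr _ _ _ n.+1) //=.
  rewrite (@big_nat_recr _ _ _ s) //= (exprS (-1) s).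
  have -> : (s * n.+2 = s * n.+1 + s)%N by lia.
  rewrite mulSn [(n.+1 + _)%N]addnC !exprD; ring.
have G1 : G 1%N = - x ^+ n.+1 * N by rewrite /G mul1n expr1 [X in _ * X]big_geq // mulr1 mulN1r.
have Gn : G n.+1 = (-1) ^+ n.+1 * x ^+ (n.+1 ^ 2) * M by rewrite /G big_geq // mulr1 mulnn.
have {tele}-> : S' = (1 + x ^+ n.+1) * S + G n.+1 - G 1%N.
  by rewrite -addrA -tele addrC subrK.
rewrite !big_geq //.
have -> : (n.+1 * n.+2 = n.+1 ^ 2 + n.+1)%N by lia.
rewrite exprD.
rewrite [LHS](_ : _ = (1 + x ^+ n.+1) * ((1 + 2%:R * T) * M) +
  2%:R * (-1) ^+ n.+1 * x ^+ (n.+1 ^ 2) * M * (1 + x ^+ n.+1)); last by ring.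
rewrite IH G1 Gn -/N; ring.
Qed.

Lemma gauss_triangle_finite n :
  (\sum_(0 <= s < n.*2) x ^+ 'C(s.+1, 2)) *
    \prod_(0 <= k < n) (1 - x ^+ k.*2.+1) =
  \sum_(0 <= s < n) x ^+ (s * n.*2.+1) *
      \prod_(s <= k < n) (1 - x ^+ k.*2.+2) * \prod_(0 <= k < s) (1 - x ^+ k.*2.+1).
Proof.
elim: n => [|n IH]; first by rewrite !big_geq // mul0r.
rewrite doubleS !(big_nat_recr n) // !(big_nat_recr n.*2.+1) //.
rewrite !(@big_nat_recr _ _ _ n.*2 0) //=.
set T := \sum_(0 <= s < n.*2) _ in IH *.
set A := \prod_(0 <= k < n) (1 - _) in IH *.
set S := \sum_(0 <= s < n) _ in IH; set S' := \sum_(0 <= s < n) _.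
pose G s : R := x ^+ (s * n.*2.+1) * (1 - x ^+ s.*2) *
   \prod_(s <= k < n) (1 - x ^+ k.*2.+2) * \prod_(0 <= k < s) (1 - x ^+ k.*2.+1).
have tele : S' - (1 - x ^+ n.*2.+1) * S = G n - G 0%N.
  rewrite -(@telescope_sumr _ 0 n G) // big_distrr -sumrB.
  apply: eq_big_nat => s /andP[s0 lesn] /=.
  rewrite /G (@big_nat_recr _ _ _ n s) //=; last exact: ltnW.
  rewrite (@big_nat_recr _ _ _ s 0) //= (@big_ltn _ _ _ s n) // doubleS.
  have -> : (s * n.*2.+3 = s * n.*2.+1 + s.*2)%N by lia.
  have -> : (s.+1 * n.*2.+1 = s * n.*2.+1 + n.*2.+1)%N by lia.
  rewrite !exprS !exprD ?exprS; ring.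
have G0 : G 0%N = 0 by rewrite /G subrr; ring.
have Gn : G n = x ^+ (n * n.*2.+1) * (1 - x ^+ n.*2) * A by rewrite /G big_geq // mulr1.
have {tele}-> : S' = (1 - x ^+ n.*2.+1) * S + G n - G 0%N.
  by rewrite -addrA -tele addrC subrK.
rewrite big_geq // -IH G0 Gn.
have -> : 'C(n.*2.+1, 2) = (n * n.*2.+1)%N.
  by rewrite bin2 /= -doubleMr doubleK mulnC. 
have -> : 'C(n.*2.+2, 2) = (n * n.*2.+1 + n.*2.+1)%N.
  by rewrite -(doubleS n) bin2 doubleS -(doubleS n) -doubleMl doubleK mulSn addnC.
have -> : (n * n.*2.+3 = n * n.*2.+1 + n.*2)%N by lia.
rewrite !exprS !exprD !exprS; move: T A {S S' IH G G0 Gn} => T A; ring.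
Qed.

(** The two factors at an odd [k] multiply to [1 - x^(2 k)], those at an even [k] to a square; the
    factors [1 - x^(4 k)] then complete the odd [k] to all of them. *)
Lemma euler_split_finite n :
  \prod_(1 <= k < n.*2.+1) (1 - x ^+ k) *
  \prod_(1 <= k < n.*2.+1) (1 - (- x) ^+ k) *
  \prod_(1 <= k < n.+1) (1 - x ^+ (4 * k)) =
  \prod_(1 <= k < n.+1) (1 - x ^+ (2 * k)) ^+ 2 *
  \prod_(1 <= k < n.*2.+1) (1 - x ^+ (2 * k)).
Proof.
elim: n => [|n IH]; first by rewrite !big_geq // !mulr1.
rewrite doubleS !(big_nat_recr n.*2.+2) // !(big_nat_recr n.*2.+1) //.
rewrite !(big_nat_recr n.+1) //=.
rewrite [LHS](_ : _ = (\prod_(1 <= k < n.*2.+1) (1 - x ^+ k) *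
  \prod_(1 <= k < n.*2.+1) (1 - (- x) ^+ k) *
  \prod_(1 <= k < n.+1) (1 - x ^+ (4 * k))) *
   ((1 - x ^+ n.*2.+1) * (1 - x ^+ n.*2.+2) * ((1 - (- x) ^+ n.*2.+1) *
   (1 - (- x) ^+ n.*2.+2)) * (1 - x ^+ (4 * n.+1)))); last by ring.
rewrite IH !(exprNn x) -!(signr_odd _ n.*2.+1) -!(signr_odd _ n.*2.+2) /= odd_double.
have e1 : (2 * n.*2.+1 = n.*2.+1 + n.*2.+1)%N by rewrite mul2n addnn.
have e2 : (2 * n.+1 = n.*2.+2)%N by rewrite mul2n doubleS.
have e3 : (4 * n.+1 = n.*2.+2 + n.*2.+2)%N by lia.
have e4 : (2 * n.*2.+2 = n.*2.+2 + n.*2.+2)%N by lia.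
rewrite /= e1 e2 e3 e4 !exprD; ring.
Qed.

End FiniteProducts.

Section Eqm.
Variable K : comNzRingType.
Implicit Types f g h : series K.
Local Notation X := (X K).

Lemma eqmD n f f' g g' : eqm n f f' -> eqm n g g' -> eqm n (f + g) (f' + g').
Proof. by move=> ff gg i lin; rewrite !coeffD ff ?gg. Qed.
Lemma eqmXn0 n m f : (n <= m)%N -> eqm n (X ^+ m * f) 0.
Proof. by move=> lenm i lin; rewrite coeffXnM (leq_trans lin). Qed.
Lemma eqm_sum0 n m k (F : nat -> series K) :
  (forall i, (m <= i < k)%N -> eqm n (F i) 0) -> eqm n (\sum_(m <= i < k) F i) 0.
Proof.
by move=> F0 j ljn; rewrite coeff_sum big_nat big1 // => i /F0 /(_ j ljn).
Qed.

Lemma dil_prod m a b (F : nat -> series K) : (0 < m)%N ->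
  dil m (\prod_(a <= i < b) F i) = \prod_(a <= i < b) dil m (F i).
Proof. by move=> m0; apply: big_morph; [move=> f g; apply: dilM | apply: dil1]. Qed.
Lemma alt_prod a b (F : nat -> series K) :
  alt (\prod_(a <= i < b) F i) = \prod_(a <= i < b) alt (F i).
Proof. by apply: big_morph; [exact: altM | exact: alt1]. Qed.

Definition euler_prod n : series K := \prod_(1 <= k < n.+1) (1 - X ^+ k).
Definition euler : series K := Series (fun n => coeff (euler_prod n) n).
Definition square_sum n : series K :=
  1 + 2%:R * \sum_(1 <= s < n.+1) X ^+ (s ^ 2).
Definition phi : series K := Series (fun n => coeff (square_sum n) n).
Definition triangle_sum n : series K := \sum_(0 <= s < n) X ^+ 'C(s.+1, 2).
(** [triangle_sum n] stops before [s = n], hence the shift in the index. *)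
Definition psi : series K := Series (fun n => coeff (triangle_sum n.+1) n).

Lemma eqm_lim (S : nat -> series K) :
  (forall n, eqm n.+1 (S n.+1) (S n)) ->
  forall n m, (m <= n.+1)%N -> eqm m (Series (fun i => coeff (S i) i)) (S n).
Proof.
move=> S1 n m lemn i lim /=; have {m lemn lim} le_in : (i <= n)%N.
  exact: leq_trans lim lemn.
rewrite -(subnKC le_in); elim: (n - i)%N => [|d IH]; first by rewrite addn0.
by rewrite addnS S1 // ltnS leq_addr.
Qed.

Lemma eqm_euler n m : (m <= n.+1)%N -> eqm m euler (euler_prod n).
Proof.
apply: eqm_lim => k; rewrite {1}/euler_prod (@big_nat_recr _ _ _ k.+1) //=.
by rewrite mulrBr mulr1 mulrC -mulrN; apply: eqmDX.
Qed.

Lemma eqm_phi n m : (m <= n.+1)%N -> eqm m phi (square_sum n).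
Proof.
apply: eqm_lim => k; rewrite {1}/square_sum (@big_nat_recr _ _ _ k.+1) //=.
rewrite mulrDr addrA -/(square_sum k) -[X in eqm _ _ X]addr0.
apply: eqmD => //; rewrite mulrC; apply: eqmXn0; nia.
Qed.

Lemma eqm_psi n m : (m <= n)%N -> eqm m psi (triangle_sum n).
Proof.
case: n => [|n]; first by rewrite leqn0 => /eqP ->.
apply: eqm_lim => k; rewrite {1}/triangle_sum (@big_nat_recr _ _ _ k.+1) //=.
rewrite -/(triangle_sum k.+1) -[X in eqm _ _ X]addr0.
apply: eqmD => //; rewrite -[_ ^+ _]mulr1; apply: eqmXn0.
by rewrite binS bin1 leq_addl.
Qed.

Lemma coeff0_euler : coeff euler 0 = 1.
Proof. by rewrite (@eqm_euler 0 1) // /euler_prod big_geq. Qed.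
Lemma coeff0_psi : coeff psi 0 = 1.
Proof. by rewrite (@eqm_psi 1 1) // /triangle_sum big_nat1 bin_small. Qed.
Lemma coeff0_phi : coeff phi 0 = 1.
Proof. by rewrite (@eqm_phi 0 1) // /square_sum big_geq // mulr0 addr0. Qed.
Lemma coeff1_phi : coeff phi 1 = 2%:R.
Proof.
rewrite (@eqm_phi 1 2) // /square_sum big_nat1 coeffD coeff_natl coeffXn.
by rewrite mulr1 add0r.
Qed.

Lemma dil_euler_prod m n : (0 < m)%N ->
  dil m (euler_prod n) = \prod_(1 <= k < n.+1) (1 - X ^+ (m * k)).
Proof.
move=> m0; rewrite dil_prod //; apply: eq_bigr => k _.
by rewrite raddfB /= dil1 // dilX // dil_X // exprM.
Qed.

Lemma eqm_dil_euler k n m : (0 < k)%N -> (m <= n.+1)%N ->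
  eqm m (dil k euler) (\prod_(1 <= i < n.+1) (1 - X ^+ (k * i))).
Proof.
by move=> k0 le_mn; rewrite -dil_euler_prod //; apply: eqm_dil => //; apply: eqm_euler.
Qed.

Lemma alt_square_sum n :
  alt (square_sum n) = 1 + 2%:R * \sum_(1 <= s < n.+1) (-1) ^+ s * X ^+ (s ^ 2).
Proof.
rewrite raddfD /= alt1 altM alt_nat raddf_sum /=; congr (_ + _ * _).
apply: eq_bigr => s _; rewrite altX alt_X (exprNn X).
by rewrite -(signr_odd _ (s ^ 2)) oddX /= signr_odd.
Qed.

(** Gauss's product of [(1 - x^k) / (1 + x^k)] for [phi(-x)], without denominators. *)
Lemma gauss_square : alt phi * dil 2 euler = euler ^+ 2.
Proof.
apply: eqm_eq => n.
have e_phi : eqm n (alt phi) (1 + 2%:R * \sum_(1 <= s < n.+1) (-1) ^+ s * X ^+ (s ^ 2)).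
  rewrite -alt_square_sum.
  by apply: eqm_alt; apply: eqm_phi.
have e_fin := gauss_square_finite X n.
set T := 1 + _ * _ in e_phi e_fin; set M := \prod_(1 <= k < n.+1) (1 + _) in e_fin.
have TM : eqm n (T * M) (euler_prod n).
  rewrite e_fin -[X in eqm _ _ X]addr0; apply: eqmD => //.
  rewrite big_distrr; apply: eqm_sum0 => s /andP[s0 _] /=.
  rewrite -!mulrA mulrA mulrCA; apply: eqmXn0; nia.
have MN : M * euler_prod n = \prod_(1 <= i < n.+1) (1 - X ^+ (2 * i)).
  rewrite -big_split; apply: eq_bigr => i _ /=.
  by rewrite mul2n -addnn exprD; ring.
apply: (eqm_trans (eqmM e_phi (@eqm_dil_euler 2 n n _ _))) => //.
rewrite -MN mulrA expr2.
apply: (eqm_trans (eqmM TM (eqm_refl _))).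
by apply: eqmM; apply: eqm_sym; apply: eqm_euler.
Qed.

(** Gauss's product of [(1 - x^(2 k)) / (1 - x^(2 k - 1))] for [psi], without denominators. *)
Lemma gauss_triangle : psi * euler = dil 2 euler ^+ 2.
Proof.
apply: eqm_eq => n; have le_n2n : (n <= n.*2)%N by rewrite -addnn leq_addr.
have e_fin := gauss_triangle_finite X n.
set A := \prod_(0 <= k < n) (1 - _) in e_fin.
pose B : series K := \prod_(0 <= k < n) (1 - X ^+ k.*2.+2).
have AB : euler_prod n.*2 = A * B.
  rewrite /euler_prod /A /B -big_split; elim: (n) => [|k IH].
    by rewrite !big_geq.
  rewrite doubleS (@big_nat_recr _ _ _ k.*2.+2) // (@big_nat_recr _ _ _ k.*2.+1) //.
  by rewrite (@big_nat_recr _ _ _ k) //= IH mulrA.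
have eB : \prod_(1 <= i < n.+1) (1 - X ^+ (2 * i)) = B.
  by rewrite big_add1 /=; apply: eq_bigr => i _; rewrite mul2n doubleS.
have e_tri : eqm n (triangle_sum n.*2 * A) B.
  rewrite e_fin; case: (posnP n) => [n0 i|n_gt0]; first by rewrite {1}n0.
  rewrite (@big_ltn _ _ _ 0 n) // mul0n expr0 mul1r [X in _ * X + _]big_geq //.
  rewrite mulr1 -[X in eqm _ _ X]addr0; apply: eqmD => //; apply: eqm_sum0 => s /andP[s0 _].
  by rewrite -mulrA; apply: eqmXn0; nia.
apply: (@eqm_trans _ _ _ (triangle_sum n.*2 * (A * B))).
  by rewrite -AB; apply: eqmM; [apply: eqm_psi | apply: eqm_euler; apply: leqW].
rewrite mulrA expr2; apply: eqm_trans (eqmM e_tri (eqm_refl B)) _.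
by rewrite -eB; apply: eqmM; apply: eqm_sym; apply: eqm_dil_euler.
Qed.

Lemma euler_split : euler * alt euler * dil 4 euler = dil 2 euler ^+ 3.
Proof.
apply: eqm_eq => n; have le_n2n : (n <= n.*2.+1)%N by rewrite leqW // -addnn leq_addr.
have e_fin := euler_split_finite X n.
have e_alt : alt (euler_prod n.*2) = \prod_(1 <= k < n.*2.+1) (1 - (- X) ^+ k).
  by rewrite alt_prod; apply: eq_bigr => k _; rewrite raddfB /= alt1 altX alt_X.
apply: (@eqm_trans _ _ _ (euler_prod n.*2 * alt (euler_prod n.*2) *
     \prod_(1 <= k < n.+1) (1 - X ^+ (4 * k)))).
  apply: eqmM; last exact: eqm_dil_euler.
  by apply: eqmM; last apply: eqm_alt; apply: eqm_euler.
rewrite e_alt /euler_prod e_fin exprSr prodrXl; apply: eqmM.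
  by apply: eqmX; apply: eqm_sym; apply: eqm_dil_euler.
by apply: eqm_sym; apply: eqm_dil_euler.
Qed.

Lemma phiD : phi + alt phi = 2%:R * dil 4 phi.
Proof.
have fin n : square_sum n.*2 + alt (square_sum n.*2) = 2%:R * dil 4 (square_sum n).
  rewrite alt_square_sum /square_sum raddfD /= dil1 // dilM // dil_nat // raddf_sum /=.
  elim: n => [|n IH]; first by rewrite !big_geq //; ring.
  rewrite doubleS !(@big_nat_recr _ _ _ n.*2.+2 1) // !(@big_nat_recr _ _ _ n.*2.+1 1) //.
  rewrite (@big_nat_recr _ _ _ n.+1 1) //.
  rewrite dilX // dil_X // -exprM.
  have <- : (n.*2.+2 ^ 2 = 4 * n.+1 ^ 2)%N by rewrite -doubleS -mul2n expnMn.
  rewrite -(signr_odd _ n.*2.+1) -(signr_odd _ n.*2.+2) /= odd_double expr0 expr1.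
  move: IH; set A := \sum_(_ <= _ < _) _; set B := \sum_(_ <= _ < _) _.
  set C := \sum_(_ <= _ < _) _; move: (X ^+ _) (X ^+ _) => u v IH.
  rewrite [LHS](_ : _ = 1 + 2%:R * A + (1 + 2%:R * B) + 4%:R * u); last by ring.
  by rewrite IH; ring.
apply: eqm_eq => n; have le_n2n : (n <= n.*2.+1)%N by rewrite leqW // -addnn leq_addr.
apply: (@eqm_trans _ _ _ (square_sum n.*2 + alt (square_sum n.*2))).
  by apply: eqmD; last apply: eqm_alt; apply: eqm_phi.
rewrite fin; apply: eqmM => //; apply: eqm_dil => //; apply: eqm_sym.
exact: eqm_phi.
Qed.

(** The odd squares are [(2 s + 1)^2 = 8 'C(s + 1, 2) + 1]. *)
Lemma phiB : phi - alt phi = 4%:R * X * dil 8 psi.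
Proof.
have fin n : square_sum n.*2 - alt (square_sum n.*2) =
    4%:R * X * dil 8 (triangle_sum n).
  rewrite alt_square_sum /square_sum /triangle_sum raddf_sum /=.
  elim: n => [|n IH]; first by rewrite !big_geq //; ring.
  rewrite doubleS !(@big_nat_recr _ _ _ n.*2.+2 1) // !(@big_nat_recr _ _ _ n.*2.+1 1) //.
  rewrite (@big_nat_recr _ _ _ n 0) //.
  rewrite dilX // dil_X // -exprM [RHS]mulrDr -[4%:R * X * X ^+ _]mulrA -exprS.
  have <- : (n.*2.+1 ^ 2 = (8 * 'C(n.+1, 2)).+1)%N.
    have := bin2 n.+1; have := odd_double_half (n.+1 * n); rewrite oddM oddS.
    by rewrite andNb /=; nia.
  rewrite -(signr_odd _ n.*2.+1) -(signr_odd _ n.*2.+2) /= odd_double expr0 expr1.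
  move: IH; set A := \sum_(_ <= _ < _) _; set B := \sum_(_ <= _ < _) _.
  set C := \sum_(_ <= _ < _) _; move: (X ^+ _) (X ^+ _) => u v IH.
  rewrite [LHS](_ : _ = 1 + 2%:R * A - (1 + 2%:R * B) + 4%:R * v); last by ring.
  by rewrite IH; ring.
apply: eqm_eq => n; have le_n2n : (n <= n.*2.+1)%N by rewrite leqW // -addnn leq_addr.
apply: (@eqm_trans _ _ _ (square_sum n.*2 - alt (square_sum n.*2))).
  by move=> i lin; rewrite !coeffB (eqm_phi le_n2n) // (eqm_alt (eqm_phi le_n2n)).
rewrite fin; apply: eqmM => //; apply: eqm_dil => //; apply: eqm_sym.
exact: eqm_psi.
Qed.

Lemma psi_phi : psi * alt phi ^+ 2 = euler ^+ 3.
Proof.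
apply: (@series_mulI _ (euler * dil 2 euler ^+ 2)).
  by rewrite coeff0M coeff0X coeff0_dil coeff0_euler expr1n mulr1.
rewrite [LHS](_ : _ = (psi * euler) * (alt phi * dil 2 euler) ^+ 2); last by ring.
rewrite gauss_square gauss_triangle; ring.
Qed.

Lemma phi_alt : phi * alt phi = dil 2 (alt phi) ^+ 2.
Proof.
apply: (@series_mulI _ (dil 2 euler ^+ 2 * dil 4 euler ^+ 2)).
  by rewrite coeff0M !coeff0X !coeff0_dil coeff0_euler !expr1n mulr1.
have g2 := congr1 (@dil K 2) gauss_square; rewrite dilM // dil_dil // dilX // in g2.
have ga := congr1 (@alt K) gauss_square.
rewrite altM altX altK alt_dil // in ga.
rewrite [LHS](_ : _ = (phi * dil 2 euler) * (alt phi * dil 2 euler) *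
  dil 4 euler ^+ 2); last by ring.
rewrite ga gauss_square.
rewrite [RHS](_ : _ = (dil 2 (alt phi) * dil 4 euler) ^+ 2 * dil 2 euler ^+ 2); last by ring.
rewrite g2 [LHS](_ : _ = (euler * alt euler * dil 4 euler) ^+ 2); last by ring.
rewrite euler_split; ring.
Qed.

Lemma phi_psi : phi * dil 2 psi = psi ^+ 2.
Proof.
apply: (@series_mulI _ (dil 2 euler ^+ 2 * euler ^+ 2)).
  by rewrite coeff0M !coeff0X !coeff0_dil coeff0_euler !expr1n mulr1.
have g2 := congr1 (@dil K 2) gauss_triangle; rewrite dilM // dilX // dil_dil // in g2.
have ga := congr1 (@alt K) gauss_square.
rewrite altM altX altK alt_dil // in ga.
rewrite [LHS](_ : _ = (phi * dil 2 euler) * (dil 2 psi * dil 2 euler) *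
  euler ^+ 2); last by ring.
rewrite ga g2 [RHS](_ : _ = (psi * euler) ^+ 2 * dil 2 euler ^+ 2); last by ring.
rewrite gauss_triangle.
rewrite [LHS](_ : _ = (euler * alt euler * dil 4 euler) ^+ 2); last by ring.
rewrite euler_split; ring.
Qed.

Lemma dil2_fixed (c : K) (f : series K) :
  coeff f 0 = 0 -> (forall n, coeff f n = c * coeff (dil 2 f) n) -> f = 0.
Proof.
move=> f0 fE; apply: seriesP => n; elim/ltn_ind: n => -[|n] IH //.
rewrite fE coeff_dil; case: ifP => _; last by rewrite mulr0.
by rewrite IH ?mulr0 // ltn_Pdiv.
Qed.

(** By [phiD] and [phi_alt] the difference [f] of the two sides satisfies [f = -2 f(x^2)]. *)
Lemma phi_sqrD : phi ^+ 2 + alt phi ^+ 2 = 2%:R * dil 2 phi ^+ 2.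
Proof.
apply/eqP; rewrite -subr_eq0; apply/eqP; apply: (@dil2_fixed (- 2%:R)).
  by rewrite coeffB coeffD coeff_natl !coeff0X coeff0_alt coeff0_dil coeff0_phi; ring.
move=> n; rewrite mulNr -coeff_natl -coeffN; congr (coeff _ n).
rewrite !raddfB /= !raddfD /= dilM // dil_nat // !dilX // dil_dil // -phi_alt.
rewrite [LHS](_ : _ = (phi + alt phi) ^+ 2 - 2%:R * (phi * alt phi) -
   2%:R * dil 2 phi ^+ 2); last by ring.
rewrite phiD; ring.
Qed.

Lemma phi_sqrB : phi ^+ 2 - alt phi ^+ 2 = 8%:R * X * dil 4 psi ^+ 2.
Proof.
rewrite subr_sqr phiB phiD.
have := congr1 (@dil K 4) phi_psi; rewrite dilM // dil_dil // dilX // => <-; ring.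
Qed.

(** Jacobi's quartic identity between theta constants; the right side is the fourth power of
    [theta_2]. *)
Lemma phi_4B : phi ^+ 4 - alt phi ^+ 4 = 16%:R * X * dil 2 psi ^+ 4.
Proof.
rewrite [LHS](_ : _ = (phi ^+ 2 - alt phi ^+ 2) * (phi ^+ 2 + alt phi ^+ 2)); last by ring.
rewrite phi_sqrB phi_sqrD.
have := congr1 (@dil K 2) phi_psi; rewrite dilM // dil_dil // dilX // => e.
rewrite [RHS](_ : _ = 16%:R * X * (dil 2 psi ^+ 2) ^+ 2); last by ring.
rewrite -e; ring.
Qed.

End Eqm.

(** * The arithmetic-geometric mean *)

Section ArithmeticGeometricMean.
Variable K : fieldType.
Hypothesis nz2 : 2%:R != 0 :> K.
Implicit Types f g h : series K.
Local Notation X := (X K).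
Local Notation phi := (phi K).
Local Notation psi := (psi K).
Local Notation euler := (euler K).

Lemma series_fieldI f g h : coeff f 0 != 0 -> f * g = f * h -> g = h.
Proof.
move=> nzf e; apply: (@series_mulI _ (Series (fun n => (coeff f 0)^-1 * coeff f n))).
  by rewrite /= mulVf.
have sc k : Series (fun n => (coeff f 0)^-1 * coeff f n) * k =
    Series (fun n => (coeff f 0)^-1 * coeff (f * k) n).
  apply: seriesP => n; rewrite coeffM /= big_distrr.
  by apply: eq_bigr => i _; rewrite /= mulrA.
by rewrite !sc e.
Qed.

Lemma XM_inj n f g : X ^+ n * f = X ^+ n * g -> f = g.
Proof.
move=> e; apply: seriesP => i; have := congr1 (fun h => coeff h (n + i)) e.
by rewrite !coeffXnM ltnNge leq_addr /= addKn.
Qed.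

(* If [f] has order [n >= 2], the two sides have orders [2 n] and at least [n + 1]. *)
Lemma dil2_linear_eq0 u v f : coeff u 0 != 0 -> coeff v 0 != 0 ->
  u * dil 2 f = X * v * f -> eqm 2 f 0 -> f = 0.
Proof.
move=> nzu nzv ef f2; apply: eqm_eq => n; elim: n => // n IH.
have [ltn2|le2n] := ltnP n 2; first exact: eqm_le f2.
have [h def_f] := eqm_0E IH.
have h0 : coeff h 0 = 0.
  have : coeff (X ^+ n.+1 * (v * h)) n.+1 = 0.
    have -> : X ^+ n.+1 * (v * h) = X ^+ n.*2 * (u * dil 2 h).
      rewrite exprS mulrACA -mulrA -def_f mulrA [_ * v]mulrC -[v * _]mulrC -ef def_f.
      by rewrite dilM // dilX // dil_X // -exprM mul2n; ring.
    by rewrite coeffXnM ifT // -addnn; lia.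
  by rewrite coeffXnM ltnn subnn coeff0M => /eqP; rewrite mulf_eq0 (negPf nzv) => /eqP.
move=> i; rewrite ltnS leq_eqVlt => /predU1P[->|/IH //].
by rewrite def_f coeffXnM ltnn subnn h0.
Qed.

Section LogDerivative.
Variable s' : series K.
Hypothesis phiV : phi * s' = 1.
Local Notation s := phi.
Local Notation t := (alt phi).
Let k := theta s * s'.
Local Notation k' := (alt k).

Let thetas : theta s = k * s.
Proof. by rewrite /k -mulrA [s' * _]mulrC phiV mulr1. Qed.
Let thetat : theta t = k' * t.
Proof. by rewrite theta_alt thetas altM. Qed.
Let nz4 : 4%:R != 0 :> K.
Proof. by rewrite (natrM _ 2 2) mulf_neq0. Qed.
Let nz8 : 8%:R != 0 :> K.
Proof. by rewrite (natrM _ 2 4) mulf_neq0. Qed.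
Let natI n f g : n%:R != 0 :> K -> n%:R * f = n%:R * g -> f = g.
Proof.
move=> nzn; apply: series_fieldI.
by rewrite -[n%:R]mulr1 coeff_natl coeff1 mulr1.
Qed.
Let dil2t2 : dil 2 t ^+ 2 = s * t.
Proof. by rewrite phi_alt. Qed.
Let dil2s2 : 2%:R * dil 2 s ^+ 2 = s ^+ 2 + t ^+ 2.
Proof. by rewrite phi_sqrD. Qed.
Let s0 : coeff s 0 = 1. Proof. exact: coeff0_phi. Qed.

(** [k2E] and [k2'E] differentiate the two relations of the mean, and express [k] and [k'] at [x^2]
    by their values at [x]. *)
Let k2E : 2%:R * dil 2 k * (s ^+ 2 + t ^+ 2) = k * s ^+ 2 + k' * t ^+ 2.
Proof.
apply: (@natI 2) => //; have := congr1 (@theta K) dil2s2.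
rewrite thetaM theta_nat mul0r add0r raddfD /= !thetaX thetas thetat.
rewrite theta_dil // thetas dilM // => e.
rewrite -dil2s2 [RHS](_ : _ = 2%:R * s ^+ 1 * (k * s) + 2%:R * t ^+ 1 * (k' * t)).
  by rewrite -e; ring.
ring.
Qed.

Let k2'E : 4%:R * dil 2 k' = k + k'.
Proof.
apply: (@series_mulI _ (s * t)).
  by rewrite coeff0M coeff0_alt s0 mulr1.
have := congr1 (@theta K) dil2t2.
rewrite thetaX theta_dil // thetat dilM // thetaM thetas thetat => e.
rewrite [RHS](_ : _ = k * s * t + s * (k' * t)); last by ring.
by rewrite -e -dil2t2; ring.
Qed.

Local Notation a := (s ^+ 4 - t ^+ 4).

Let dil2a : 4%:R * dil 2 a = (s ^+ 2 - t ^+ 2) ^+ 2.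
Proof.
rewrite raddfB /= !dilX //.
rewrite [LHS](_ : _ = (2%:R * dil 2 s ^+ 2) ^+ 2 - 4%:R * (dil 2 t ^+ 2) ^+ 2); last by ring.
by rewrite dil2s2 dil2t2; ring.
Qed.

Let s'0 : coeff s' 0 = 1.
Proof. by have := coeff0M s s'; rewrite phiV s0 mul1r => <-. Qed.
Let k0 : coeff k 0 = 0.
Proof. by rewrite /k coeff0M coeff_theta !mul0r. Qed.
Let k1 : coeff k 1 = 2%:R.
Proof.
rewrite /k coeffM big_ord_recl big_ord1 !coeff_theta lift0 !mul0r add0r mul1r.
by rewrite subnn s'0 mulr1 coeff1_phi.
Qed.

(** The difference [f] of the two sides satisfies [4 (s^2 + t^2) f(x^2) = (s^2 - t^2) f], where
    [s^2 - t^2] is divisible by [X], and its first two coefficients vanish. *)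
Lemma log_derivative_sub : 4%:R * (k - k') = a.
Proof.
apply/eqP; rewrite -subr_eq0; apply/eqP.
apply: (@dil2_linear_eq0 (4%:R * (s ^+ 2 + t ^+ 2)) (8%:R * dil 4 psi ^+ 2)).
- rewrite coeff_natl coeffD !coeff0X coeff0_alt s0 expr1n -(natrD _ 1 1).
  by rewrite mulf_neq0.
- by rewrite coeff_natl coeff0X coeff0_dil coeff0_psi expr1n mulr1.
- rewrite [RHS](_ : _ = (8%:R * X * dil 4 psi ^+ 2) * (4%:R * (k - k') - a)); last by ring.
  rewrite -phi_sqrB raddfB /= dilM // dil_nat // raddfB /=.
  rewrite [LHS](_ : _ = 8%:R * (2%:R * dil 2 k * (s ^+ 2 + t ^+ 2)) -
    4%:R * (s ^+ 2 + t ^+ 2) * (4%:R * dil 2 k') - (s ^+ 2 + t ^+ 2) * (4%:R * dil 2 a));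
    last by ring.
  rewrite k2E k2'E dil2a; ring.
- have -> : 4%:R * (k - k') - a =
      4%:R * (k - k') - X ^+ 1 * (16%:R * dil 2 psi ^+ 4).
    by rewrite phi_4B expr1; ring.
  move=> [|[|//]] _; rewrite coeffB coeff_natl coeffB coeff_alt coeffXnM.
    by rewrite k0 mulr0 !subr0 mulr0.
  rewrite k1 ltnn subnn coeff_natl coeff0X coeff0_dil coeff0_psi expr1n expr1 coeff0; ring.
Qed.

Local Notation kappa := (4%:R * k).

(** The difference [f] of the two sides satisfies [f = 4 f(x^2)], once [k'] is eliminated by
    [log_derivative_sub] and [k(x^2)] by [k2E]. *)
Lemma log_derivative_ode : 2%:R * theta kappa = kappa ^+ 2 + a * t ^+ 4.
Proof.
have k'E : 4%:R * k' = 4%:R * k - a by rewrite -log_derivative_sub; ring.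
have k2E' : 8%:R * dil 2 k = 4%:R * k - t ^+ 2 * (s ^+ 2 - t ^+ 2).
  apply: (@series_fieldI (s ^+ 2 + t ^+ 2)).
    by rewrite coeffD !coeff0X coeff0_alt s0 expr1n -(natrD _ 1 1).
  rewrite [LHS](_ : _ = 4%:R * (2%:R * dil 2 k * (s ^+ 2 + t ^+ 2))); last by ring.
  rewrite k2E [LHS](_ : _ = 4%:R * k * s ^+ 2 + 4%:R * k' * t ^+ 2); last by ring.
  by rewrite k'E; ring.
apply/eqP; rewrite -subr_eq0; apply/eqP; apply: (@dil2_fixed _ 4%:R).
  rewrite coeffB coeffD coeff_natl coeff_theta coeff0X coeff_natl k0 coeff0M.
  by rewrite coeffB !coeff0X coeff0_alt s0; ring.
move=> n; rewrite -coeff_natl; congr (coeff _ n).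
have dil2k : dil 2 kappa = 4%:R * dil 2 k by rewrite dilM // dil_nat.
have -> : dil 2 (2%:R * theta kappa - (kappa ^+ 2 + a * t ^+ 4)) =
    2%:R * dil 2 (theta kappa) - (dil 2 kappa ^+ 2 + dil 2 a * dil 2 t ^+ 4).
  rewrite (raddfB (@dil K 2)) (raddfD (@dil K 2)) /= dilM // dil_nat //.
  by congr (_ - (_ + _)); [rewrite dilX | rewrite dilM // (dilX t)].
have thk : 8%:R * dil 2 (theta kappa) = 2%:R * theta (8%:R * dil 2 k).
  have := theta_dil kappa (isT : 0 < 2)%N.
  rewrite dil2k !theta_natl => e.
  rewrite [LHS](_ : _ = 4%:R * (2%:R * dil 2 (4%:R * theta k))); last by ring.
  rewrite -e; ring.
rewrite [RHS](_ : _ = 8%:R * dil 2 (theta kappa) - (8%:R * dil 2 k) ^+ 2 -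
   (4%:R * dil 2 a) * (dil 2 t ^+ 2) ^+ 2); last by rewrite dil2k; ring.
rewrite thk k2E' dil2a dil2t2.
rewrite theta_natl raddfB /= theta_natl thetaM raddfB /= !thetaX thetas thetat.
rewrite [RHS](_ : _ = 2%:R * (4%:R * theta k) - (4%:R * k - t ^+ 2 * (s ^+ 2 - t ^+ 2)) ^+ 2 -
  (s ^+ 2 - t ^+ 2) ^+ 2 * (s * t) ^+ 2 - 4%:R * k * t ^+ 2 * s ^+ 2 -
  (4%:R * k') * (t ^+ 2 * s ^+ 2) + 2%:R * (4%:R * k') * t ^+ 4); last by ring.
rewrite k'E; ring.
Qed.

End LogDerivative.

Let a := phi ^+ 4 - alt phi ^+ 4.
Let b := alt phi ^+ 4.

Lemma theta_constants_ode : exists kappa, [/\ theta (phi ^+ 4) = kappa * phi ^+ 4,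
  theta b = (kappa - a) * b & 2%:R * theta kappa = kappa ^+ 2 + a * b].
Proof.
have [s' e] := series_inv (coeff0_phi K).
pose k := theta phi * s'.
have thp : theta phi = k * phi by rewrite /k -mulrA [s' * _]mulrC e mulr1.
exists (4%:R * k); split; last exact: log_derivative_ode.
  by rewrite thetaX thp; ring.
rewrite /b thetaX theta_alt thp altM /a -(log_derivative_sub e) -/k; ring.
Qed.

Definition Delta : series K := X * euler ^+ 24.

(** By [phi_4B], [a = 16 x psi(x^2)^4]; the 24th power arises as the eighth power of the cube in
    [psi_phi], taken at [x^2]. *)
Lemma Delta_theta : 256%:R * dil 2 Delta = (a * b * phi ^+ 4) ^+ 2.
Proof.
rewrite /a phi_4B /Delta dilM // dil_X //.
rewrite [RHS](_ : _ = 256%:R * X ^+ 2 * (dil 2 psi ^+ 8 * (phi * alt phi) ^+ 8)).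
  rewrite phi_alt [dil 2 psi ^+ 8 * _](_ : _ = (dil 2 psi * dil 2 (alt phi) ^+ 2) ^+ 8);
    last by ring.
  have := congr1 (@dil K 2) (psi_phi K); rewrite dilM // dilX // => ->.
  by rewrite -dilX // -exprM mulrA.
by rewrite /b; ring.
Qed.

(** Logarithmic differentiation: the left side of the product formula contributes [2 P(x^2)], the
    right side [2 ((kappa + b) + (kappa - a) + kappa)]. As [D] is not a unit, its factor [X] is
    cancelled separately. *)
Lemma log_derivative_square c D h P kappa :
  c%:R != 0 :> K ->
  c%:R * dil 2 D = (a * b * phi ^+ 4) ^+ 2 -> D = X * h -> coeff h 0 = 1 ->
  theta D = P * D -> theta (phi ^+ 4) = kappa * phi ^+ 4 ->
  theta b = (kappa - a) * b -> dil 2 P = 3%:R * kappa + b - a.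
Proof.
move=> nzc DE Dh h0 thD thc thb.
have tha : theta a = (kappa + b) * a.
  by rewrite raddfB /= thc -/b thb /a -/b; ring.
move: (a) (b) (phi ^+ 4) DE thc thb tha => A B C DE thc thb tha.
have e : c%:R * (2%:R * (dil 2 P * dil 2 D)) =
    2%:R * (c%:R * dil 2 D) * (3%:R * kappa + B - A).
  rewrite -dilM // -thD -theta_dil // -theta_natl DE.
  by rewrite thetaX !thetaM tha thb thc; ring.
have DhE : dil 2 D = X ^+ 2 * dil 2 h by rewrite Dh dilM // dil_X.
apply: (@series_fieldI ((2 * c)%N%:R * dil 2 h)).
  by rewrite coeff_natl coeff0_dil h0 mulr1 natrM mulf_neq0.
apply: (@XM_inj 2); rewrite natrM.
rewrite [LHS](_ : _ = c%:R * (2%:R * (dil 2 P * (X ^+ 2 * dil 2 h)))); last by ring.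
by rewrite -DhE e DhE; ring.
Qed.

Lemma log_derivative_Delta P kappa :
  theta Delta = P * Delta -> theta (phi ^+ 4) = kappa * phi ^+ 4 ->
  theta b = (kappa - a) * b -> dil 2 P = 3%:R * kappa + b - a.
Proof.
apply: (log_derivative_square _ Delta_theta (erefl _)).
  have -> : 256%N = (2 ^ 8)%N by [].
  by rewrite natrX expf_neq0.
by rewrite coeff0X coeff0_euler expr1n.
Qed.

(** [P] is to be the Eisenstein series of weight 2, for which [P^2 - 12 theta P] is [E4]. The
    differential system eliminates [kappa]. *)
Lemma weight4_theta P : theta Delta = P * Delta ->
  dil 2 (P ^+ 2 - 12%:R * theta P) = a ^+ 2 + a * b + b ^+ 2.
Proof.
move=> thD; have [kappa [thc thb ode]] := theta_constants_ode.
have P2 := log_derivative_Delta thD thc thb.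
have tha : theta a = (kappa + b) * a.
  by rewrite /a raddfB /= thc -/b thb /a -/b; ring.
move: (a) (b) tha thb ode P2 => A B tha thb ode P2.
rewrite raddfB /= dilX // dilM // dil_nat //.
rewrite [LHS](_ : _ = dil 2 P ^+ 2 - 6%:R * (2%:R * dil 2 (theta P))); last by ring.
rewrite -theta_dil // P2 raddfB raddfD /= theta_natl thb tha.
rewrite [LHS](_ : _ = (3%:R * kappa + B - A) ^+ 2 - 9%:R * (2%:R * theta kappa) -
  6%:R * ((kappa - A) * B) + 6%:R * ((kappa + B) * A)); last by ring.
rewrite ode; ring.
Qed.

End ArithmeticGeometricMean.

(** * Eisenstein series *)

Section Lambert.
Variable K : comNzRingType.
Implicit Types f g h : series K.
Local Notation X := (X K).

(* The geometric series [X ^+ a / (1 - X ^+ a)]. *)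
Definition geom a : series K := Series (fun n => ((0 < n)%N && (a %| n)%N)%:R).

Lemma geomE a : (0 < a)%N -> (1 - X ^+ a) * geom a = X ^+ a.
Proof.
move=> a0; apply: seriesP => n; rewrite mulrBl mul1r coeffB coeffXnM coeffXn.
case: ltngtP => [ltna|ltan|->] /=.
- by rewrite subr0; case: n ltna => //= n ltna; rewrite gtnNdvd.
- have n0 := ltn_trans a0 ltan.
  by rewrite n0 subn_gt0 ltan -{1}(subnKC (ltnW ltan)) dvdn_addr // subrr.
- by rewrite a0 dvdnn subnn subr0.
Qed.

Lemma coeff0_1BXn a : (0 < a)%N -> coeff (1 - X ^+ a) 0 = 1.
Proof. by case: a => // a _; rewrite coeffB coeffXn subr0. Qed.

(** Partial fractions for [u v / ((1 - u) (1 - v))] with [u = X^a] and [v = X^c]. *)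
Lemma geomM a c : (0 < a)%N -> (0 < c)%N ->
  geom a * geom c = geom (a + c) * (1 + geom a + geom c).
Proof.
move=> a0 c0; have ac0 : (0 < a + c)%N by rewrite addn_gt0 a0.
apply: (@series_mulI _ ((1 - X ^+ a) * (1 - X ^+ c) * (1 - X ^+ (a + c)))).
  by rewrite !coeff0M !coeff0_1BXn // !mulr1.
rewrite [LHS](_ : _ = ((1 - X ^+ a) * geom a) * ((1 - X ^+ c) * geom c) *
  (1 - X ^+ (a + c))); last by ring.
rewrite [RHS](_ : _ = ((1 - X ^+ (a + c)) * geom (a + c)) *
  ((1 - X ^+ a) * (1 - X ^+ c) + ((1 - X ^+ a) * geom a) * (1 - X ^+ c) +
   (1 - X ^+ a) * ((1 - X ^+ c) * geom c))); last by ring.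
by rewrite !geomE // exprD; ring.
Qed.

Lemma theta_geom a : (0 < a)%N ->
  theta (geom a) = a%:R * (geom a + geom a ^+ 2).
Proof.
move=> a0; have gE := geomE a0; have := congr1 (@theta K) gE.
have thXa : theta (X ^+ a) = a%:R * X ^+ a.
  apply: seriesP => n; rewrite coeff_theta coeff_natl coeffXn.
  by case: eqP => [->|]; rewrite ?mulr0.
rewrite thetaM raddfB /= theta1 thXa sub0r => e.
apply: (@series_mulI _ (1 - X ^+ a)); first exact: coeff0_1BXn.
rewrite [LHS](_ : _ = a%:R * X ^+ a + a%:R * X ^+ a * geom a); last by rewrite -{1}e; ring.
rewrite [RHS](_ : _ = a%:R * ((1 - X ^+ a) * geom a) * (1 + geom a)); last by ring.
by rewrite gE; ring.
Qed.

Definition lambert k N : series K := \sum_(1 <= a < N.+1) a%:R ^+ k * geom a.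

Lemma eqm_geom n a : (n <= a)%N -> eqm n (geom a) 0.
Proof.
move=> lena [|i] lti //=; rewrite gtnNdvd //; exact: leq_trans lti lena.
Qed.

Lemma triangle_sum_swap N (F : nat -> nat -> series K) :
  \sum_(1 <= s < N.+1) \sum_(1 <= a < s) F a (s - a)%N =
  \sum_(1 <= a < N.+1) \sum_(1 <= c < N.+1 - a) F a c.
Proof.
elim: N => [|N IH]; first by rewrite !big_geq.
rewrite big_nat_recr //= IH [RHS]big_nat_recr //= [X in _ = _ + X]big_geq ?subSnn //.
rewrite addr0 -big_split; apply: eq_big_nat => a /andP[a0 leaN] /=.
by rewrite (subSn (ltnW leaN)) big_nat_recr //= subn_gt0.
Qed.

Lemma square_sum_split N (F : nat -> nat -> series K) :
  \sum_(1 <= a < N.+1) \sum_(1 <= c < N.+1) F a c =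
  \sum_(1 <= s < N.+1) \sum_(1 <= c < s) F s c +
  \sum_(1 <= s < N.+1) \sum_(1 <= c < s) F c s + \sum_(1 <= s < N.+1) F s s.
Proof.
elim: N => [|N IH]; first by rewrite !big_geq // !addr0.
rewrite !(@big_nat_recr _ _ _ N.+1) //=.
under eq_bigr => a _ do rewrite big_nat_recr //=.
by rewrite big_split /= IH; ring.
Qed.

Lemma geomM_eqm0 n a c : (0 < a)%N -> (0 < c)%N -> (n <= a + c)%N ->
  eqm n (geom a * geom c) 0.
Proof.
move=> a0 c0 len; rewrite geomM // => i lin.
have g0 := eqm_geom len; rewrite (eqmM g0 (eqm_refl _)) //.
by rewrite mul0r.
Qed.

(** The two sums differ by the pairs with [a + c > N], whose products are divisible by [X^(N+1)]. *)
Lemma square_sum_eqm N (F : nat -> nat -> series K) :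
  eqm N.+1
    (\sum_(1 <= a < N.+1) \sum_(1 <= c < N.+1) F a c * (geom a * geom c) -
     \sum_(1 <= s < N.+1) \sum_(1 <= a < s) F a (s - a)%N * (geom a * geom (s - a)))
    0.
Proof.
rewrite (triangle_sum_swap N (fun a c => F a c * (geom a * geom c))) -sumrB.
apply: eqm_sum0 => a /andP[a0 leaN].
rewrite (@big_cat_nat _ _ _ (N.+1 - a)%N) //=; last exact: leq_subr.
  rewrite [X in eqm _ (X + _)]addrC addrK; apply: eqm_sum0 => c /andP[lec _].
  rewrite -(mulr0 (F a c)); apply: eqmM => //.
  have c0 : (0 < c)%N by rewrite (leq_trans _ lec) // subn_gt0.
  by rewrite leq_subLR in lec; apply: geomM_eqm0.
by rewrite subn_gt0.
Qed.

Lemma sum_squares6 s :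
  6%:R * \sum_(1 <= c < s) c%:R ^+ 2 = (s%:R - 1) * s%:R * (2%:R * s%:R - 1) :> series K.
Proof.
case: s => [|s]; first by rewrite big_geq //; ring.
elim: s => [|s IH]; first by rewrite big_geq //; ring.
by rewrite big_nat_recr //= mulrDr IH -!(natr1 s.+1) -!(natr1 s); ring.
Qed.

(* Besge's convolution of divisor sums, from [4 a c = (a + c)^2 - (a - c)^2] and
   the reduction of [geom a * geom c] to [geom (a + c)] in [geomM]. *)
Lemma lambert_convolution N :
  eqm N.+1 (12%:R * lambert 1 N ^+ 2)
    (5%:R * lambert 3 N + lambert 1 N - 6%:R * theta (lambert 1 N)).
Proof.
pose g := geom; pose n (a : nat) : series K := a%:R.
pose SQ F : series K := \sum_(1 <= a < N.+1) \sum_(1 <= c < N.+1) F a c * (g a * g c).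
pose T F : series K := \sum_(1 <= s < N.+1) \sum_(1 <= c < s) F s c.
have L1sq : 4%:R * lambert 1 N ^+ 2 =
    SQ (fun a c => (n a + n c) ^+ 2) - SQ (fun a c => (n a - n c) ^+ 2).
  rewrite /SQ expr2 {1}/lambert big_distrl big_distrr -sumrB.
  apply: eq_bigr => a _ /=; rewrite /lambert big_distrr big_distrr -sumrB.
  by apply: eq_bigr => c _ /=; rewrite /n /g; ring.
(* The square sums reduce to these. In the end [U] and [V] cancel, and [W] is the quadratic part of
   the derivative of [lambert 1 N]. *)
pose U := T (fun s c => n s ^+ 2 * (g s * g c)).
pose V := T (fun s c => n c ^+ 2 * (g s * g c)).
pose W : series K := \sum_(1 <= s < N.+1) n s ^+ 2 * g s ^+ 2.
pose Z : series K := \sum_(1 <= s < N.+1) g s * \sum_(1 <= c < s) n c ^+ 2.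
pose Y : series K := \sum_(1 <= s < N.+1) n s ^+ 2 * (n s - 1) * g s.
pose TA := T (fun s c => n s ^+ 2 * (g c * g (s - c)%N)).
pose TE := T (fun s c => n c ^+ 2 * (g c * g (s - c)%N)).
have gM s c : (0 < c < s)%N -> g c * g (s - c)%N = g s * (1 + g c + g (s - c)%N).
  by case/andP=> c0 ltcs; rewrite /g geomM ?subn_gt0 // subnKC // ltnW.
have flip s (F : nat -> series K) : \sum_(1 <= c < s) F c = \sum_(1 <= c < s) F (s - c)%N.
  by rewrite big_nat_rev; apply: eq_big_nat => c _; rewrite add1n subSS.
have TAE : TA = Y + 2%:R * U.
  rewrite /TA /Y /U /T big_distrr -big_split; apply: eq_big_nat => s /andP[s0 _] /=.
  have -> : \sum_(1 <= c < s) n s ^+ 2 * (g c * g (s - c)%N) =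
      \sum_(1 <= c < s) n s ^+ 2 * g s + \sum_(1 <= c < s) n s ^+ 2 * (g s * g c) +
      \sum_(1 <= c < s) n s ^+ 2 * (g s * g (s - c)%N).
    by rewrite -!big_split; apply: eq_big_nat => c /gM -> /=; ring.
  rewrite -(flip s (fun c => n s ^+ 2 * (g s * g c))) sumr_const_nat -[X in X + _ + _ = _]mulr_natl natrB //.
  by rewrite /n; ring.
have BE : T (fun s c => (n s - n c) ^+ 2 * (g s * g c)) = TE - Z - V.
  rewrite /TE /Z /V /T -!sumrB; apply: eq_big_nat => s /andP[s0 _] /=.
  rewrite big_distrr -!sumrB flip; apply: eq_big_nat => c clt /=.
  have := gM s c clt; case/andP: clt => c0 ltcs e.
  rewrite /n (natrB _ (ltnW ltcs)).
  rewrite [LHS](_ : _ = c%:R ^+ 2 * (g s * g (s - c)%N)); last by ring.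
  by rewrite e; ring.
have SQB : SQ (fun a c => (n a - n c) ^+ 2) = 2%:R * (TE - Z - V).
  rewrite -BE /SQ square_sum_split mulr_natl mulr2n -/(T _) -addrA; congr (_ + _).
  rewrite [X in _ + X]big1 ?addr0; last by move=> s _; rewrite subrr; ring.
  by apply: eq_bigr => s _; apply: eq_bigr => c _; ring.
have SQE : SQ (fun a c => n a ^+ 2) = U + V + W.
  rewrite /SQ square_sum_split; congr (_ + _ + _).
  by apply: eq_bigr => s _; apply: eq_bigr => c _; rewrite [g c * _]mulrC.
have Z6 : 6%:R * Z = \sum_(1 <= s < N.+1) (n s - 1) * n s * (2%:R * n s - 1) * g s.
  rewrite big_distrr; apply: eq_bigr => s _ /=.
  by rewrite mulrCA sum_squares6 mulrC.
have thL : theta (lambert 1 N) = lambert 2 N + W.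
  rewrite raddf_sum /lambert /W -big_split; apply: eq_big_nat => s /andP[s0 _] /=.
  by rewrite expr1 theta_natl theta_geom // /n /g; ring.
have dA : eqm N.+1 (SQ (fun a c => (n a + n c) ^+ 2) - TA) 0.
  have -> : TA = \sum_(1 <= s < N.+1) \sum_(1 <= c < s)
      (n c + n (s - c)%N) ^+ 2 * (g c * g (s - c)%N).
    apply: eq_bigr => s _; apply: eq_big_nat => c /andP[_ ltcs].
    by rewrite /n -natrD subnKC // ltnW.
  exact: square_sum_eqm.
have dE : eqm N.+1 (SQ (fun a c => n a ^+ 2) - TE) 0 by apply: square_sum_eqm.
have LYZ : 3%:R * Y + 6%:R * Z = 5%:R * lambert 3 N + lambert 1 N - 6%:R * lambert 2 N.
  rewrite Z6 /Y /lambert !big_distrr -!big_split -sumrB /=.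
  by apply: eq_bigr => s _; rewrite /n /g; ring.
have -> : 12%:R * lambert 1 N ^+ 2 = 5%:R * lambert 3 N + lambert 1 N -
    6%:R * theta (lambert 1 N) +
    (3%:R * (SQ (fun a c => (n a + n c) ^+ 2) - TA) +
     6%:R * (SQ (fun a c => n a ^+ 2) - TE)).
  rewrite [LHS](_ : _ = 3%:R * (4%:R * lambert 1 N ^+ 2)); last by ring.
  rewrite L1sq SQB SQE thL TAE.
  rewrite [5%:R * _ + _ - _](_ : _ = 3%:R * Y + 6%:R * Z - 6%:R * W); last by rewrite LYZ; ring.
  by ring.
rewrite -[X in eqm _ _ X]addr0; apply: eqmD => // i lin.
by rewrite coeffD !coeff_natl dA // dE // !mulr0 addr0.
Qed.

Lemma coeff_lambert k N n : (0 < n <= N)%N ->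
  coeff (lambert k N) n = \sum_(d <- divisors n) d%:R ^+ k.
Proof.
case/andP=> n0 lenN; rewrite coeff_sum.
have -> : \sum_(d <- divisors n) d%:R ^+ k = \sum_(d <- index_iota 1 N.+1 | (d %| n)%N) d%:R ^+ k :> K.
  rewrite -[RHS]big_filter; apply: perm_big; apply: uniq_perm; first exact: divisors_uniq.
    by rewrite filter_uniq // iota_uniq.
  move=> d; rewrite mem_filter mem_index_iota -dvdn_divisors //.
  case dn: (d %| n)%N => //=; rewrite (dvdn_gt0 n0 dn) ltnS.
  by rewrite (leq_trans (dvdn_leq n0 dn) lenN).
rewrite [RHS]big_mkcond; apply: eq_bigr => d _.
rewrite -natrX coeff_natl natrX /= n0 /=; case: (d %| n)%N; by rewrite ?mulr1 ?mulr0.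
Qed.

Lemma coeff0_lambert k N : coeff (lambert k N) 0 = 0.
Proof.
by rewrite coeff_sum big1 // => d _; rewrite -natrX coeff_natl mulr0.
Qed.

Definition sigma k : series K :=
  Series (fun n => if n == 0%N then 0 else \sum_(d <- divisors n) d%:R ^+ k).

Lemma eqm_sigma k N : eqm N.+1 (sigma k) (lambert k N).
Proof.
move=> [|n] ltnN; first by rewrite coeff0_lambert.
by rewrite coeff_lambert.
Qed.

Lemma eqm_theta n f g : eqm n f g -> eqm n (theta f) (theta g).
Proof. by move=> fg i lin; rewrite !coeff_theta fg. Qed.

Definition eisenstein2 : series K := 1 - 24%:R * sigma 1.
Definition eisenstein4 : series K := 1 + 240%:R * sigma 3.

(** Ramanujan's differential equation for the Eisenstein series of weight 2, a restatement of
    Besge's convolution. *)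
Lemma ramanujan_theta_eisenstein2 :
  eisenstein4 = eisenstein2 ^+ 2 - 12%:R * theta eisenstein2.
Proof.
have conv : 12%:R * sigma 1 ^+ 2 = 5%:R * sigma 3 + sigma 1 - 6%:R * theta (sigma 1).
  apply: eqm_eq => n; apply: (@eqm_le _ n n.+1) => //.
  apply: (@eqm_trans _ _ _ (12%:R * lambert 1 n ^+ 2)).
    by apply: eqmM => //; apply: eqmX; apply: eqm_sigma.
  apply: (eqm_trans (@lambert_convolution n)) => i lin.
  rewrite !coeffB !coeffD !coeff_natl (eqm_theta (@eqm_sigma 1 n)) //.
  by rewrite !(@eqm_sigma _ n).
rewrite /eisenstein2 raddfB /= theta1 theta_natl.
rewrite [RHS](_ : _ = 1 - 48%:R * sigma 1 + 48%:R * (12%:R * sigma 1 ^+ 2) +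
  288%:R * theta (sigma 1)); last by ring.
by rewrite conv /eisenstein4; ring.
Qed.

Lemma theta_euler : theta (euler K) = - sigma 1 * euler K.
Proof.
have fin n : theta (euler_prod K n) = - lambert 1 n * euler_prod K n.
  rewrite /euler_prod /lambert; elim: n => [|n IH].
    by rewrite !big_geq // theta1 oppr0 mul0r.
  rewrite !(@big_nat_recr _ _ _ n.+1) //= thetaM IH raddfB /= theta1.
  have -> : theta (X ^+ n.+1) = n.+1%:R * ((1 - X ^+ n.+1) * geom n.+1).
    rewrite geomE //; apply: seriesP => i; rewrite coeff_theta coeff_natl coeffXn.
    by case: eqP => [->|]; rewrite ?mulr0.
  by rewrite expr1; ring.
apply: eqm_eq => n; apply: (eqm_trans (eqm_theta (@eqm_euler _ n n (leqnSn _)))).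
rewrite fin; apply: eqm_sym; apply: eqmM; last exact: eqm_euler.
by move=> i lin; rewrite !coeffN (@eqm_sigma _ n) // ltnW.
Qed.

Lemma theta_X : theta X = X.
Proof. by apply: seriesP => n; rewrite /=; case: eqP => [->|]; rewrite ?mulr1 ?mulr0. Qed.

End Lambert.

Lemma theta_Delta (K : fieldType) : theta (Delta K) = eisenstein2 K * Delta K.
Proof.
rewrite /Delta thetaM theta_X thetaX theta_euler /eisenstein2.
by move: (euler K) (sigma K 1) => E S; ring.
Qed.

Lemma Delta_eisenstein4 (K : fieldType) : 2%:R != 0 :> K ->
  let c := phi K ^+ 4 in let b := alt (phi K) ^+ 4 in
  256%:R * dil 2 (Delta K * eisenstein4 K) =
  ((c - b) * b * c) ^+ 2 * ((c - b) ^+ 2 + (c - b) * b + b ^+ 2).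
Proof.
move=> nz2 c b; rewrite dilM // mulrA (Delta_theta K) ramanujan_theta_eisenstein2.
by rewrite (weight4_theta nz2 (theta_Delta K)).
Qed.

(** * Reduction modulo 31 *)

Section Coefficients.
Variable K : comNzRingType.
Local Notation X := (X K).

Lemma coeff_phi_square k : coeff (phi K) (k ^ 2) = if k == 0%N then 1 else 2%:R.
Proof.
case: posnP => [->|k0]; first exact: coeff0_phi.
rewrite (@eqm_phi _ (k ^ 2) (k ^ 2).+1) // coeffD coeff_natl coeff1 expn_eq0.
rewrite (gtn_eqF k0) add0r coeff_sum (bigD1_seq k) ?iota_uniq //=; last first.
  by rewrite mem_index_iota k0 ltnS -mulnn leq_pmulr.
rewrite coeffXn eqxx big1 ?addr0 ?mulr1 // => s neqsk.
by rewrite coeffXn eqn_sqr eq_sym (negPf neqsk).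
Qed.

Lemma coeff_phi_nonsquare n : (forall k, n <> (k ^ 2)%N) -> coeff (phi K) n = 0.
Proof.
move=> nsq; rewrite (@eqm_phi _ n n.+1) // coeffD coeff_natl coeff1 coeff_sum.
rewrite big1 => [|s _]; last by rewrite coeffXn; case: eqP => // /nsq.
by rewrite mulr0 addr0; case: eqP => // n0; case: (nsq 0%N).
Qed.

Lemma triangle_inj : injective (fun k => 'C(k.+1, 2)).
Proof.
have mono m n : (m < n)%N -> ('C(m.+1, 2) < 'C(n.+1, 2))%N.
  move=> ltmn; apply: (@leq_trans 'C(m.+2, 2)); last exact: leq_bin2l.
  by rewrite [X in (_ < X)%N]binS bin1 -addn1 leq_add2l.
move=> m n e; case: (ltngtP m n) => // /mono; by rewrite e ltnn.
Qed.

Lemma coeff_psi_triangle k : coeff (psi K) 'C(k.+1, 2) = 1.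
Proof.
have lek : (k <= 'C(k.+1, 2))%N by rewrite binS bin1 leq_addl.
rewrite (@eqm_psi _ 'C(k.+1, 2).+1 'C(k.+1, 2).+1) // coeff_sum.
rewrite (bigD1_seq k) ?iota_uniq ?mem_index_iota //=.
rewrite coeffXn eqxx big1 ?addr0 // => s neqsk; rewrite coeffXn.
by rewrite (inj_eq triangle_inj) eq_sym (negPf neqsk).
Qed.

Lemma coeff_psi_nontriangle n :
  (forall k, n <> 'C(k.+1, 2)) -> coeff (psi K) n = 0.
Proof.
move=> ntr; rewrite (@eqm_psi _ n.+1 n.+1) // coeff_sum.
by rewrite big1 // => s _; rewrite coeffXn; case: eqP => // /ntr.
Qed.

Definition of_fps (f : fps) : series K := Series (fun n => (f n)%:~R).
Definition of_poly (P : {poly int}) : series K := Series (fun n => (P`_n)%:~R).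

Lemma of_fpsM f g : of_fps (fps_mul f g) = of_fps f * of_fps g.
Proof.
apply: seriesP => n; rewrite coeffM /= rmorph_sum.
by apply: eq_bigr => i _; rewrite rmorphM.
Qed.

Lemma of_polyM P Q : of_poly (P * Q) = of_poly P * of_poly Q.
Proof.
apply: seriesP => n; rewrite coeffM /= coefM rmorph_sum.
by apply: eq_bigr => i _; rewrite rmorphM.
Qed.

Lemma of_poly1 : of_poly 1 = 1.
Proof. by apply: seriesP => n; rewrite /= coefC; case: (n == 0%N). Qed.

Lemma of_fps_X : of_fps fps_X = X.
Proof. by apply: seriesP => n /=; rewrite /fps_X; case: (n == 1%N). Qed.

Lemma of_fps_E4 : of_fps E4 = eisenstein4 K.
Proof.
apply: seriesP => n; rewrite coeffD coeff_natl coeff1 /= /E4.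
case: eqP => [_|_]; first by rewrite mulr0 addr0.
rewrite add0r rmorphM rmorph_nat rmorph_sum; congr (_ * _).
by apply: eq_bigr => d _; rewrite /= -pmulrn natrX.
Qed.

Lemma of_fps_euler24 : of_fps euler24 = euler K ^+ 24.
Proof.
apply: seriesP => n; rewrite (eqmX 24 (@eqm_euler K n n.+1 (leqnn _))) //.
have -> : euler_prod K n ^+ 24 =
    of_poly (\prod_(1 <= k < n.+1) (1 - 'X^k) ^+ 24); last by [].
rewrite (@big_morph _ _ of_poly 1 *%R) ?of_poly1 //; last exact: of_polyM.
rewrite -prodrXl; apply: eq_bigr => k _.
have -> : 1 - X ^+ k = of_poly (1 - 'X^k).
  apply: seriesP => i; rewrite coeffB coeffXn coeff1 /= coefB coefC coefXn rmorphB.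
  by case: (i == 0%N); case: (i == k).
by elim: 24%N => [|m IH]; rewrite ?expr0 ?of_poly1 // !exprS of_polyM IH.
Qed.

End Coefficients.

Lemma of_fps_tau16 (K : fieldType) : of_fps K tau16 = Delta K * eisenstein4 K.
Proof. by rewrite /tau16 !of_fpsM of_fps_X of_fps_E4 of_fps_euler24 /Delta mulrAC. Qed.

(* For [s = phi] and [t = alt phi] the terms on the right are 32nd powers of theta
   series, by [phi_sqrD], [phi_sqrB] and [phi_4B]. *)
Lemma theta_polynomial_mod31 (R : comNzRingType) (s t : R) : 31%:R = 0 :> R ->
  let c := s ^+ 4 in let b := t ^+ 4 in
  ((c - b) * b * c) ^+ 2 * ((c - b) ^+ 2 + (c - b) * b + b ^+ 2) =
  2%:R * ((s ^+ 2 + t ^+ 2) ^+ 16 + (s ^+ 2 - t ^+ 2) ^+ 16 -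
          ((c - b) ^+ 8 + b ^+ 8 + c ^+ 8)).
Proof.
move=> c31 c b; rewrite /c /b.
have -> : s ^+ 4 = (s ^+ 2) ^+ 2 by rewrite -exprM.
have -> : t ^+ 4 = (t ^+ 2) ^+ 2 by rewrite -exprM.
move: (s ^+ 2) (t ^+ 2) => {c b} u v.
(* The polynomial multiplied by 31 is the right side minus the left side, divided by 31. *)
rewrite -[RHS]addr0 -(mul0r (- (16%:R * (u ^+ 14 * v ^+ 2 + u ^+ 2 * v ^+ 14) +
  233%:R * (u ^+ 12 * v ^+ 4 + u ^+ 4 * v ^+ 12) +
  1037%:R * (u ^+ 10 * v ^+ 6 + u ^+ 6 * v ^+ 10) +
  1656%:R * (u ^+ 8 * v ^+ 8)))) -c31; ring.
Qed.

Section Mod31.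
Local Notation phi31 := (phi 'F_31).
Local Notation psi31 := (psi 'F_31).
Local Notation Phi := (phi31 * dil 31 phi31).
Local Notation Psi := (psi31 * dil 31 psi31).
Local Notation X := (X 'F_31).

Lemma F31_0 : 31%:R = 0 :> 'F_31.
Proof. by apply/val_inj. Qed.

Lemma series31_0 : 31%:R = 0 :> series 'F_31.
Proof.
by apply: seriesP => n; rewrite -[31%:R]mulr1 coeff_natl F31_0 mul0r.
Qed.

Lemma natr_mod31 (R : comNzRingType) m k : 31%:R = 0 :> R -> (m * 31 + k)%:R = k%:R :> R.
Proof. by move=> c31; rewrite natrD natrM c31 mulr0 add0r. Qed.

Lemma Frobenius31 (f : series 'F_31) : f ^+ 32 = f * dil 31 f.
Proof. by rewrite exprS Frobenius_series. Qed.

Lemma Delta_eisenstein4_mod31 :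
  dil 2 (Delta 'F_31 * eisenstein4 'F_31) =
  16%:R * dil 2 Phi + 2%:R * (X ^+ 16 * dil 4 Psi) - 8%:R * (Phi + alt Phi) -
    X ^+ 8 * dil 2 Psi.
Proof.
have nz2 : 2%:R != 0 :> 'F_31 by [].
have c31 := series31_0; have De := Delta_eisenstein4 nz2; rewrite /= in De.
have p32 : 2%:R ^+ 5 = 1 :> series 'F_31.
  by rewrite -natrX; exact: (@natr_mod31 _ 1 1 c31).
move: De; set DE := dil 2 _ => De.
(* [4 256 = 33 31 + 1], so that 4 inverts 256. *)
have -> : DE = 4%:R * (256%:R * DE).
  rewrite mulrA -natrM -[DE in LHS]mul1r; congr (_ * _).
  exact: esym (@natr_mod31 _ 33 1 c31).
rewrite De theta_polynomial_mod31 // phi_sqrD phi_sqrB phi_4B.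
rewrite [LHS](_ : _ = (2%:R ^+ 5) ^+ 3 * 16%:R * dil 2 phi31 ^+ 32 +
  (2%:R ^+ 5) ^+ 10 * 2%:R * (X ^+ 16 * dil 4 psi31 ^+ 32) -
  (8%:R * (phi31 ^+ 32 + alt phi31 ^+ 32) +
   (2%:R ^+ 5) ^+ 7 * (X ^+ 8 * dil 2 psi31 ^+ 32))); last by ring.
rewrite p32 !expr1n !mul1r -altX -!dilX // !Frobenius31 opprD addrA.
by [].
Qed.

Lemma coeff_mul_dil_eq0 (K : comNzRingType) m (f g : series K) n : (0 < m)%N ->
  (forall j, (m * j <= n)%N -> coeff f (n - m * j) * coeff g j = 0) ->
  coeff (f * dil m g) n = 0.
Proof.
move=> m0 fg0; rewrite mulrC coeffM big1 // => i _; rewrite coeff_dil.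
case: ifP => [/dvdnP[j e]|]; last by rewrite mul0r.
by rewrite e mulnK // mulrC [(j * m)%N]mulnC fg0 // mulnC -e -ltnS.
Qed.

Lemma coeff_mul_dil_single (K : comNzRingType) m (f g : series K) n j0 :
  (0 < m)%N -> (m * j0 <= n)%N ->
  (forall j, (m * j <= n)%N -> j <> j0 -> coeff f (n - m * j) * coeff g j = 0) ->
  coeff (f * dil m g) n = coeff f (n - m * j0) * coeff g j0.
Proof.
move=> m0 le_j0 fg0; rewrite mulrC coeffM.
have lt_j0 : (m * j0 < n.+1)%N by [].
rewrite (bigD1 (Ordinal lt_j0)) // [nat_of_ord (Ordinal _)]/= coeff_dilM //.
rewrite mulrC big1 => [|i neq_i]; first exact: addr0.
rewrite coeff_dil; case: ifP => [/dvdnP[j e]|]; last by rewrite mul0r.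
rewrite e mulnK // mulrC [(j * m)%N]mulnC fg0 //; first by rewrite mulnC -e -ltnS.
by move=> ej; case/eqP: neq_i; apply: val_inj; rewrite /= e ej mulnC.
Qed.

Lemma coeff_phi_cases (K : comNzRingType) n :
  coeff (phi K) n = 0 \/ exists x, n = (x ^ 2)%N.
Proof.
have [|nx] := pselect (exists x, n = (x ^ 2)%N); first by right.
by left; apply: coeff_phi_nonsquare => x ex; case: nx; exists x.
Qed.

Lemma coeff_psi_cases (K : comNzRingType) n :
  coeff (psi K) n = 0 \/ exists x, n = 'C(x.+1, 2).
Proof.
have [|nx] := pselect (exists x, n = 'C(x.+1, 2)); first by right.
by left; apply: coeff_psi_nontriangle => x ex; case: nx; exists x.
Qed.

Lemma coeff_Phi_eq0 n :
  (forall x y, n <> x ^ 2 + 31 * y ^ 2)%N -> coeff Phi n = 0.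
Proof.
move=> nrep; apply: coeff_mul_dil_eq0 => // j le_j.
have [->|[x ex]] := coeff_phi_cases 'F_31 (n - 31 * j); first exact: mul0r.
have [->|[y ey]] := coeff_phi_cases 'F_31 j; first exact: mulr0.
by case: (nrep x y); rewrite -ex -ey subnK.
Qed.

(** Each of the two nonzero squares is counted with both signs. *)
Lemma coeff_Phi_unique x y : (0 < x)%N -> (0 < y)%N ->
  (forall x' y', x' ^ 2 + 31 * y' ^ 2 = x ^ 2 + 31 * y ^ 2 -> y' = y)%N ->
  coeff Phi (x ^ 2 + 31 * y ^ 2) = 4%:R.
Proof.
move=> x0 y0 uniq_y; rewrite (@coeff_mul_dil_single _ 31 _ _ _ (y ^ 2)) ?leq_addl //.
  rewrite addnK !coeff_phi_square (gtn_eqF x0) (gtn_eqF y0) -natrM; exact: erefl.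
move=> j le_j neq_j.
have [->|[x' ex]] := coeff_phi_cases 'F_31 (x ^ 2 + 31 * y ^ 2 - 31 * j); first exact: mul0r.
have [->|[y' ey]] := coeff_phi_cases 'F_31 j; first exact: mulr0.
case: neq_j; rewrite ey (uniq_y x' y') //; rewrite -ex -ey subnK //.
Qed.

Lemma triangle8 k : (8 * 'C(k.+1, 2)).+1 = (k.*2.+1 ^ 2)%N.
Proof.
have := bin2 k.+1; have := odd_double_half (k.+1 * k); rewrite oddM oddS.
by rewrite andNb /=; nia.
Qed.

(** Eight times a triangular number plus 1 is an odd square. With weights 1 and 31 the added
    constant is [32 = 8 4], which explains [p - 4]. *)
Lemma coeff_Psi_eq0 p : (3 < p)%N ->
  (forall x y, odd x -> odd y -> 8 * p <> x ^ 2 + 31 * y ^ 2)%N ->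
  coeff Psi (p - 4) = 0.
Proof.
move=> p3 nrep; apply: coeff_mul_dil_eq0 => // j le_j.
have [->|[x ex]] := coeff_psi_cases 'F_31 (p - 4 - 31 * j); first exact: mul0r.
have [->|[y ey]] := coeff_psi_cases 'F_31 j; first exact: mulr0.
have := @nrep x.*2.+1 y.*2.+1; rewrite !oddS !odd_double => /(_ isT isT); case.
rewrite -!triangle8 -ex -ey; lia.
Qed.

Lemma coeff_Psi_unique p x y : odd x -> odd y -> (8 * p = x ^ 2 + 31 * y ^ 2)%N ->
  (forall x' y', odd x' -> odd y' -> 8 * p = x' ^ 2 + 31 * y' ^ 2 -> y' = y)%N ->
  coeff Psi (p - 4) = 1.
Proof.
move=> ox oy def_p uniq_y.
have [x1 y1] : (x./2.*2.+1 = x)%N /\ (y./2.*2.+1 = y)%N.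
  by rewrite -{2}(odd_double_half x) -{2}(odd_double_half y) ox oy.
have def4 : (p - 4 = 'C(x./2.+1, 2) + 31 * 'C(y./2.+1, 2))%N.
  by have := triangle8 x./2; have := triangle8 y./2; rewrite x1 y1; lia.
rewrite def4 (@coeff_mul_dil_single _ 31 _ _ _ 'C(y./2.+1, 2)) ?leq_addl //.
  by rewrite addnK !coeff_psi_triangle mulr1.
rewrite -def4 => j le_j neq_j.
have [->|[x' ex]] := coeff_psi_cases 'F_31 (p - 4 - 31 * j); first exact: mul0r.
have [->|[y' ey]] := coeff_psi_cases 'F_31 j; first exact: mulr0.
case: neq_j; rewrite ey; suff -> : (y' = y./2)%N by [].
suff : (y'.*2.+1 = y)%N by move=> <-; rewrite /= uphalf_double.
apply: (uniq_y x'.*2.+1); rewrite ?oddS ?odd_double // -!triangle8 -ex -ey.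
by have := triangle8 x./2; have := triangle8 y./2; rewrite x1 y1; lia.
Qed.

(** The coefficient is read at [2 p]. There [Phi] vanishes, as [x^2 + 31 y^2] is never 2 modulo 4,
    and so does the term in [dil 4 Psi], as 4 does not divide [2 p - 16]. *)
Lemma tau16_mod31 p : odd p -> (3 < p)%N ->
  (tau16 p)%:~R = 16%:R * coeff Phi p - coeff Psi (p - 4).
Proof.
move=> odd_p p3.
have Phi2p : coeff Phi p.*2 = 0.
  apply: coeff_Phi_eq0 => x y e.
  have: (p.*2 %% 4 = 2)%N by rewrite -(odd_double_half p) odd_p; lia.
  rewrite e -(odd_double_half x) -(odd_double_half y).
  by case: (odd x); case: (odd y); rewrite ?add1n ?add0n; lia.
have -> : (tau16 p)%:~R = coeff (of_fps 'F_31 tau16) p by [].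
rewrite of_fps_tau16 -(coeff_dilM (Delta _ * _) p (isT : 0 < 2)%N).
rewrite Delta_eisenstein4_mod31 coeffB coeffB coeffD !coeff_natl !coeffXnM.
rewrite coeff_dilM // coeffD coeff_alt mul2n Phi2p mulr0 addr0 mulr0 subr0.
have -> : (if (p.*2 < 16)%N then 0 else coeff (dil 4 Psi) (p.*2 - 16)) = 0.
  case: ltnP => // le16; rewrite coeff_dil ifF //; apply/negbTE.
  by rewrite -(odd_double_half p) odd_p in le16 *; lia.
rewrite mulr0 addr0 ifF; last by lia.
by have -> : (p.*2 - 8 = 2 * (p - 4))%N; [lia | rewrite coeff_dilM].
Qed.

End Mod31.

(** * Residues of the coefficients modulo 31, and the two equivalences *)

Lemma representation_nat (p : nat) (k X Y : int) : k * p%:Z = X ^+ 2 + 31%:R * Y ^+ 2 ->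
  k * p%:Z = (`|X|%N ^ 2 + 31 * `|Y|%N ^ 2)%N%:Z.
Proof.
have sq (x : int) : (`|x|%N ^ 2)%N%:Z = x ^+ 2 by rewrite -abszX gez0_abs ?sqr_ge0.
by move->; rewrite PoszD PoszM !sq.
Qed.

Lemma nonprime_square x : ~~ prime (x ^ 2).
Proof.
apply/negP => px; have := prime_gt1 px; case/primeP: px => _ /(_ x).
rewrite dvdn_exp // => /(_ isT)/pred2P[->|ex] //; rewrite -ex.
by case: x ex => [|[|x]] //; rewrite -mulnn mulSn; lia.
Qed.

(** Modulo 31 the coefficient is [16 4 = 2] if [p] is represented, -1 if instead [8 p] is
    represented with odd [x] and [y], and 0 otherwise. *)
Lemma tau16_mod31_representation (p : nat) : prime p ->
  ~~ (p %| 2 * 3 * 29 * 31)%N ->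
  (exists X Y : int, p%:Z = X ^+ 2 + 31%:R * Y ^+ 2) <->
  (tau16 p = 2%:R %[mod 31])%Z.
Proof.
move=> pp ndvd; have p2 := prime_gt1 pp.
have [nd2 nd3] : p != 2%N /\ p != 3%N.
  by split; apply/eqP => e; move: ndvd; rewrite e.
have op : odd p by case/even_prime: pp nd2 => ->.
have p3 : (3 < p)%N by case: p p2 nd2 nd3 {pp ndvd op} => [|[|[|[|]]]].
have -> : (tau16 p = 2%:R %[mod 31])%Z <-> (tau16 p)%:~R = 2%:R :> 'F_31.
  have chF : 31%N \in [pchar 'F_31] by exact: pchar_Fp.
  split=> [/eqP|e]; last apply/eqP.
    by rewrite eqz_mod_dvd (dvdz_pcharf chF) rmorphB subr_eq0 /= => /eqP.
  by rewrite eqz_mod_dvd (dvdz_pcharf chF) rmorphB /= e subr_eq0.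
rewrite (tau16_mod31 op p3); split.
- case=> X [Y e].
  have en : (p = `|X|%N ^ 2 + 31 * `|Y|%N ^ 2)%N.
    have := @representation_nat p 1 X Y; rewrite mul1r => /(_ e) [].
    done.
  (* Both squares must be nonzero, since the constant coefficient of [phi] is 1 and not 2. Otherwise
     [p] would be 31 or a square. *)
  have X0 : (0 < `|X|)%N.
    rewrite lt0n; apply/negP => /eqP X0; move: en; rewrite X0 add0n => en.
    have : (31 %| p)%N by rewrite en dvdn_mulr.
    by rewrite dvdn_prime2 // => /eqP p31; move: ndvd; rewrite -p31 dvdn_mull.
  have Y0 : (0 < `|Y|)%N.
    rewrite lt0n; apply/negP => /eqP Y0; move: en; rewrite Y0 addn0 => en.
    by move: (nonprime_square `|X|%N); rewrite -en pp.
  rewrite en coeff_Phi_unique //; last first.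
    by move=> x y ex; apply: (@representation_unique p `|X| `|Y| x y)%N => //; rewrite ex.
  rewrite -en (coeff_Psi_eq0 p3); last first.
    move=> x y ox oy e8.
    apply: (@representations_exclusive p X Y x y) => //; lia.
  by apply/val_inj.
- move=> tau2.
  have [[X [Y e]]|nrep] := pselect (exists X Y : int, p%:Z = X ^+ 2 + 31%:R * Y ^+ 2).
    by exists X, Y.
  exfalso; move: tau2; rewrite coeff_Phi_eq0; last first.
    by move=> x y e; case: nrep; exists x%:Z, y%:Z; lia.
  have [[x [y [ox oy e]]]|nrep8] :=
    pselect (exists x y, [/\ odd x, odd y & 8 * p = x ^ 2 + 31 * y ^ 2])%N.
    rewrite (coeff_Psi_unique ox oy e) => [|x' y' ox' oy' e']; last first.
      exact: (@representation8_unique p x y x' y').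
    move=> e2; have /eqP : 3%:R = 0 :> 'F_31.
      by rewrite (natrD _ 2 1) -e2 mulr0 sub0r addNr.
    by [].
  rewrite (coeff_Psi_eq0 p3) => [|x y ox oy e]; first by rewrite mulr0 subr0 => /esym/eqP.
  by case: nrep8; exists x, y.
Qed.

Theorem corollary12 (p : nat) (p_prime : prime p)
    (p_ndvd : ~~ (p %| 2 * 3 * 29 * 31)%N) :
  ((C p = 0 %[mod p])%Z <->
     (exists X Y : int, p%:Z = X ^+ 2 + 31%:R * Y ^+ 2)) /\
  ((exists X Y : int, p%:Z = X ^+ 2 + 31%:R * Y ^+ 2) <->
     (tau16 p = 2%:R %[mod 31])%Z).
Proof.
split; last exact: tau16_mod31_representation.
have neq q : (q %| 2 * 3 * 29 * 31)%N -> p != q.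
  by move=> qd; apply: contraNneq p_ndvd => ->.
have [p2 p3 p29 p31] := And4 (neq 2%N isT) (neq 3%N isT) (neq 29%N isT) (neq 31%N isT).
have op : odd p by case/even_prime: p_prime p2 => ->.
have -> : (C p = 0 %[mod p])%Z <-> (p %| C p)%Z.
  have := eqz_mod_dvd p (C p) 0; rewrite subr0 => <-; exact: (rwP eqP).
split=> [pC | [X [Y e]]]; last first.
  have [u [v rep]] := principal_odd_representation p_prime p2 e.
  by rewrite (C_dvd_odd_representation p_prime p2 p3 p29 p31 _ rep).
have [s ps] := C_dvd_disc p_prime p3 p29 p31 pC.
case: (split_prime_forms p_prime op ps) => // -[x [y [e ox oy]]].
have [k [u [v [k0 k3 rep]]]] := nonprincipal_odd_representation p_prime e ox oy.
by rewrite (C_dvd_odd_representation p_prime p2 p3 p29 p31 k0 rep) (negPf k3) in pC.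
Qed.
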